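(* Fix an integer $\ell \geq 2$. There is an algorithm that, given an instance $(G,k)$ of $\mathcal{L}_\ell$-Cluster Editing$(k)$, where $G$ has $n$ vertices and $m$ edges, runs in $O(n+m)$ time and outputs an equivalent instance $(G_k,k')$ with $k' \leq k$ (that is, $(G,k)$ is a yes-instance if and only if $(G_k,k')$ is a yes-instance) such that $G_k$ has $O(\ell k^2)$ vertices. In other words, $\mathcal{L}_\ell$-Cluster Editing$(k)$ admits a problem kernel with $O(\ell k^2)$ vertices computable in $O(n+m)$ time.
   Context: All graphs are finite, simple and undirected. A clique is a complete graph. For an integer $\ell \geq 2$, an $\ell$-clique is a connected complete $\ell$-partite graph (so a connected graph whose vertex set can be partitioned into at most $\ell$ independent sets with all edges present between different sets). Let $\mathcal{K}$ be the family of cliques, $\mathcal{K}_\ell$ the family of $\ell$-cliques, and $\mathcal{L}_\ell = \mathcal{K} \cup \mathcal{K}_\ell$. An $\mathcal{L}_\ell$-cluster graph is a graph each of whose connected components is a clique or an $\ell$-clique. An edition set $F$ for a graph $G$ is a set of unordered pairs of distinct vertices of $G$, no pair occurring twice, each marked either $-$ (the pair is an edge of $G$, to be deleted) or $+$ (the pair is a non-edge of $G$, to be added); $G+F$ denotes the graph obtained from $G$ by performing these deletions and additions, and $|F|$ is the number of edge editions. The problem $\mathcal{L}_\ell$-Cluster Editing$(k)$ (parameterized by $k$): given a graph $G$ and a nonnegative integer $k$, decide whether there is an edition set $F$ with $|F| \leq k$ such that $G+F$ is an $\mathcal{L}_\ell$-cluster graph. *)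

(* Defs.v *)
From mathcomp Require Import all_boot.

Set Implicit Arguments.
Unset Strict Implicit.
Unset Printing Implicit Defensive.

(** * Graphs and cluster editing *)

Record sgraph (T : finType) := SGraph {
  adj :> rel T;
  adj_sym : symmetric adj;
  adj_irr : irreflexive adj }.

Section Graphs.
Variable T : finType.
Implicit Types (G : sgraph T) (A : {set T}) (F : {set {set T} * bool}).

Definition edges G : {set {set T}} :=
  [set [set p.1; p.2] | p : T * T & G p.1 p.2].

Definition components G : {set {set T}} :=
  [set [set y | connect G x y] | x : T].

(* The predicates below speak about the subgraph of G induced by A. *)
Definition connected_in G A : Prop :=
  {in A &, forall x y,
     connect [rel u v | [&& u \in A, v \in A & G u v]] x y}.

Definition clique G A : Prop := {in A &, forall x y, x != y -> G x y}.

Definition independent G A : Prop := {in A &, forall x y, ~~ G x y}.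

Definition lclique (l : nat) G A : Prop :=
  connected_in G A /\
  exists P : {set {set T}},
    [/\ partition P A, #|P| <= l,
        forall B, B \in P -> independent G B &
        forall B B', B \in P -> B' \in P -> B != B' ->
          {in B & B', forall x y, G x y}].

Definition cluster_graph (l : nat) G : Prop :=
  forall A, A \in components G -> clique G A \/ lclique l G A.

(* The mark [true] stands for + (addition), [false] for - (deletion). *)
Definition edition_set G F : Prop :=
  {in F &, injective fst} /\
  forall A b, (A, b) \in F -> #|A| = 2 /\ (A \in edges G) = ~~ b.

(* For an edition set F the guard [x != y] is redundant; it makes [edit] total
   on arbitrary F. *)
Definition edit_rel G F : rel T := fun x y =>
  (x != y) &&
  ((([set x; y] \in edges G) && (([set x; y], false) \notin F))
   || (([set x; y], true) \in F)).

Lemma edit_sym G F : symmetric (edit_rel G F).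
Proof. by move=> x y; rewrite /edit_rel eq_sym setUC. Qed.

Lemma edit_irr G F : irreflexive (edit_rel G F).
Proof. by move=> x; rewrite /edit_rel eqxx. Qed.

Definition edit G F : sgraph T := SGraph (edit_sym G F) (edit_irr G F).

Definition yes_instance (l : nat) G (k : nat) : Prop :=
  exists F, [/\ edition_set G F, #|F| <= k & cluster_graph l (edit G F)].

End Graphs.

(** * Random access machine *)

(* Programs of a word RAM, in structured form.  The store consists of registers
   and of arrays of cells; a program names finitely many of both, by literals.
   The only arithmetic is addition and truncated subtraction. *)
Inductive expr :=
| Cst of nat
| Reg of nat
| Get of nat & expr
| Plus of expr & expr
| Minus of expr & expr.

(* Tests have the form [e1 <= e2]. *)
Inductive cmd :=
| Skip
| Asg of nat & expr
| Put of nat & expr & expr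
| Seq of cmd & cmd
| If of expr & expr & cmd & cmd
| While of expr & expr & cmd.

Record state := State { regs : nat -> nat; arrs : nat -> nat -> nat }.

Definition upd (V : Type) (f : nat -> V) (i : nat) (v : V) : nat -> V :=
  fun j => if j == i then v else f j.

Definition set_reg (s : state) (x v : nat) : state :=
  State (upd (regs s) x v) (arrs s).

Definition set_arr (s : state) (a i v : nat) : state :=
  State (regs s) (upd (arrs s) a (upd (arrs s a) i v)).

Fixpoint eval (s : state) (e : expr) : nat :=
  match e with
  | Cst c => c
  | Reg x => regs s x
  | Get a e1 => arrs s a (eval s e1)
  | Plus e1 e2 => eval s e1 + eval s e2
  | Minus e1 e2 => eval s e1 - eval s e2
  end.

(* Every value met while evaluating e fits in a machine word, i.e. is at most
   W; array indices are such values, so W also bounds the addressable memory. *)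
Fixpoint fits (W : nat) (s : state) (e : expr) : bool :=
  (eval s e <= W) &&
  match e with
  | Cst _ | Reg _ => true
  | Get _ e1 => fits W s e1
  | Plus e1 e2 | Minus e1 e2 => fits W s e1 && fits W s e2
  end.

Fixpoint ecost (e : expr) : nat :=
  match e with
  | Cst _ | Reg _ => 1
  | Get _ e1 => (ecost e1).+1
  | Plus e1 e2 | Minus e1 e2 => (ecost e1 + ecost e2).+1
  end.

(* [exec W p s t s']: with word bound W, program p started in s halts in s'
   after t elementary steps, without overflow.  The relation is deterministic
   and has no derivation when p diverges or overflows. *)
Inductive exec (W : nat) : cmd -> state -> nat -> state -> Prop :=
| ExecSkip s : exec W Skip s 1 s
| ExecAsg s x e : fits W s e ->
    exec W (Asg x e) s (ecost e).+1 (set_reg s x (eval s e))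
| ExecPut s a e1 e2 : fits W s e1 -> fits W s e2 ->
    exec W (Put a e1 e2) s (ecost e1 + ecost e2).+1
         (set_arr s a (eval s e1) (eval s e2))
| ExecSeq s1 s2 s3 c1 c2 t1 t2 :
    exec W c1 s1 t1 s2 -> exec W c2 s2 t2 s3 ->
    exec W (Seq c1 c2) s1 (t1 + t2) s3
| ExecIfT s s' e1 e2 c1 c2 t : fits W s e1 -> fits W s e2 ->
    eval s e1 <= eval s e2 -> exec W c1 s t s' ->
    exec W (If e1 e2 c1 c2) s (ecost e1 + ecost e2 + t).+1 s'
| ExecIfF s s' e1 e2 c1 c2 t : fits W s e1 -> fits W s e2 ->
    eval s e2 < eval s e1 -> exec W c2 s t s' ->
    exec W (If e1 e2 c1 c2) s (ecost e1 + ecost e2 + t).+1 s'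
| ExecWhileT s s1 s2 e1 e2 c t1 t2 : fits W s e1 -> fits W s e2 ->
    eval s e1 <= eval s e2 -> exec W c s t1 s1 ->
    exec W (While e1 e2 c) s1 t2 s2 ->
    exec W (While e1 e2 c) s (ecost e1 + ecost e2 + t1 + t2).+1 s2
| ExecWhileF s e1 e2 c : fits W s e1 -> fits W s e2 ->
    eval s e2 < eval s e1 ->
    exec W (While e1 e2 c) s (ecost e1 + ecost e2).+1 s.

(* Array 0 holds the input word sequence, array 1 receives the output. *)
Definition input_state (w : seq nat) : state :=
  State (fun _ => 0) (fun a i => if a == 0 then nth 0 w i else 0).

Definition output_is (s : state) (w : seq nat) : Prop :=
  forall i, i < size w -> arrs s 1 i = nth 0 w i.

(* Adjacency-list encoding of (G, k): the words n and k, and then, for each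
   vertex v = 0, ..., n-1, the degree of v followed by the neighbours of v
   in an arbitrary order. *)
Definition encodes (n : nat) (G : sgraph 'I_n) (k : nat) (w : seq nat) : Prop :=
  exists nb : 'I_n -> seq 'I_n,
    (forall v, uniq (nb v) /\ nb v =i G v) /\
    w = n :: k :: flatten [seq size (nb v) :: map val (nb v) | v <- enum 'I_n].

(* Main.v *)
(** A graph is an L_l-cluster graph iff its vertices carry labels c, p such that
    x, y are adjacent iff c x = c y and p x <> p y, and on each class of c either
    p is injective or p takes at most l values.

    The kernel is obtained by removing the components that are already cliques or
    l-cliques and truncating the classes of false twins to 2k+2 vertices and the
    classes of true twins to 2k+l+1.  A solution touches at most 2k vertices, so
    a truncated class still has untouched members, next to which the labels of the
    deleted twins can be put back.  Conversely, if there is a solution then every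
    label class of c meeting the kernel contains a touched vertex, and its
    untouched vertices form one class of true twins or at most l classes of false
    twins; this bounds the kernel by 2k + 2k l (2k+2), and a larger one is replaced
    by a path on four vertices with k = 0.

    For linear time, twin classes are computed by splitting labels along each
    neighbourhood.  No search is needed to find the components: those to be removed
    have diameter at most 2, so r2 v, the least vertex within distance 2 of v, is
    constant on them, and v lies in a connected complete multipartite component iff
    r2 is constant along edges and deg v plus the number of false twins of v is the
    number of vertices sharing r2 v. *)

Require Import Defs.
From mathcomp Require Import all_boot zify.

Set Implicit Arguments.
Unset Strict Implicit.
Unset Printing Implicit Defensive.

(** * Cluster graphs and labellings *)

(** The labels remove connectivity from the problem: a class of [c] on which [p] is constant is just
    a set of isolated vertices. Labellings therefore restrict to arbitrary vertex sets, and each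
    reduction rule becomes a statement about reinserting one vertex. The truncation constants count
    the untouched twins that a reinsertion needs. Among [2k+2] false twins two are untouched; one
    would not suffice, because repeating its label could destroy the injectivity of [p]. Among
    [2k+l+1] true twins [l+1] are untouched, too many values for a class limited to [l], so [p] is
    injective there and tolerates a fresh value. Twins are always those of the input graph, never of
    a truncated one, so each kind of twin class is computed only once. When labels are split along a
    neighbourhood, every label is stamped with the pivot that last split it. Nothing has to be reset
    between pivots, so the cost is constant per adjacency entry. *)

Section PairCounting.
Variable T : finType.
Implicit Types D : {set T * T}.

Definition upairs D : {set {set T}} := [set [set q.1; q.2] | q in D].

Lemma set2_inj (x y a b : T) :
  [set x; y] = [set a; b] -> (x, y) = (a, b) \/ (x, y) = (b, a).
Proof.
move=> e.
have xin : x \in [set a; b] by rewrite -e !inE eqxx.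
have yin : y \in [set a; b] by rewrite -e !inE eqxx orbT.
have ain : a \in [set x; y] by rewrite e !inE eqxx.
have bin : b \in [set x; y] by rewrite e !inE eqxx orbT.
move: xin yin ain bin; rewrite !inE.
by case/orP=> /eqP ?; case/orP=> /eqP ?; case/orP=> /eqP ?; case/orP=> /eqP ?; subst; auto.
Qed.

Lemma card_upairs_fibers D :
  #|D| = \sum_(A in upairs D) #|[set q in D | [set q.1; q.2] == A]|.
Proof.
rewrite -sum1_card (partition_big_imset (fun q => [set q.1; q.2])) /=.
by apply: eq_bigr => A _; rewrite -sum1_card; apply: eq_bigl => q; rewrite !inE.
Qed.

Lemma card_le_double_upairs D : #|D| <= 2 * #|upairs D|.
Proof.
rewrite card_upairs_fibers mulnC -sum_nat_const; apply: leq_sum => A.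
case/imsetP => -[a b] _ ->; apply: (@leq_trans #|[set (a, b); (b, a)]|).
  apply/subset_leq_card/subsetP => -[x y]; rewrite !inE /= => /andP[_ /eqP].
  by case/set2_inj => ->; rewrite eqxx ?orbT.
by rewrite cards2; case: (_ != _).
Qed.

(** In a symmetric set without diagonal each unordered pair occurs in both orders. This turns a
    budget of [2 * k] ordered differences into [k] edits. *)
Lemma double_upairs_le_card D :
  (forall x y, (x, y) \in D -> x != y /\ (y, x) \in D) ->
  2 * #|upairs D| <= #|D|.
Proof.
move=> symD; rewrite card_upairs_fibers mulnC -sum_nat_const.
apply: leq_sum => A /imsetP[[a b] abD ->].
have [neq baD] := symD _ _ abD.
apply: (@leq_trans #|[set (a, b); (b, a)]|).
  by rewrite cards2 xpair_eqE negb_and neq.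
apply/subset_leq_card/subsetP => q; rewrite !inE => /orP[]/eqP-> /=.
  by rewrite abD eqxx.
by rewrite baD setUC eqxx.
Qed.

Lemma card_edges_pairs (G : sgraph T) :
  #|[set q : T * T | G q.1 q.2]| <= 2 * #|edges G|.
Proof.
apply: leq_trans (card_le_double_upairs _) _; rewrite leq_mul2l /=.
apply/subset_leq_card/subsetP => A /imsetP[q qG ->].
by apply/imsetP; exists q => //; rewrite inE in qG.
Qed.

Lemma mem_edges (G : sgraph T) x y : ([set x; y] \in edges G) = G x y.
Proof.
apply/imsetP/idP => [[[a b]] /=|xy]; last by exists (x, y); rewrite ?inE.
by rewrite inE /= => ab /set2_inj[] [-> ->] //; rewrite adj_sym.
Qed.

End PairCounting.

Lemma card_le_sum_fibers (T I : finType) (Y : {set T}) (B : {set I})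
    (f : I -> {set T}) :
  {in Y, forall v, exists2 b, b \in B & v \in f b} ->
  #|Y| <= \sum_(b in B) #|f b|.
Proof.
move=> cov; apply: (@leq_trans #|\bigcup_(b in B) f b|).
  by apply/subset_leq_card/subsetP => v /cov[b bB vb]; apply/bigcupP; exists b.
rewrite -!big_enum /=; elim: (enum B) => [|b s IH]; first by rewrite !big_nil cards0.
rewrite !big_cons; apply: leq_trans (leq_card_setU _ _) _; by rewrite leq_add2l.
Qed.

(** * Labellings, reinsertion of twins, and the size bound *)

Section Labellings.
Variables (T : finType) (l : nat).
Implicit Types (G : sgraph T) (Y X Z B : {set T}).

Definition lrel (L : eqType) (c p : T -> L) : rel T :=
  fun x y => (c x == c y) && (p x != p y).

(** Since [L] is an arbitrary [eqType], the number of values of [p] is bounded by a set [B] of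
    representatives. A free label type can be enlarged by [option] or by a sum when labellings are
    extended or combined. *)
Definition lvalid (L : eqType) Y (c p : T -> L) : Prop :=
  forall z, {in [set x in Y | c x == z] &, injective p} \/
    exists B : {set T}, [/\ #|B| <= l, B \subset [set x in Y | c x == z] &
      {in [set x in Y | c x == z], forall x, exists2 b, b \in B & p b = p x}].

Definition ldiff G (L : eqType) Y (c p : T -> L) : {set T * T} :=
  [set q in setX Y Y | G q.1 q.2 != lrel c p q.1 q.2].

(* Ordered pairs are counted, hence the factor 2. *)
Definition yes_on G Y k : Prop :=
  exists (L : eqType) (c p : T -> L),
    lvalid Y c p /\ #|ldiff G Y c p| <= 2 * k.

Lemma cover_card (L : eqType) (p : T -> L) (U B : {set T}) :
  {in U &, injective p} ->
  {in U, forall x, exists2 b, b \in B & p b = p x} -> #|U| <= #|B|.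
Proof.
move=> injp cov.
have uq : uniq (map p (enum U)).
  rewrite map_inj_in_uniq ?enum_uniq // => x y; rewrite !mem_enum.
  exact: injp.
rewrite !cardE -(size_map p (enum U)) -(size_map p (enum B)).
apply: uniq_leq_size => // q /mapP[x]; rewrite mem_enum => xU ->.
have [b bB <-] := cov x xU; apply/mapP; exists b => //; by rewrite mem_enum.
Qed.

(** Each useful representative is exchanged for a vertex of [A] with the same value. This makes
    [lvalid] hereditary under shrinking the vertex set. *)
Lemma cover_shrink (L : eqType) (p : T -> L) (A B : {set T}) :
  {in A, forall x, exists2 b, b \in B & p b = p x} ->
  exists B' : {set T}, [/\ #|B'| <= #|B|, B' \subset A &
    {in A, forall x, exists2 b, b \in B' & p b = p x}].
Proof.
move=> cov; pose B1 := [set b in B | [exists x in A, p x == p b]].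
pose f b := odflt b [pick x in A | p x == p b].
have fP b : b \in B1 -> f b \in A /\ p (f b) = p b.
  rewrite inE => /andP[_ /exists_inP[x xA e]]; rewrite /f.
  by case: pickP => [y /andP[? /eqP ?]|/(_ x)] //=; rewrite xA e.
exists (f @: B1); split.
- apply: leq_trans (leq_imset_card _ _) _; apply/subset_leq_card/subsetP => b.
  by rewrite inE => /andP[].
- by apply/subsetP => y /imsetP[b /fP[? _] ->].
move=> x xA; have [b bB e] := cov x xA.
have b1 : b \in B1 by rewrite inE bB; apply/exists_inP; exists x; rewrite ?e.
by exists (f b); [exact: imset_f | rewrite (fP b b1).2].
Qed.

Lemma lrel_sym (L : eqType) (c p : T -> L) : symmetric (lrel c p).
Proof. by move=> x y; rewrite /lrel eq_sym [p x == _]eq_sym. Qed.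

Lemma lrel_irr (L : eqType) (c p : T -> L) : irreflexive (lrel c p).
Proof. by move=> x; rewrite /lrel !eqxx. Qed.

Lemma connect_gsym G : connect_sym G.
Proof. by apply: sym_connect_sym => x y; rewrite adj_sym. Qed.

(* In a good component non-adjacency is an equivalence relation; [part G]
   picks a representative of each of its classes. *)
Definition part G x := odflt x [pick y | connect G x y && ~~ G x y].

(** In a clique non-adjacency is equality, and in an [l]-clique it means lying in the same block. *)
Lemma cluster_nonadj_trans G : cluster_graph l G -> forall x y z,
  connect G x y -> connect G x z -> ~~ G x y -> ~~ G y z -> ~~ G x z.
Proof.
move=> cg x y z cxy cxz nxy nyz.
have Ax : [set y | connect G x y] \in components G by apply: imset_f.
case: (cg _ Ax) => [cl|[_ [P [partP _ indep compl]]]].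
  have [?|ne] := eqVneq x y; first by subst.
  by have := cl x y; rewrite !inE connect0 cxy ne => /(_ isT isT isT) G1; rewrite G1 in nxy.
have [/eqP covP tiP _] := and3P partP.
have inb u : connect G x u -> exists2 B, B \in P & u \in B.
  move=> cu; have : u \in cover P by rewrite covP inE.
  by case/bigcupP => B; exists B.
have sameb u v B B' : B \in P -> B' \in P -> u \in B -> v \in B' ->
   ~~ G u v -> B = B'.
  move=> BP BP' uB vB nuv; apply/eqP/negPn/negP => ne.
  by rewrite (compl _ _ BP BP' ne) in nuv.
have [B1 B1P xB] := inb _ (connect0 _ _).
have [B2 B2P yB] := inb _ cxy; have [B3 B3P zB] := inb _ cxz.
have e1 := sameb _ _ _ _ B1P B2P xB yB nxy.
have e2 := sameb _ _ _ _ B2P B3P yB zB nyz.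
by apply: (indep B1) => //; rewrite e1 e2.
Qed.

Lemma partP G x : connect G x (part G x) && ~~ G x (part G x).
Proof.
rewrite /part; case: pickP => [y //|/(_ x)] /=.
by rewrite connect0 adj_irr.
Qed.

Lemma cluster_labels G : cluster_graph l G ->
  lvalid setT (root G) (part G) /\ lrel (root G) (part G) =2 G.
Proof.
move=> cg; have tr := cluster_nonadj_trans cg; have sy := connect_gsym G.
have partE x y : connect G x y -> (part G x == part G y) = ~~ G x y.
  move=> cxy; apply/eqP/idP => [e|nxy].
    have /andP[c1 n1] := partP G x; have /andP[c2 n2] := partP G y.
    apply: (tr x (part G x)) => //; by rewrite e adj_sym.
  (* [pick] depends only on the extension of its predicate, so it is enough that [x] and [y] have
     the same non-neighbours in their component. *)
  rewrite /part.
  have e : (fun z => connect G x z && ~~ G x z) =1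
           (fun z => connect G y z && ~~ G y z).
    move=> z; rewrite -(same_connect sy cxy); case cz: (connect G x z) => //=.
    apply/idP/idP => n1.
      by apply: (tr y x) => //; [rewrite sy | rewrite sy (connect_trans _ cxy) // sy | rewrite adj_sym].
    by apply: (tr x y).
  rewrite (eq_pick e); case: pickP => // /(_ y).
  by rewrite connect0 adj_irr.
split; last first.
  move=> x y; rewrite /lrel root_connect //.
  case cxy: (connect G x y) => /=; first by rewrite partE ?negbK.
  by symmetry; apply/negbTE/negP => /connect1; rewrite cxy.
move=> z; set A := [set x in _ | _].
have [x xA|A0] := pickP (mem A); last by left=> x y; have := A0 x => /= ->.
have AE : A = [set y | connect G x y].
  apply/setP => y; move: xA; rewrite !inE /= => /eqP <-.
  by rewrite eq_sym root_connect.
have Ax : A \in components G by rewrite AE; apply: imset_f.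
have cA u v : u \in A -> v \in A -> connect G u v.
  rewrite AE !inE => c1 c2; by rewrite (connect_trans _ c2) // sy.
case: (cg _ Ax) => [cl|[_ [P [ptP cP indep compl]]]].
  left => u v uA vA e; apply/eqP/negPn/negP => ne.
  have := cl u v uA vA ne; apply/negP; rewrite -partE ?e ?eqxx //.
  exact: cA.
right; have [/eqP covP tiP n0] := and3P ptP.
(* One vertex per block; the default [x] could only serve an empty block, and it lies in [A]
   anyway. *)
exists [set odflt x [pick y in B] | B : {set T} in P]; split.
- by apply: leq_trans (leq_imset_card _ _) cP.
- apply/subsetP => _ /imsetP[B BP ->]; case: pickP => [y yB|_] //=.
  by rewrite -/A -covP; apply/bigcupP; exists B.
move=> u uA; have : u \in cover P by rewrite covP.
case/bigcupP => B BP uB.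
exists (odflt x [pick y in B]); first exact: imset_f.
case: pickP => [y yB|/(_ u)] /=; last by rewrite uB.
apply/eqP; rewrite partE; first exact: (indep B).
apply: cA => //; rewrite -covP; by apply/bigcupP; exists B.
Qed.

(** A class of [c] with constant [p] consists of isolated vertices. Any other class is a single
    component, because two of its vertices with equal [p] have a common neighbour; its blocks are
    the fibres of [p]. *)
Lemma labels_cluster (L : eqType) (c p : T -> L) G :
  lvalid setT c p -> lrel c p =2 G -> cluster_graph l G.
Proof.
move=> val eG A /imsetP[x _ ->]; set A' := [set y | _].
have cE y : connect G x y -> c y = c x.
  move/connectP => [s]; elim: s x {A'} => [|a s IH] x /= => [_ -> //|].
  by case/andP; rewrite -eG => /andP[/eqP -> _] /IH h /h.
have [x' xx'|iso] := pickP (G x); last first.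
  left; have A1 y : y \in A' -> y = x.
    rewrite inE => /connectP[[|a s] /= ]; first by [].
    by rewrite iso.
  by move=> u v /A1-> /A1->; rewrite eqxx.
have [/eqP cx' px'] : c x == c x' /\ p x != p x'.
  by apply/andP; have := xx'; rewrite -eG.
(* A vertex of the class that differs from [x] in [p] is adjacent to [x]; one that agrees with [x]
   is adjacent to [x']. *)
have cA u : (u \in A') = (c u == c x).
  rewrite inE; apply/idP/eqP => [/cE//|e].
  have [pe|pne] := eqVneq (p u) (p x).
    apply: connect_trans (connect1 xx') _; apply: connect1.
    by rewrite -eG /lrel e cx' eqxx pe eq_sym.
  by apply: connect1; rewrite -eG /lrel e eqxx eq_sym.
have other u : u \in A' -> exists2 v, v \in A' & p u != p v.
  move=> uA; have [pe|pne] := eqVneq (p u) (p x); last first.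
    by exists x; rewrite // inE connect0.
  by exists x'; [rewrite cA cx' | rewrite pe].
case: (val (c x)) => [inj|[B [cB sB cov]]].
  left=> u v uA vA ne; rewrite -eG /lrel.
  move: (uA) (vA); rewrite !cA => /eqP-> /eqP->; rewrite eqxx /=.
  by apply: contra ne => /eqP/inj->; rewrite ?inE -?cA ?uA ?vA.
right; split.
  move=> u v uA vA; set R := (X in connect X).
  have R1 a b : a \in A' -> b \in A' -> p a != p b -> R a b.
    move=> aA bA ne; rewrite /R /= aA bA -eG /lrel ne andbT /=.
    by move: aA bA; rewrite !cA => /eqP-> /eqP->.
  have [pe|pne] := eqVneq (p u) (p v); last exact/connect1/R1.
  have [w wA ne] := other u uA.
  apply: connect_trans (connect1 (R1 _ _ uA wA ne)) _.
  by apply/connect1/R1 => //; rewrite -pe eq_sym.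
pose bl b := [set y in A' | p b == p y].
exists (preim_partition p A'); split.
- exact: preim_partitionP.
- apply: leq_trans cB; apply: leq_trans (leq_imset_card bl _).
  apply/subset_leq_card/subsetP => D /imsetP[u uA ->].
  have [b bB e] : exists2 b, b \in B & p b = p u.
    by apply: cov; rewrite !inE /= -cA.
  by apply/imsetP; exists b => //; rewrite /bl; apply/setP => y; rewrite !inE e.
- move=> D /imsetP[u uA ->] a b; rewrite !inE => /andP[_ /eqP e] /andP[_ /eqP e'].
  by rewrite -eG /lrel -e -e' eqxx andbF.
move=> D D' /imsetP[u uA ->] /imsetP[v vA ->] ne a b.
rewrite !inE => /andP[aA /eqP ea] /andP[bA /eqP eb].
rewrite -eG /lrel; apply/andP; split.
  rewrite (cE a aA) (cE b bA) //.
apply: contraNneq ne => e; apply/eqP/setP => y.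
by rewrite !inE ea eb e.
Qed.

Lemma yes_instanceE G k : yes_instance l G k <-> yes_on G setT k.
Proof.
split.
  case=> F [[injF edF] cF cg].
  have [val eG] := cluster_labels cg.
  exists T, (root (edit G F)), (part (edit G F)); split=> //.
  apply: leq_trans (card_le_double_upairs _) _; rewrite leq_mul2l /=.
  apply: leq_trans cF; apply: leq_trans (leq_imset_card fst _).
  apply/subset_leq_card/subsetP => A /imsetP[[x y]].
  rewrite !inE /= eG /= /edit_rel mem_edges => ne ->.
  have [f|f] := boolP (([set x; y], true) \in F).
    by apply/imsetP; exists ([set x; y], true).
  have [g|g] := boolP (([set x; y], false) \in F).
    by apply/imsetP; exists ([set x; y], false).
  rewrite (negbTE f) g orbF andbT in ne.
  by case: (eqVneq x y) ne => [->|_]; rewrite ?adj_irr ?eqxx.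
case=> L [c [p [val cD]]].
pose D := ldiff G setT c p.
have DE x y : ((x, y) \in D) = (G x y != lrel c p x y) by rewrite !inE.
have Dne x y : (x, y) \in D -> x != y.
  by rewrite DE; apply: contraNneq => ->; rewrite adj_irr lrel_irr.
(* The mark of an edit is the adjacency that the labels ask for. *)
pose g (q : T * T) := ([set q.1; q.2], lrel c p q.1 q.2).
have gE x y a b : [set x; y] = [set a; b] -> lrel c p x y = lrel c p a b.
  by case/set2_inj => -[-> ->] //; rewrite lrel_sym.
pose F := [set g q | q in D].
have FE x y b : (([set x; y], b) \in F) = ((x, y) \in D) && (b == lrel c p x y).
  apply/imsetP/andP => [[[a a'] aD [e ->]]|[xyD /eqP->]]; last by exists (x, y).
  rewrite (gE _ _ _ _ e) eqxx; split=> //.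
  case/set2_inj: e => -[-> ->] //; move: aD.
  by rewrite !DE lrel_sym adj_sym.
exists F; split.
- split.
    move=> _ _ /imsetP[[x y] _ ->] /imsetP[[a b] _ ->] /= e.
    by rewrite /g /= e (gE _ _ _ _ e).
  move=> A b /imsetP[[x y] xyD [-> ->]] /=.
  rewrite cards2 (Dne _ _ xyD) mem_edges; split=> //.
  by move: xyD; rewrite DE; case: (G x y); case: (lrel c p x y).
- have h : 2 * #|upairs D| <= #|D|.
    apply: double_upairs_le_card => x y xyD; split; first exact: Dne.
    by move: xyD; rewrite !DE lrel_sym adj_sym.
  rewrite -(leq_pmul2l (isT : 0 < 2)); apply: leq_trans cD.
  apply: leq_trans h; rewrite leq_mul2l /=.
  (* The mark can be recovered from the unordered pair alone, so [F] is an image of [upairs D]. *)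
  apply: leq_trans (leq_imset_card (fun A => (A, [exists x, exists y, (A == [set x; y]) && lrel c p x y])) _).
  apply/subset_leq_card/subsetP => q /imsetP[[x y] xyD ->]; apply/imsetP.
  exists [set x; y]; first by apply/imsetP; exists (x, y).
  congr pair; apply/idP/existsP => /= [xy|[a /existsP[b /andP[/eqP/gE-> //]]]].
  by exists x; apply/existsP; exists y; rewrite eqxx.
apply: (labels_cluster val) => x y /=; rewrite /edit_rel mem_edges !FE DE.
have [->|ne] /= := eqVneq x y; first by rewrite lrel_irr.
by case: (G x y); case: (lrel c p x y).
Qed.

Lemma yes_on_sub G Y Y' k : Y' \subset Y -> yes_on G Y k -> yes_on G Y' k.
Proof.
move=> sY [L [c [p [val cD]]]]; exists L, c, p; split.
  move=> z; have sub x : x \in [set x in Y' | c x == z] -> x \in [set x in Y | c x == z].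
    by rewrite !inE => /andP[/(subsetP sY)-> ->].
  case: (val z) => [inj|[B [cB sB cov]]]; [left|right].
    by move=> x y /sub ? /sub ?; apply: inj.
  have [B' [cB' sB' cov']] : exists B' : {set T}, [/\ #|B'| <= #|B|,
      B' \subset [set x in Y' | c x == z] &
      {in [set x in Y' | c x == z], forall x, exists2 b, b \in B' & p b = p x}].
    by apply: cover_shrink => x /sub; apply: cov.
  by exists B'; split=> //; apply: leq_trans cB' cB.
apply: leq_trans cD; apply/subset_leq_card/subsetP => q.
rewrite !inE => /andP[/andP[/(subsetP sY)-> /(subsetP sY)->]] //.
Qed.

(** Differences come in both orders, so the first coordinates already are all the endpoints, and
    there are at most [2 * k] of them. *)
Definition touched G (L : eqType) Y (c p : T -> L) : {set T} :=
  [set q.1 | q in ldiff G Y c p].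

Lemma card_touched G (L : eqType) Y (c p : T -> L) :
  #|touched G Y c p| <= #|ldiff G Y c p|.
Proof. exact: leq_imset_card. Qed.

Lemma untouchedE G (L : eqType) Y (c p : T -> L) x y :
  x \notin touched G Y c p -> x \in Y -> y \in Y -> G x y = lrel c p x y.
Proof.
move=> nx xY yY; apply/eqP/negPn/negP => ne; case/negP: nx.
by apply/imsetP; exists (x, y); rewrite ?inE ?xY ?yY.
Qed.

(** Two twins [u], [u'] of [v] are untouched, and [v] receives the labels of [u]. The only danger is
    that [p] was injective on that class; the second twin shows that the class can be covered by at
    most [l] values. *)
Lemma yes_on_add_false_twin G Y v k : 0 < l -> v \notin Y ->
  2 * k + 2 <= #|[set u in Y | [forall x, G u x == G v x]]| ->
  yes_on G Y k -> yes_on G (v |: Y) k.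
Proof.
move=> l0 vY; set Q := [set u in Y | _] => cQ [L [c [p [val cD]]]].
pose S := touched G Y c p.
have : 1 < #|Q :\: S|.
  have := cardsD Q S; have := subset_leq_card (subsetIr Q S).
  by have := card_touched G Y c p; rewrite -/S; lia.
case/card_gt1P => u [u' [uQ u'Q une]].
have QP w : w \in Q :\: S -> [/\ w \in Y, w \notin S & forall x, G w x = G v x].
  by rewrite !inE => /and3P[? ? /forallP h]; split=> // x; apply/eqP.
have [uY uS uE] := QP u uQ; have [uY' uS' uE'] := QP u' u'Q.
have guv : G v u = false by rewrite adj_sym uE adj_irr.
have nuu : lrel c p u u' = false.
  by rewrite -(untouchedE uS) // uE adj_sym uE' adj_irr.
pose c' x := if x == v then c u else c x.
pose p' x := if x == v then p u else p x.
have neqv x : x \in Y -> (x == v) = false.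
  by move=> xY; apply: contraNF vY => /eqP <-.
exists L, c', p'; split.
  move=> z; have [/eqP ez|nz] := boolP (c u == z); last first.
    have sub x : x \in [set x in v |: Y | c' x == z] -> x \in [set x in Y | c x == z] /\ x != v.
      rewrite !inE /c'; case: (eqVneq x v) => [_|_] //=.
      by rewrite (negbTE nz).
    case: (val z) => [inj|[B [cB sB cov]]]; [left|right].
      move=> x y /sub[xi nx] /sub[yi ny]; rewrite /p' (negbTE nx) (negbTE ny).
      exact: inj.
    have BY b : b \in B -> [/\ b \in Y, c b == z & (b == v) = false].
      by move/(subsetP sB); rewrite !inE => /andP[bY cb]; rewrite neqv.
    exists B; split=> //.
      by apply/subsetP => b /BY[bY cb nb]; rewrite !inE /c' nb /= bY.
    move=> x /sub[xi nx]; have [b bB e] := cov x xi.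
    by exists b => //; have [_ _ nb] := BY b bB; rewrite /p' nb (negbTE nx).
  right; rewrite -ez.
  (* If [u] and [u'] share a class, then they also share [p], so [p] is not injective there.
     Otherwise a neighbour of [u] would also be one of [u'] and lie in both classes; hence [u] has
     none in its class and [p] is constant there. *)
  have [B [cB sB cov]] : exists B : {set T}, [/\ #|B| <= l,
      B \subset [set x in Y | c x == c u] &
      {in [set x in Y | c x == c u], forall x, exists2 b, b \in B & p b = p x}].
    have [ec|nc] := eqVneq (c u) (c u').
      case: (val (c u)) => [inj|//]; case/eqP: une; apply: inj; rewrite ?inE ?uY ?uY' ?ec ?eqxx //.
      by move: nuu; rewrite /lrel ec eqxx /= => /negbFE/eqP.
    exists [set u]; split; first by rewrite cards1.
      by apply/subsetP => x /set1P->; rewrite !inE uY eqxx.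
    move=> x; rewrite inE => /andP[xY /eqP xc]; exists u; rewrite ?inE //.
    apply/eqP/negPn/negP => ne.
    have : G u x by rewrite (untouchedE uS) // /lrel xc eqxx.
    rewrite uE -uE' (untouchedE uS') // /lrel xc => /andP[/eqP e _].
    by rewrite e eqxx in nc.
  have BY b : b \in B -> [/\ b \in Y, c b == c u & (b == v) = false].
    by move/(subsetP sB); rewrite !inE => /andP[bY cb]; rewrite neqv.
  exists B; split=> //.
    by apply/subsetP => b /BY[bY cb nb]; rewrite !inE /c' nb /= bY.
  move=> x; rewrite !inE /c' /p'; case: (eqVneq x v) => [_ _|nx /= xi].
    have [|b bB e] := cov u; first by rewrite inE uY eqxx.
    by exists b => //; have [_ _ ->] := BY b bB.
  have [|b bB e] := cov x; first by rewrite inE.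
  by exists b => //; have [_ _ ->] := BY b bB.
(* Pairs containing [v] copy pairs containing the untouched [u], so no difference is added. *)
apply: leq_trans cD; apply/subset_leq_card/subsetP => -[x y].
rewrite !inE /= /lrel /c' /p' /=.
case: (eqVneq x v) => [->|nx]; case: (eqVneq y v) => [->|ny] //=.
- by rewrite adj_irr !eqxx.
- by case/andP=> yY; rewrite -uE (untouchedE uS uY yY) eqxx.
- by rewrite andbT => /andP[xY]; rewrite adj_sym -uE (untouchedE uS uY xY) -/(lrel c p x u) lrel_sym eqxx.
Qed.

(** The [l+1] untouched twins are pairwise adjacent, so they share a class and have distinct [p].
    That class exceeds [l] values; hence [p] is injective on it, and [v] can join with a new
    value. *)
Lemma yes_on_add_true_twin G Y v k : v \notin Y ->
  2 * k + l.+1 <=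
    #|[set u in Y | [forall x, ((x == u) || G u x) == ((x == v) || G v x)]]| ->
  yes_on G Y k -> yes_on G (v |: Y) k.
Proof.
move=> vY; set Q := [set u in Y | _] => cQ [L [c [p [val cD]]]].
pose S := touched G Y c p.
have cU : l < #|Q :\: S|.
  have := cardsD Q S; have := subset_leq_card (subsetIr Q S).
  by have := card_touched G Y c p; rewrite -/S; lia.
have neqv x : x \in Y -> (x == v) = false.
  by move=> xY; apply: contraNF vY => /eqP <-.
have QP w : w \in Q :\: S -> [/\ w \in Y, w \notin S &
    forall x, (x == w) || G w x = (x == v) || G v x].
  by rewrite !inE => /and3P[? ? /forallP h]; split=> // x; apply/eqP.
have [u uQ] : exists u, u \in Q :\: S by apply/card_gt0P; lia.
have [uY uS uE] := QP u uQ.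
have adjU w w' : w \in Q :\: S -> w' \in Q :\: S -> w != w' -> lrel c p w w'.
  move=> /QP[wY wS wE] /QP[wY' wS' wE'] ne; rewrite -(untouchedE wS wY wY').
  have := wE w'; rewrite eq_sym (negbTE ne) /= => ->.
  rewrite (neqv _ wY') /= adj_sym.
  have := wE' v; rewrite eqxx /= => /orP[/eqP e|//]; by rewrite e wY' in vY.
have inj : {in [set x in Y | c x == c u] &, injective p}.
  case: (val (c u)) => // -[B [cB sB cov]].
  suff : #|Q :\: S| <= #|B| by lia.
  apply: (@cover_card _ p).
    move=> w w' wU wU' e; apply/eqP/negPn/negP => ne.
    by have := adjU _ _ wU wU' ne; rewrite /lrel e eqxx andbF.
  move=> w wU; apply: cov; have [wY _ _] := QP w wU; rewrite inE wY /=.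
  have [->//|ne] := eqVneq w u.
  by have /andP[] := adjU _ _ wU uQ ne.
(* [None] provides the fresh value of [p']; [c'] is wrapped only because both labels share one
   type. *)
pose c' x := if x == v then Some (c u) else Some (c x).
pose p' x := if x == v then None else Some (p x).
exists (option L), c', p'; split.
  case=> [z|]; last first.
    by left=> x y; rewrite !inE /c'; case: (eqVneq x v); rewrite ?andbF.
  have [/eqP ez|nz] := boolP (c u == z).
    left=> x y; rewrite -ez !inE /c' /p'.
    case: (eqVneq x v) => [->|nx]; case: (eqVneq y v) => [->|ny] //= xi yi [e].
    by apply: inj e; rewrite inE.
  have sub x : x \in [set x in v |: Y | c' x == Some z] -> x \in [set x in Y | c x == z] /\ x != v.
    rewrite !inE /c'; case: (eqVneq x v) => [_|_] //=.
    by rewrite -[Some _ == _]/(c u == z) (negbTE nz).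
  case: (val z) => [injz|[B [cB sB cov]]]; [left|right].
    move=> x y /sub[xi nx] /sub[yi ny]; rewrite /p' (negbTE nx) (negbTE ny) => -[].
    exact: injz.
  have BY b : b \in B -> [/\ b \in Y, c b == z & (b == v) = false].
    by move/(subsetP sB); rewrite !inE => /andP[bY cb]; rewrite neqv.
  exists B; split=> //.
    by apply/subsetP => b /BY[bY cb nb]; rewrite !inE /c' nb /= bY.
  move=> x /sub[xi nx]; have [b bB e] := cov x xi.
  by exists b => //; have [_ _ nb] := BY b bB; rewrite /p' nb (negbTE nx) e.
(* By injectivity the closed neighbourhood of the untouched [u] within [Y] is its whole class, and
   [v] has the same neighbours. *)
have vE y : y \in Y -> G v y = (c u == c y).
  move=> yY; have := uE y; rewrite (neqv _ yY) /= => <-.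
  have [->|ne] /= := eqVneq y u; first by rewrite eqxx.
  rewrite (untouchedE uS uY yY) /lrel andb_idr // => ec.
  by apply: contra ne => /eqP/inj->; rewrite ?inE ?uY ?yY ?eqxx // eq_sym.
apply: leq_trans cD; apply/subset_leq_card/subsetP => -[x y].
rewrite !inE /= /lrel /c' /p' /=.
case: (eqVneq x v) => [->|nx]; case: (eqVneq y v) => [->|ny] //=.
- by rewrite adj_irr andbF.
- by case/andP=> yY; rewrite (vE _ yY) -[Some _ == _]/(c u == c y) andbT eqxx.
- rewrite andbT => /andP[xY]; rewrite adj_sym (vE _ xY) -[Some _ == _]/(c x == c u).
  by rewrite andbT [c x == _]eq_sym eqxx.
Qed.

(** Vertices return one at a time. The step is required for every [Z] above [X] because the twins
    that justify it lie in [X] and remain available. *)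
Lemma yes_on_grow G X Y k : X \subset Y ->
  (forall Z v, X \subset Z -> v \in Y -> v \notin Z ->
     yes_on G Z k -> yes_on G (v |: Z) k) ->
  yes_on G X k -> yes_on G Y k.
Proof.
move=> sXY step yX.
suff h m : forall Z, X \subset Z -> Z \subset Y -> #|Y :\: Z| = m ->
   yes_on G Z k -> yes_on G Y k by apply: (h _ X).
elim: m => [|m IH] Z sXZ sZY cm yZ.
  have : Y \subset Z by rewrite -setD_eq0 -cards_eq0 cm.
  by move=> s; suff -> : Y = Z by []; apply/eqP; rewrite eqEsubset s.
have /card_gt0P[v] : 0 < #|Y :\: Z| by rewrite cm.
rewrite inE => /andP[vZ vY].
apply: (IH (v |: Z)); last exact: step.
- by apply: subset_trans sXZ (subsetUr _ _).
- by rewrite subUset sub1set vY.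
have := cardsD1 v (Y :\: Z); rewrite inE vZ vY cm setDDl (setUC Z) => e.
by apply: succn_inj; rewrite e.
Qed.

Definition adj_closed G Z := forall x y, x \in Z -> G x y -> y \in Z.

(** The sum of the two label types keeps the classes of both sides apart, matching the absence of
    edges between them. *)
Lemma yes_on_add_closed G Z k : adj_closed G Z ->
  yes_on G Z 0 -> yes_on G (~: Z) k -> yes_on G setT k.
Proof.
move=> cl [L1 [c1 [p1 [v1 d1]]]] [L2 [c2 [p2 [v2 d2]]]].
pose mk (f1 : T -> L1) (f2 : T -> L2) x : L1 + L2 :=
  if x \in Z then inl (f1 x) else inr (f2 x).
exists (L1 + L2)%type, (mk c1 c2), (mk p1 p2); split.
  case=> z.
    have sub x : x \in [set x in setT | mk c1 c2 x == inl z] ->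
        x \in [set x in Z | c1 x == z] /\ x \in Z.
      by rewrite !inE /mk; case: (boolP (x \in Z)).
    have sub' x : x \in [set x in Z | c1 x == z] ->
        x \in [set x in setT | mk c1 c2 x == inl z] /\ x \in Z.
      by rewrite !inE /mk; case: (boolP (x \in Z)).
    case: (v1 z) => [inj|[B [cB sB cov]]]; [left|right].
      by move=> x y /sub[xi xZ] /sub[yi yZ]; rewrite /mk xZ yZ => -[]; apply: inj.
    exists B; split=> //; first by apply/subsetP=> b /(subsetP sB)/sub'[].
    move=> x /sub[xi xZ]; have [b bB e] := cov _ xi; exists b => //.
    by have /sub'[_ bZ] := subsetP sB _ bB; rewrite /mk xZ bZ e.
  have sub x : x \in [set x in setT | mk c1 c2 x == inr z] ->
      x \in [set x in ~: Z | c2 x == z] /\ (x \in Z) = false.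
    by rewrite !inE /mk; case: (boolP (x \in Z)).
  have sub' x : x \in [set x in ~: Z | c2 x == z] ->
      x \in [set x in setT | mk c1 c2 x == inr z] /\ (x \in Z) = false.
    by rewrite !inE /mk; case: (boolP (x \in Z)).
  case: (v2 z) => [inj|[B [cB sB cov]]]; [left|right].
    by move=> x y /sub[xi xZ] /sub[yi yZ]; rewrite /mk xZ yZ => -[]; apply: inj.
  exists B; split=> //; first by apply/subsetP=> b /(subsetP sB)/sub'[].
  move=> x /sub[xi xZ]; have [b bB e] := cov _ xi; exists b => //.
  by have /sub'[_ bZ] := subsetP sB _ bB; rewrite /mk xZ bZ e.
apply: leq_trans d2; apply/subset_leq_card/subsetP => -[x y].
rewrite !inE /= /lrel /mk.
have [xZ|xZ] := boolP (x \in Z); have [yZ|yZ] := boolP (y \in Z) => //=.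
- move=> ne; move: d1; rewrite muln0 leqn0 cards_eq0 => /eqP/setP/(_ (x, y)).
  by rewrite !inE xZ yZ /= ne.
- by case gxy: (G x y) => //; rewrite (cl _ _ xZ gxy) in yZ.
- by case gxy: (G x y) => //; rewrite adj_sym in gxy; rewrite (cl _ _ yZ gxy) in xZ.
Qed.

Lemma card_kernel G k X :
  yes_on G setT k -> 1 < l ->
  (forall v Z, v \in X -> v \in Z -> adj_closed G Z -> ~ yes_on G Z 0) ->
  (forall v, #|[set u in X | [forall x, G u x == G v x]]| <= 2 * k + 2) ->
  (forall v, #|[set u in X |
     [forall x, ((x == u) || G u x) == ((x == v) || G v x)]]| <= 2 * k + l.+1) ->
  #|X| <= 2 * k + 2 * k * (l * (2 * k + 2)).
Proof.
move=> [L [c [p [val cD]]]] l1 bad hF hT.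
pose S := touched G setT c p.
have cS : #|S| <= 2 * k by apply: leq_trans (card_touched _ _ _ _) cD.
have unt x y : x \notin S -> G x y = lrel c p x y.
  by move=> xS; apply: (untouchedE xS); rewrite inE.
(* A class without touched vertices would be closed under adjacency and solved with no edits, which
   [bad] excludes. *)
have near v : v \in X -> [exists s in S, c s == c v].
  move=> vX; apply: contraT => /exists_inPn h.
  pose Z := [set x | c x == c v].
  have ZS x : x \in Z -> x \notin S.
    by rewrite inE => cx; apply: contraTN cx => /h.
  case: (bad v Z vX); first by rewrite inE.
    move=> x y xZ; rewrite (unt _ _ (ZS x xZ)) => /andP[/eqP e _].
    by move: xZ; rewrite !inE e.
  exists L, c, p; split.
    move=> z; have [->|nz] := eqVneq z (c v).
      have eZ : [set x in Z | c x == c v] = [set x in [set: T] | c x == c v].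
        by apply/setP=> x; rewrite !inE andbb.
      by rewrite eZ; apply: val.
    left=> x y; rewrite !inE => /andP[/eqP-> e]; by rewrite eq_sym e in nz.
  rewrite muln0 leqn0 cards_eq0; apply/eqP/setP => -[x y]; rewrite [RHS]inE !inE /=.
  apply/negbTE/negP => /andP[/andP[xZ _]]; rewrite unt ?eqxx //.
  by apply: ZS; rewrite inE.
(* Where [p] is injective, the untouched vertices of the class are true twins of each other;
   otherwise each of the at most [l] fibres of [p] consists, up to touched vertices, of false
   twins. *)
have step s : #|[set v in X :\: S | c v == c s]| <= l * (2 * k + 2).
  set Y := [set v in _ | _].
  have YP v : v \in Y -> [/\ v \in X, v \notin S & c v = c s].
    by rewrite !inE => /andP[/andP[? ?] /eqP].
  case: (val (c s)) => [inj|[B [cB sB cov]]].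
    have [->|[v vY]] := set_0Vmem Y; first by rewrite cards0.
    apply: (@leq_trans (2 * k + l.+1)); last by nia.
    apply: leq_trans (hT v); apply/subset_leq_card/subsetP => u uY.
    have nbh w x : w \in Y -> (x == w) || G w x = (c x == c s).
      move=> /YP[_ wS cw]; rewrite unt // /lrel cw.
      have [->|ne] /= := eqVneq x w; first by rewrite cw eqxx.
      rewrite eq_sym andb_idr // => /eqP e; apply: contra ne => /eqP/inj->//;
      by rewrite !inE /= ?cw ?e.
    rewrite inE; have [-> _ _] := YP u uY.
    by apply/forallP => x; rewrite !nbh.
  apply: (@leq_trans (#|B| * (2 * k + 2))); last by rewrite leq_mul2r cB orbT.
  rewrite -sum_nat_const.
  apply: (@leq_trans (\sum_(b in B) #|[set v in Y | p v == p b]|)).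
    apply: card_le_sum_fibers => v vY; have [|b bB e] := cov v.
      by have [_ _ e] := YP v vY; rewrite !inE e eqxx.
    by exists b => //; rewrite inE vY e eqxx.
  apply: leq_sum => b _; set Yb := [set v in Y | _].
  have [->|[v vY]] := set_0Vmem Yb; first by rewrite cards0.
  apply: leq_trans _ (hF v); apply/subset_leq_card/subsetP => u uY.
  have nbh w x : w \in Yb -> G w x = (c s == c x) && (p b != p x).
    by rewrite inE => /andP[/YP[_ wS cw] /eqP pw]; rewrite unt // /lrel cw pw.
  rewrite inE; have [-> _ _] : [/\ u \in X, u \notin S & c u = c s].
    by move: uY; rewrite inE => /andP[/YP].
  by apply/forallP => x; rewrite !nbh.
(* Classes are indexed by touched vertices, so one class may be counted several times;
   [#|S| <= 2 * k] absorbs this. *)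
apply: (@leq_trans (#|S| + \sum_(s in S) #|[set v in X :\: S | c v == c s]|)).
  rewrite -(cardsID S X); apply: leq_add.
    exact: subset_leq_card (subsetIr _ _).
  apply: card_le_sum_fibers => v vXS; move: (vXS); rewrite inE => /andP[_ vX].
  have /exists_inP[s sS /eqP e] := near v vX.
  by exists s => //; rewrite inE vXS e eqxx.
apply: leq_add => //; apply: (@leq_trans (#|S| * (l * (2 * k + 2)))).
  by rewrite -sum_nat_const; apply: leq_sum => s _; apply: step.
by rewrite leq_mul2r cS orbT.
Qed.
End Labellings.

(** * The kernel as a graph on an initial segment of the integers *)

Section Induced.
Variables (T : finType) (G : sgraph T) (X : {set T}).

Definition induced_rel : rel 'I_#|X| := fun i j => G (enum_val i) (enum_val j).

Lemma induced_sym : symmetric induced_rel.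
Proof. by move=> i j; rewrite /induced_rel adj_sym. Qed.

Lemma induced_irr : irreflexive induced_rel.
Proof. by move=> i; rewrite /induced_rel adj_irr. Qed.

Definition induced := SGraph induced_sym induced_irr.

Lemma enum_val_surj x : x \in X -> exists i : 'I_#|X|, x = enum_val i.
Proof. by move=> xX; exists (enum_rank_in xX x); rewrite enum_rankK_in. Qed.

Lemma yes_on_induced l k : yes_on l G X k <-> yes_on l induced setT k.
Proof.
split=> -[L [c [p [val cD]]]].
  exists L, (c \o enum_val), (p \o enum_val); split.
    move=> z; have sub i : i \in [set i in [set: 'I_#|X|] | (c \o enum_val) i == z] ->
        enum_val i \in [set x in X | c x == z].
      by rewrite !inE /= => ->; rewrite enum_valP.
    case: (val z) => [inj|[B [cB sB cov]]]; [left|right].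
      by move=> i j /sub iz /sub jz e; apply/enum_val_inj/inj.
    exists [set i | enum_val i \in B]; split.
    - apply: leq_trans cB; rewrite -(card_imset _ (@enum_val_inj _ (mem X))).
      by apply/subset_leq_card/subsetP => _ /imsetP[i + ->]; rewrite inE.
    - apply/subsetP => i; rewrite !inE => /(subsetP sB).
      by rewrite inE => /andP[_].
    move=> i /sub iz; have [b bB e] := cov _ iz.
    have [|j ej] := @enum_val_surj b.
      by move/(subsetP sB): bB; rewrite inE => /andP[].
    by exists j; rewrite ?inE /= -?ej.
  apply: leq_trans cD.
  have inj : injective (fun q : 'I_#|X| * 'I_#|X| => (enum_val q.1, enum_val q.2)).
    by move=> [a b] [a' b'] /= [/enum_val_inj-> /enum_val_inj->].
  rewrite -(card_imset _ inj); apply/subset_leq_card/subsetP.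
  move=> _ /imsetP[[i j] + ->]; rewrite !inE /= !enum_valP /=.
  by rewrite /induced_rel /lrel.
(* The partial inverse of [enum_val]; outside [X] the labels become [None], a value never taken
   inside [X]. *)
pose rk x := [pick i : 'I_#|X| | enum_val i == x].
have rkK i : rk (enum_val i) = Some i.
  rewrite /rk; case: pickP => [j /eqP/enum_val_inj-> //|/(_ i)].
  by rewrite eqxx.
exists (option L), (omap c \o rk), (omap p \o rk); split.
  case=> [z|]; last first.
    left=> x y; rewrite !inE => /andP[/enum_val_surj[i ->]].
    by rewrite /= rkK.
  have sub x : x \in [set x in X | (omap c \o rk) x == Some z] ->
      exists2 i, x = enum_val i & i \in [set i in [set: 'I_#|X|] | c i == z].
    rewrite !inE => /andP[/enum_val_surj[i ->]] /=; rewrite rkK => e.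
    by exists i => //; rewrite !inE.
  case: (val z) => [inj|[B [cB sB cov]]]; [left|right].
    move=> _ _ /sub[i -> iz] /sub[j -> jz]; rewrite /= !rkK => -[e].
    by rewrite (inj i j).
  exists [set enum_val i | i in B]; split.
  - by apply: leq_trans (leq_imset_card _ _) cB.
  - apply/subsetP => _ /imsetP[i /(subsetP sB) iz ->].
    by move: iz; rewrite !inE /= rkK enum_valP.
  move=> _ /sub[i -> iz]; have [b bB e] := cov _ iz.
  by exists (enum_val b); [exact: imset_f | rewrite /= !rkK /= e].
apply: leq_trans cD.
apply: leq_trans (leq_imset_card (fun q : 'I_#|X| * 'I_#|X| => (enum_val q.1, enum_val q.2)) _).
apply/subset_leq_card/subsetP => -[x y]; rewrite !inE /= => /andP[/andP[]].
move=> /enum_val_surj[i ->] /enum_val_surj[j ->] ne.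
apply/imsetP; exists (i, j) => //; rewrite !inE /=.
by move: ne; rewrite /lrel /= !rkK.
Qed.

End Induced.

(** * Recognising the components to be removed *)

Section GoodTest.
Variables (n l : nat) (G : sgraph 'I_n) (r1 r2 cls : 'I_n -> nat).
Variable first : {set 'I_n}.
Hypotheses (r1_min : forall v u : 'I_n, (u == v) || G v u -> r1 v <= u)
  (r1_ex : forall v, exists2 u : 'I_n, (u == v) || G v u & r1 v = u)
  (r2_min : forall v u, (u == v) || G v u -> r2 v <= r1 u)
  (r2_ex : forall v, exists2 u, (u == v) || G v u & r2 v = r1 u)
  (clsP : forall u v, (cls u == cls v) = [forall x, G u x == G v x])
  (first_inj : {in first &, injective cls})
  (first_ex : forall v, exists2 u, u \in first & cls u = cls v).

(* [r2 v] is the least vertex at distance at most 2 from [v]; it identifies the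
   component of [v] as soon as that component has diameter at most 2. *)
Definition cc r := [set u | r2 u == r].

(** Violations are gathered per value [r] because one of them disqualifies every vertex with that
    [r2]; the program counts them in arrays indexed by [r]. *)
Definition bad_edge r := [exists v, exists u, [&& G v u, r2 v == r & r2 u != r2 v]].

Definition bad_degree r := [exists v, (r2 v == r) &&
  (#|[set u | G v u]| + #|[set u | cls u == cls v]| != #|cc (r2 v)|)].

(** Isolated vertices need their own disjunct: they are all false twins of each other, so the degree
    test would fail for them. In the last test [first] counts the parts: at most [l] of them, or one
    per vertex, which means a clique. *)
Definition good v :=
  (#|[set u | G v u]| == 0) ||
  [&& ~~ bad_edge (r2 v), ~~ bad_degree (r2 v) &
      (#|first :&: cc (r2 v)| <= l) || (#|cc (r2 v)| <= #|first :&: cc (r2 v)|)].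

Lemma isolatedP v : reflect (forall u, G v u = false) (#|[set u | G v u]| == 0).
Proof.
rewrite cards_eq0; apply: (iffP eqP) => [/setP h u|h]; first by have := h u; rewrite !inE.
by apply/setP => u; rewrite !inE h.
Qed.

Lemma nonisolated v u : G v u -> (#|[set u | G v u]| == 0) = false.
Proof. by move=> vu; apply/negP => /isolatedP/(_ u); rewrite vu. Qed.

Lemma twinE u v : cls u = cls v -> forall x, G u x = G v x.
Proof. by move/eqP; rewrite clsP => /forallP h x; apply/eqP. Qed.

Lemma good_edge v u : good v -> G v u -> r2 u = r2 v.
Proof.
rewrite /good => + vu; rewrite (nonisolated vu) /= => /and3P[h _ _].
apply: contraNeq h => ne; apply/existsP; exists v; apply/existsP; exists u.
by rewrite vu eqxx.
Qed.

Lemma good_closed : adj_closed G [set v | good v].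
Proof.
move=> x y; rewrite !inE => gx xy; have e := good_edge gx xy; move: gx.
by rewrite /good e !(@nonisolated _ _ xy) (@nonisolated y x) // adj_sym.
Qed.

Lemma r2_near v : exists x y : 'I_n,
  [/\ (x == v) || G v x, (y == x) || G x y & r2 v = y].
Proof.
have [x vx e] := r2_ex v; have [y xy e'] := r1_ex x.
by exists x, y; rewrite -e' e.
Qed.

Lemma good_near v x u : good v -> G v x -> (u == v) || G x u -> r2 u = r2 v.
Proof.
move=> gv vx /orP[/eqP-> //|xu].
have gx : good x by have := @good_closed v x; rewrite !inE; apply.
by rewrite (good_edge gx xu) (good_edge gv vx).
Qed.

(** An isolated [x] has [r2 x = x], and no other vertex reaches it. *)
Lemma isolated_r2 x y : #|[set u | G x u]| == 0 -> r2 y = r2 x -> y = x.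
Proof.
move=> iso e.
have [a [b [xa ab e1]]] := r2_near x.
have [a' [b' [ya ab' e2]]] := r2_near y.
move: xa; rewrite (isolatedP _ iso) orbF => /eqP ?; subst a.
move: ab; rewrite (isolatedP _ iso) orbF => /eqP ?; subst b.
have ? : b' = x by apply: val_inj; rewrite /= -e2 -e1 e.
subst b'; move: ab'; rewrite adj_sym (isolatedP _ iso) orbF => /eqP ?; subst a'.
by move: ya; rewrite adj_sym (isolatedP _ iso) orbF => /eqP.
Qed.

(** The neighbours and the false twins of [x] are disjoint, and both lie in [cc (r2 x)]: twins share
    a neighbour with [x]. By the degree test they exhaust it, so whatever is not a twin is a
    neighbour. *)
Lemma good_adj x y : good x -> good y ->
  G x y = (r2 x == r2 y) && (cls x != cls y).
Proof.
move=> gx gy; have [iso|] := boolP (#|[set u | G x u]| == 0).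
  rewrite (isolatedP _ iso); symmetry; apply/negbTE/negP => /andP[/eqP e ne].
  by case/eqP: ne; rewrite (isolated_r2 iso (esym e)).
move=> niso; apply/idP/andP => [xy|[/eqP e ne]].
  rewrite (good_edge gx xy); split=> //; apply/negP => /eqP/twinE/(_ y).
  by rewrite xy adj_irr.
have [a xa] : exists a, G x a.
  by move: niso; rewrite -lt0n => /card_gt0P[a]; rewrite inE; exists a.
pose N := [set u | G x u]; pose C := [set u | cls u == cls x].
have sNC : N :|: C \subset cc (r2 x).
  apply/subsetP => u; rewrite !inE => /orP[xu|/eqP/twinE tw].
    by rewrite (good_edge gx xu).
  by rewrite (@good_near x a u gx xa) // adj_sym tw xa orbT.
have dNC : N :&: C = set0.
  apply/setP => u; rewrite !inE; apply/negbTE/negP => /andP[xu /eqP/twinE/(_ u)].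
  by rewrite xu adj_irr.
have cNC : #|N| + #|C| = #|cc (r2 x)|.
  move: gx; rewrite /good (negbTE niso) /= => /and3P[_ h _].
  apply/eqP; apply: contraNT h => h; apply/existsP; exists x.
  by rewrite eqxx h.
have /eqP eNC : N :|: C == cc (r2 x).
  by rewrite eqEcard sNC cardsU dNC cards0 subn0 cNC leqnn.
have : y \in N :|: C by rewrite eNC inE e.
by rewrite !inE [cls y == _]eq_sym (negbTE ne) orbF.
Qed.

(** The computed arrays [r2] and [cls] themselves serve as the labels [c] and [p]. *)
Lemma good_yes : yes_on l G [set v | good v] 0.
Proof.
exists nat, r2, cls; split; last first.
  rewrite leqn0 cards_eq0; apply/eqP/setP => -[x y]; rewrite [RHS]inE !inE /=.
  by apply/negbTE/negP => /andP[/andP[gx gy]]; rewrite good_adj // eqxx.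
move=> z; set A := [set x in _ | _].
have [x /andP[]|none] := pickP (fun x => (x \in A) && ~~ (#|[set u | G x u]| == 0)).
  rewrite !inE => /andP[gx /eqP ez] niso.
  have AP u : u \in A -> [/\ good u, r2 u = z & exists a, G u a].
    rewrite !inE => /andP[gu /eqP eu]; split=> //.
    have : ~~ (#|[set a | G u a]| == 0).
      by apply: contra niso => iso; rewrite (isolated_r2 (y := x) iso) ?ez.
    by rewrite -lt0n => /card_gt0P[a]; rewrite inE; exists a.
  have sA : A \subset cc (r2 x).
    by apply/subsetP => u /AP[_ + _]; rewrite inE ez => ->.
  have /orP[cl|cl] : (#|first :&: cc (r2 x)| <= l) || (#|cc (r2 x)| <= #|first :&: cc (r2 x)|).
    by move: gx; rewrite /good (negbTE niso) /= => /and3P[].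
    right; exists (first :&: A); split.
    - by apply: leq_trans (subset_leq_card _) cl; apply: setIS.
    - exact: subsetIr.
    (* The representative [b] of the twin class of [u] is adjacent to the neighbour [a] of [u], so
       it is good and has the same [r2]. *)
    move=> u /AP[gu eu [a ua]]; have [b bf e] := first_ex u; exists b => //.
    have ab : G a b by rewrite adj_sym (twinE e).
    have ga : good a by have := @good_closed u a; rewrite !inE; apply.
    have gb : good b by have := @good_closed a b; rewrite !inE; apply.
    by rewrite !inE bf gb (@good_near u a) ?ab ?orbT //= eu.
  have /eqP e : first :&: cc (r2 x) == cc (r2 x) by rewrite eqEcard subsetIr.
  left=> u v /(subsetP sA) + /(subsetP sA); rewrite -e.
  by move=> /setIP[uf _] /setIP[vf _]; apply: first_inj.
left=> u v uA vA _.
have := none u; have := none v; rewrite uA vA /= => /negbFE isov _.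
by apply: (isolated_r2 isov); move: uA vA; rewrite !inE => /andP[_ /eqP->] /andP[_ /eqP->].
Qed.

(** If [v] is not isolated, its class [K] is complete multipartite with at least two parts. Its
    vertices are within distance 2 of each other, and [r2] is constantly the least element of
    [K]. *)
Lemma good_complete (Z : {set 'I_n}) v : v \in Z -> adj_closed G Z -> yes_on l G Z 0 -> good v.
Proof.
move=> vZ cl [L [c [p [val]]]]; rewrite muln0 leqn0 cards_eq0 => /eqP/setP d0.
have GE x y : x \in Z -> y \in Z -> G x y = lrel c p x y.
  move=> xZ yZ; have := d0 (x, y); rewrite !inE xZ yZ /= => /negbFE/eqP //.
rewrite /good; case: isolatedP => //= niso.
have [v' vv'] : exists v', G v v'.
  by apply/existsP; apply: contra_notT niso; rewrite negb_exists => /forallP h u; apply/negbTE.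
pose K := [set x in Z | c x == c v].
have vK : v \in K by rewrite inE vZ eqxx.
have KE x y : x \in K -> G x y = (y \in K) && (p x != p y).
  rewrite !inE => /andP[xZ /eqP cx]; have [yZ|yZ] /= := boolP (y \in Z).
    by rewrite GE // /lrel cx eq_sym.
  by apply: contraNF yZ; apply: cl.
have v'K : v' \in K by move: vv'; rewrite KE // => /andP[].
have pvv' : p v != p v' by move: vv'; rewrite KE // => /andP[].
have other x : x \in K -> exists2 a, a \in K & p x != p a.
  move=> xK; have [e|ne] := eqVneq (p x) (p v); last by exists v.
  by exists v' => //; rewrite e.
have closedK x y : x \in K -> (y == x) || G x y -> y \in K.
  by move=> xK /orP[/eqP->//|]; rewrite KE // => /andP[].
have two x y : x \in K -> y \in K -> exists a, ((a == x) || G x a) && ((y == a) || G a y).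
  move=> xK yK; have [e|ne] := eqVneq (p x) (p y).
    have [a aK na] := other x xK; exists a; by rewrite !KE // aK yK na -e [p a == _]eq_sym na !orbT.
  by exists x; rewrite eqxx (KE x y) // yK ne orbT.
have r2K x : x \in K -> exists2 y : 'I_n, y \in K & r2 x = y.
  move=> xK; have [a [y [xa ay e]]] := r2_near x; exists y => //.
  exact: closedK (closedK _ _ xK xa) ay.
have r2le x y : x \in K -> y \in K -> r2 x <= y.
  move=> xK yK; have [a /andP[xa ay]] := two x y xK yK.
  by apply: leq_trans (r2_min xa) (r1_min ay).
have r2c x y : x \in K -> y \in K -> r2 x = r2 y.
  move=> xK yK; have [x' xK' ex] := r2K x xK; have [y' yK' ey] := r2K y yK.
  by apply/eqP; rewrite eqn_leq {1}ey {2}ex !r2le.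
(* The value [r2 v] is a vertex of [K]; whoever has the same value reaches that vertex in at most
   two steps, hence lies in the closed set [K]. *)
have ccK : cc (r2 v) = K.
  apply/setP => y; rewrite inE; apply/eqP/idP => [e|yK]; last exact: r2c.
  have [w wK ew] := r2K v vK; have [a [b [ya ab eb]]] := r2_near y.
  have ? : b = w by apply: val_inj; rewrite /= -eb -ew.
  subst b; have aK : a \in K by apply: (closedK w) => //; rewrite eq_sym adj_sym.
  by apply: (closedK a) => //; rewrite eq_sym adj_sym.
have clsK x u : x \in K -> (cls u == cls x) = (u \in K) && (p u == p x).
  move=> xK; rewrite clsP; apply/forallP/andP => [h|[uK /eqP e] y]; last first.
    by rewrite !KE // e.
  have [a aK na] := other x xK.
  have uK : u \in K.
    apply: (closedK a) => //; rewrite adj_sym (eqP (h a)) KE // aK na orbT //.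
  split=> //; have := h u; rewrite adj_irr KE // uK /= eq_sym eqbF_neg negbK eq_sym //.
apply/and3P; split.
- apply/existsP => -[x /existsP[y /and3P[xy /eqP ex /negP[]]]].
  have xK : x \in K by rewrite -ccK inE ex.
  by apply/eqP/r2c => //; apply: closedK xK _; rewrite xy orbT.
- apply/existsP => -[x /andP[/eqP ex /negP[]]].
  have xK : x \in K by rewrite -ccK inE ex.
  rewrite ex ccK -(cardsID [set u | p u == p x] K) addnC; apply/eqP; congr (_ + _).
    by apply: eq_card => u; rewrite [LHS]inE clsK // !inE.
  by apply: eq_card => u; rewrite [LHS]inE KE // !inE andbC [p x == _]eq_sym.
(* Inside [K] twin classes are fibres of [p]: singletons when [p] is injective, otherwise at most
   [#|B|] many. *)
rewrite ccK; case: (val (c v)) => [inj|[B [cB sB cov]]]; apply/orP; [right|left].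
  apply: subset_leq_card; apply/subsetP => x xK; rewrite inE xK andbT.
  have [u uf /eqP e] := first_ex x; move: e; rewrite clsK // => /andP[uK /eqP /inj <-] //.
apply: leq_trans cB; apply: (@cover_card _ _ p).
  move=> x y /setIP[xf xK] /setIP[yf yK] e; apply: first_inj => //.
  by apply/eqP; rewrite clsK // xK e eqxx.
by move=> x /setIP[_ xK]; apply: cov.
Qed.

Variables (k : nat) (tcls : 'I_n -> nat) (X1 X2 : {set 'I_n}).
Let X0 := [set v | ~~ good v].
Hypotheses (l_gt1 : 1 < l)
  (tclsP : forall u v, (tcls u == tcls v) =
     [forall x, ((x == u) || G u x) == ((x == v) || G v x)])
  (sX1 : X1 \subset X0) (sX2 : X2 \subset X1)
  (X1_le : forall v, #|[set u in X1 | cls u == cls v]| <= 2 * k + 2)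
  (X2_le : forall v, #|[set u in X2 | tcls u == tcls v]| <= 2 * k + l.+1)
  (X1_ge : forall v, v \in X0 -> v \notin X1 ->
     2 * k + 2 <= #|[set u in X1 | cls u == cls v]|)
  (X2_ge : forall v, v \in X1 -> v \notin X2 ->
     2 * k + l.+1 <= #|[set u in X2 | tcls u == tcls v]|).

(** A solution restricts to [X2]. Conversely the chain is climbed back: true twins up to [X1], false
    twins up to [X0], then the good vertices, which cost nothing. *)
Lemma kernel_equiv : yes_instance l G k <-> yes_instance l (induced G X2) k.
Proof.
rewrite !yes_instanceE -yes_on_induced; split.
  exact/yes_on_sub/subsetT.
move=> y2; apply: (yes_on_add_closed good_closed good_yes).
have -> : ~: [set v | good v] = X0 by apply/setP => v; rewrite !inE.
apply: (yes_on_grow sX1) => [Z v sZ vX vZ|].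
  apply: yes_on_add_false_twin => //; first by lia.
  have vX1 : v \notin X1 by apply: contra vZ => /(subsetP sZ).
  apply: leq_trans (X1_ge vX vX1) _; apply/subset_leq_card/subsetP => u.
  by rewrite !inE clsP => /andP[/(subsetP sZ)->].
apply: (yes_on_grow sX2) y2 => Z v sZ vX vZ.
apply: yes_on_add_true_twin => //.
have vX2 : v \notin X2 by apply: contra vZ => /(subsetP sZ).
apply: leq_trans (X2_ge vX vX2) _; apply/subset_leq_card/subsetP => u.
by rewrite !inE tclsP => /andP[/(subsetP sZ)->].
Qed.

Lemma kernel_size : yes_instance l G k -> #|X2| <= 10 * l * k ^ 2.
Proof.
rewrite yes_instanceE => y.
(* For [k > 0] the terms [2k], [4lk] and [4lk^2] are at most 2, 4 and 4 times [lk^2]; for [k = 0]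
   both sides vanish. *)
suff : #|X2| <= 2 * k + 2 * k * (l * (2 * k + 2)) by case: k => [|k']; nia.
apply: (card_kernel y) => //.
- move=> v Z /(subsetP sX2)/(subsetP sX1); rewrite inE => ng vZ cl yZ.
  by rewrite (good_complete vZ cl yZ) in ng.
- move=> v; apply: leq_trans _ (X1_le v); apply/subset_leq_card/subsetP => u.
  by rewrite !inE clsP => /andP[/(subsetP sX2)->].
move=> v; apply: leq_trans _ (X2_le v); apply/subset_leq_card/subsetP => u.
by rewrite !inE tclsP.
Qed.

End GoodTest.

(** * Total correctness of programs with time bounds *)

Section Logic.
Variable W : nat.
Implicit Types (s : state) (c : cmd) (Q : state -> Prop) (t : nat).

Definition run c s t Q : Prop :=
  exists t' s', [/\ exec W c s t' s', t' <= t & Q s'].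

Fixpoint wp c Q s : Prop :=
  match c with
  | Skip => Q s
  | Asg x e => fits W s e /\ Q (set_reg s x (eval s e))
  | Put a e1 e2 =>
      [/\ fits W s e1, fits W s e2 & Q (set_arr s a (eval s e1) (eval s e2))]
  | Seq c1 c2 => wp c1 (wp c2 Q) s
  | If e1 e2 c1 c2 => [/\ fits W s e1, fits W s e2 &
      if eval s e1 <= eval s e2 then wp c1 Q s else wp c2 Q s]
  | While _ _ _ => False
  end.

(* Meaningful for loop-free programs only. *)
Fixpoint scost c : nat :=
  match c with
  | Skip => 1
  | Asg _ e => (ecost e).+1
  | Put _ e1 e2 => (ecost e1 + ecost e2).+1
  | Seq c1 c2 => scost c1 + scost c2
  | If e1 e2 c1 c2 => (ecost e1 + ecost e2 + (scost c1 + scost c2)).+1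
  | While _ _ _ => 0
  end.

Lemma wp_run c Q s : wp c Q s -> run c s (scost c) Q.
Proof.
elim: c Q s => [|x e|a e1 e2|c1 IH1 c2 IH2|e1 e2 c1 IH1 c2 IH2|//] Q s /=.
- by exists 1, s; split=> //; constructor.
- by case=> f q; do 2 eexists; split; [constructor | |exact: q].
- by case=> f1 f2 q; do 2 eexists; split; [constructor | |exact: q].
- case/IH1 => t1 [s1 [x1 l1 /IH2[t2 [s2 [x2 l2 q]]]]].
  exists (t1 + t2), s2; split=> //; first by econstructor; eauto.
  exact: leq_add.
case=> f1 f2; case: leqP => le.
  case/IH1 => t1 [s1 [x1 l1 q]]; exists (ecost e1 + ecost e2 + t1).+1, s1.
  by split=> //; [apply: ExecIfT | lia].
case/IH2 => t1 [s1 [x1 l1 q]]; exists (ecost e1 + ecost e2 + t1).+1, s1.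
by split=> //; [apply: ExecIfF | lia].
Qed.

Lemma run_seq c1 c2 s t1 t2 Q :
  run c1 s t1 (fun s1 => run c2 s1 t2 Q) -> run (Seq c1 c2) s (t1 + t2) Q.
Proof.
case=> [u1 [s1 [x1 l1 [u2 [s2 [x2 l2 q]]]]]].
exists (u1 + u2), s2; split=> //; first by econstructor; eauto.
exact: leq_add.
Qed.

Lemma run_weaken c s t t' Q Q' :
  run c s t Q -> t <= t' -> (forall s', Q s' -> Q' s') -> run c s t' Q'.
Proof.
case=> [u [s1 [x1 l1 q]]] le h; exists u, s1; split=> //.
  exact: leq_trans le.
exact: h.
Qed.

Lemma run_le c s t t' Q : run c s t Q -> t <= t' -> run c s t' Q.
Proof. by move=> r le; apply: run_weaken r le _. Qed.

Fixpoint wregs c : seq nat :=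
  match c with
  | Skip | Put _ _ _ => [::]
  | Asg x _ => [:: x]
  | Seq c1 c2 | If _ _ c1 c2 => wregs c1 ++ wregs c2
  | While _ _ c => wregs c
  end.

Fixpoint warrs c : seq nat :=
  match c with
  | Skip | Asg _ _ => [::]
  | Put a _ _ => [:: a]
  | Seq c1 c2 | If _ _ c1 c2 => warrs c1 ++ warrs c2
  | While _ _ c => warrs c
  end.

Definition frame (R A : seq nat) s s' :=
  (forall r, r \notin R -> regs s' r = regs s r) /\
  (forall a, a \notin A -> arrs s' a = arrs s a).

(** Specifications then need to mention only what a command writes; the rest is preserved for
    syntactic reasons. *)
Lemma exec_frame c s t s' : exec W c s t s' -> frame (wregs c) (warrs c) s s'.
Proof.
elim=> {c s t s'} //=.
- by move=> s x e _; split=> // r; rewrite inE /= /upd => /negbTE->.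
- by move=> s a e1 e2 _ _; split=> // b; rewrite inE /= /upd => /negbTE->.
- move=> s1 s2 s3 c1 c2 t1 t2 _ [r1 a1] _ [r2 a2]; split=> x;
  by rewrite mem_cat negb_or => /andP[h1 h2]; rewrite ?r2 ?a2 ?r1 ?a1.
- move=> s s' e1 e2 c1 c2 t _ _ _ _ [r1 a1]; split=> x;
  by rewrite mem_cat negb_or => /andP[h1 h2]; rewrite ?r1 ?a1.
- move=> s s' e1 e2 c1 c2 t _ _ _ _ [r1 a1]; split=> x;
  by rewrite mem_cat negb_or => /andP[h1 h2]; rewrite ?r1 ?a1.
by move=> s s1 s2 e1 e2 c t1 t2 _ _ _ _ [r1 a1] _ [r2 a2]; split=> x h;
  rewrite ?r2 ?a2 ?r1 ?a1.
Qed.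

Lemma run_frame c s t Q : run c s t Q ->
  run c s t (fun s' => Q s' /\ frame (wregs c) (warrs c) s s').
Proof.
by case=> [u [s1 [x1 l1 q]]]; exists u, s1; split=> //; split=> //; apply: exec_frame x1.
Qed.

Lemma frame_trans R A s1 s2 s3 :
  frame R A s1 s2 -> frame R A s2 s3 -> frame R A s1 s3.
Proof. by move=> [r1 a1] [r2 a2]; split=> x h; rewrite ?r2 ?a2 ?r1 ?a1. Qed.

(* The loop counter of every [For] is register 3. *)
Definition For (x : nat) c : cmd :=
  Seq (Asg 3 (Cst 0))
    (While (Plus (Reg 3) (Cst 1)) (Reg x)
       (Seq c (Asg 3 (Plus (Reg 3) (Cst 1))))).

(** The test is evaluated once more with counter [N], producing [N + 1]; hence [N < W]. The
    invariant is stated after the counter update, and the frame premise gives the body access to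
    everything still unchanged since [s]. *)
Lemma run_for x c (I : nat -> state -> Prop) s N :
  regs s x = N -> N < W -> x != 3 -> x \notin wregs c -> 3 \notin wregs c ->
  I 0 (set_reg s 3 0) ->
  (forall j s', j < N -> frame (3 :: wregs c) (warrs c) s s' ->
     regs s' 3 = j -> I j s' ->
     wp c (fun s'' => I j.+1 (set_reg s'' 3 j.+1)) s') ->
  run (For x c) s ((scost c + 10) * N.+1) (I N).
Proof.
move=> eN lW nx3 nx n3 I0 step.
pose fr := frame (3 :: wregs c) (warrs c) s.
have frx s' : fr s' -> regs s' x = N.
  by case=> r _; rewrite r // inE negb_or nx3.
have loop m : forall j s', j + m = N -> fr s' -> regs s' 3 = j -> I j s' ->
    run (While (Plus (Reg 3) (Cst 1)) (Reg x)
       (Seq c (Asg 3 (Plus (Reg 3) (Cst 1))))) s' ((scost c + 10) * m + 5)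
      (I N).
  elim: m => [|m IH] j s' ejm f ej Ij.
    rewrite addn0 in ejm.
    exists 5, s'; split; last by rewrite -ejm.
      by apply: ExecWhileF; rewrite /= ?frx ?ej //; lia.
    by rewrite muln0.
  have jN : j < N by lia.
  have [t1 [s1 [x1 l1 [I1 [r1 a1]]]]] := run_frame (wp_run (step j s' jN f ej Ij)).
  have ej1 : regs s1 3 = j by rewrite r1.
  pose s2 := set_reg s1 3 (eval s1 (Plus (Reg 3) (Cst 1))).
  have es2 : s2 = set_reg s1 3 j.+1 by rewrite /s2 /= ej1 addn1.
  have f2 : fr s2.
    apply: (frame_trans f); rewrite es2; split=> y /=.
      by rewrite inE negb_or /upd => /andP[/negbTE-> h]; rewrite r1.
    by move=> h; rewrite a1.
  have [| | |t2 [s3 [x2 l2 I3]]] := IH j.+1 s2 _ f2; rewrite ?es2 //; first by lia.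
  exists (4 + (t1 + 4) + t2).+1, s3; split=> //; last first.
    by rewrite mulnS; lia.
  apply: (ExecWhileT (s1 := s2)) => //; rewrite /= ?frx ?ej //; try lia.
  by apply: ExecSeq x1 _; apply: ExecAsg => /=; rewrite ej1; lia.
have [||||t1 [s1 [x1 l1 q]]] := loop N 0 (set_reg s 3 0) => //.
  by split=> y //=; rewrite inE negb_or /upd => /andP[/negbTE->].
exists (2 + t1), s1; split=> //.
  by apply: ExecSeq x1; apply: ExecAsg.
by rewrite mulnS; lia.
Qed.

End Logic.

(** * Loops of the kernelization program *)

Section Refinement.
Variable n : nat.
Implicit Types (L : seq (nat * nat)) (A S N : nat -> nat).

Definition same L u x := forall v, ((v, u) \in L) = ((v, x) \in L).

(** When [u] has not met pivot [w], such an [x] is a vertex that shared the set of [u] and has since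
    met [w]. *)
Definition ext L w u x := forall v, ((v, x) \in L) = ((v, u) \in L) || (v == w).

(* [A] labels each vertex [u] by the set of the [v] with [(v, u)] in [L].  For
   the current pivot [w], a label [c] with stamp [S c = w.+1] has been split,
   the vertices met so far having moved to the label [N c]; [f] is fresh. *)
Record rinv L A S N f : Prop := RInv {
  rinv_lab : forall u x, u < n -> x < n -> (A u = A x <-> same L u x);
  rinv_stamp : forall w u, u < n -> {in L, forall q, q.1 <= w} -> (w, u) \notin L ->
    (S (A u) = w.+1 <-> exists2 x, x < n & ext L w u x);
  rinv_new : forall w u, u < n -> {in L, forall q, q.1 <= w} -> (w, u) \notin L ->
    S (A u) = w.+1 -> forall x, x < n -> (A x = N (A u) <-> ext L w u x);
  rinv_src : forall c, S c != 0 -> exists2 q, q \in L & S c = q.1.+1;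
  rinv_lt : forall u, A u < f;
  rinv_newlt : forall c, S c != 0 -> N c < f;
  rinv_fresh : f <= (size L).+1 }.

Lemma rinv0 A S N : (forall i, A i = 0) -> (forall i, S i = 0) ->
  rinv [::] A S N 1.
Proof.
move=> A0 S0; split=> // [u x _ _|w u _ _ _|w u _ _ _|c|u|c];
  rewrite ?A0 ?S0 //.
by split=> // -[x _ /(_ w)]; rewrite eqxx.
Qed.

Lemma mem_rcons_other L v u w x : x != u ->
  ((w, x) \in rcons L (v, u)) = ((w, x) \in L).
Proof. by move=> ne; rewrite mem_rcons inE xpair_eqE (negbTE ne) andbF. Qed.

Lemma mem_rcons_same L v u w :
  ((w, u) \in rcons L (v, u)) = (w == v) || ((w, u) \in L).
Proof. by rewrite mem_rcons inE xpair_eqE eqxx andbT. Qed.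

(** Common to both branches: [u] moves to label [d], which may be an existing split-off label or a
    fresh one. All that matters is that [d] holds exactly the companions of [u] already moved by
    pivot [v], and that no other split class points to [d]. *)
Lemma rinv_step L A S N f v u d S' N' f' :
  rinv L A S N f -> u < n -> (v, u) \notin L -> {in L, forall q, q.1 <= v} ->
  (forall x, x < n -> x != u -> (A x = d <-> ext L v u x)) ->
  (forall y, y < n -> (v, y) \notin L -> S (A y) = v.+1 -> A y <> A u -> N (A y) <> d) ->
  S' (A u) = v.+1 -> N' (A u) = d ->
  (forall c, c <> A u -> S' c = S c /\ N' c = N c) ->
  d < f' -> f <= f' -> f' <= f.+1 ->
  rinv (rcons L (v, u)) (upd A u d) S' N' f'.
Proof.
move=> [labP stampP newP srcP ltP newltP freshP] un vuL Lv dP dN Su Nu off df ff' f'f.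
have extO y x : y != u -> x != u -> ext (rcons L (v, u)) v y x <-> ext L v y x.
  move=> yu xu; split=> h w; have := h w; rewrite ?mem_rcons_other //.
have extS y : y < n -> y != u -> (v, y) \notin L ->
    ext (rcons L (v, u)) v y u <-> A u = A y.
  move=> yn yu vy; rewrite labP //; split=> h w; have := h w.
    rewrite mem_rcons_same mem_rcons_other //; case: eqP => [-> _|_] /=.
      by rewrite (negbTE vuL) (negbTE vy).
    by rewrite orbF.
  by rewrite mem_rcons_same mem_rcons_other // => ->; rewrite orbC.
have src' c : S' c != 0 -> exists2 q, q \in rcons L (v, u) & S' c = q.1.+1.
  have [->|/eqP/off[-> _]] := eqVneq c (A u).
    by exists (v, u); rewrite // mem_rcons inE eqxx.
  by move=> /srcP[q qL e]; exists q; rewrite // mem_rcons inE qL orbT.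
have le' q : q \in rcons L (v, u) -> q.1 <= v.
  by rewrite mem_rcons inE => /orP[/eqP->|/Lv].
(* for a pivot beyond [v] no stamp is current *)
have later w y : v < w ->
    S' (upd A u d y) <> w.+1 /\ forall x, ~ ext (rcons L (v, u)) w y x.
  move=> vw; split.
    move=> e; have [|q qL] := src' (upd A u d y); first by rewrite e.
    by rewrite e => -[eq]; have := le' q qL; rewrite -eq leqNgt vw.
  move=> x /(_ w); rewrite eqxx orbT => h.
  by have /= := le' (w, x); rewrite h => /(_ isT); rewrite leqNgt vw.
split=> //.
- move=> x y xn yn; rewrite /upd; have [->|xu] := eqVneq x u; have [->|yu] := eqVneq y u.
  + by split.
  + split=> [/esym/dP h w|h].
      by rewrite mem_rcons_same mem_rcons_other // h // orbC.
    apply/esym/dP => // w; have := h w.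
    by rewrite mem_rcons_same mem_rcons_other // orbC.
  + split=> [/dP h w|h].
      by rewrite mem_rcons_same mem_rcons_other // h // orbC.
    apply/dP => // w; have := h w.
    by rewrite mem_rcons_same mem_rcons_other // orbC.
  + rewrite labP //; split=> h w; have := h w; by rewrite !mem_rcons_other.
- move=> w y yn Lw wy.
  have vw : v <= w by apply: (Lw (v, u)); rewrite mem_rcons inE eqxx.
  have [e|ne] := eqVneq w v; last first.
    have [h1 h2] : S' (upd A u d y) <> w.+1 /\ forall x, ~ ext (rcons L (v, u)) w y x.
      by apply: later; lia.
    by split=> [/h1|[x _ /h2]].
  subst w; have yu : y != u.
    by apply: contraNneq wy => ->; rewrite mem_rcons inE eqxx.
  have vy : (v, y) \notin L by rewrite mem_rcons_other in wy.
  rewrite /upd (negbTE yu).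
  have [e|ne] := eqVneq (A y) (A u).
    by rewrite e; split=> // _; exists u => //; apply/extS.
  have [-> _] := off _ (elimN eqP ne).
  rewrite stampP //; split=> -[x xn h].
    exists x => //; apply/extO => //; apply: contraNneq vuL => xu.
    by have := h v; rewrite xu eqxx orbT => ->.
  exists x => //; apply/extO => //; apply: contraNneq ne => xu.
  by move: h; rewrite xu => /extS->.
- move=> w y yn Lw wy.
  have vw : v <= w by apply: (Lw (v, u)); rewrite mem_rcons inE eqxx.
  have [e|ne] := eqVneq w v; last first.
    by case: (@later w y); first lia.
  subst w; have yu : y != u.
    by apply: contraNneq wy => ->; rewrite mem_rcons inE eqxx.
  have vy : (v, y) \notin L by rewrite mem_rcons_other in wy.
  rewrite {1 3}/upd (negbTE yu).
  have [e|ne] := eqVneq (A y) (A u).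
    rewrite e Nu => _ x xn; rewrite /upd; have [->|xu] := eqVneq x u.
      by split=> // _; apply/extS.
    rewrite dP // extO //; have sm : same L u y by apply/labP.
    by split=> h w; have := h w; rewrite sm.
  have [-> ->] := off _ (elimN eqP ne).
  move=> st x xn; rewrite /upd; have [->|xu] := eqVneq x u.
    split=> [e|/extS e]; last by rewrite e ?eqxx in ne.
    by case: (dN y yn vy st (elimN eqP ne)).
  by rewrite extO //; apply: newP.
- by move=> x; rewrite /upd; case: eqP => // _; apply: leq_trans (ltP _) ff'.
- move=> c; have [->|/eqP/off[-> ->]] := eqVneq c (A u); first by rewrite Nu.
  by move=> /newltP h; apply: leq_trans h ff'.
by rewrite size_rcons; lia.
Qed.

Lemma rinv_old L A S N f v u :
  rinv L A S N f -> u < n -> (v, u) \notin L -> {in L, forall q, q.1 <= v} ->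
  S (A u) = v.+1 -> rinv (rcons L (v, u)) (upd A u (N (A u))) S N f.
Proof.
move=> I un vuL Lv st; have [labP stampP newP srcP ltP newltP freshP] := I.
have h := newP v u un Lv vuL st.
apply: (rinv_step I) => //; last by apply: newltP; rewrite st.
- by move=> x xn _; apply: h.
- move=> y yn vy sty ne e; have [x xn ex] := (stampP v u un Lv vuL).1 st.
  have ey : ext L v y x by apply/(newP v y) => //; rewrite e; apply/h.
  case: ne; apply/labP => // w; have := ex w; rewrite ey.
  by case: eqP => [->|_]; rewrite ?(negbTE vuL) ?(negbTE vy) // !orbF.
Qed.

(** Without a current stamp no companion of [u] has met [v], so the label to be created must be
    empty; [f] exceeds all labels in use or recorded. *)
Lemma rinv_split L A S N f v u :
  rinv L A S N f -> u < n -> (v, u) \notin L -> {in L, forall q, q.1 <= v} ->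
  S (A u) <> v.+1 ->
  rinv (rcons L (v, u)) (upd A u f) (upd S (A u) v.+1) (upd N (A u) f) f.+1.
Proof.
move=> I un vuL Lv st; have [labP stampP newP srcP ltP newltP freshP] := I.
apply: (rinv_step I) => //; rewrite ?/upd ?eqxx //.
- move=> x xn xu; split=> [e|h]; first by have := ltP x; lia.
  by case: st; apply/stampP => //; exists x.
- by move=> y yn vy sty ne e; have := newltP (A y); rewrite sty => /(_ isT); lia.
by move=> c /eqP/negbTE->.
Qed.

End Refinement.

(** * Loop schemes: filling, counting, truncating, minima, refinement *)

Definition src := Get 2 (Reg 3).
Definition dst := Get 3 (Reg 3).
(** One of the truncated differences is 0, so this is the distance; it expresses equality and
    inequality through the only available test [<=]. *)
Definition absd e1 e2 := Plus (Minus e1 e2) (Minus e2 e1).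
Definition nz e := Minus (Cst 1) (Minus (Cst 1) e).

Lemma iotaSr j : iota 0 j.+1 = rcons (iota 0 j) j.
Proof. by rewrite -addn1 iotaD add0n /= cats1. Qed.

Lemma card_ord_count n (P : pred nat) :
  #|[set u : 'I_n | P u]| = count P (iota 0 n).
Proof.
by rewrite cardsE cardE size_filter -enumT -val_enum_ord count_map; apply: eq_count.
Qed.

Lemma upd_same V (f : nat -> V) i v : upd f i v i = v.
Proof. by rewrite /upd eqxx. Qed.

Lemma upd_other V (f : nat -> V) i v j : j != i -> upd f i v j = f j.
Proof. by rewrite /upd => /negbTE->. Qed.

Ltac fits_lia := rewrite ?andbT; repeat (apply/andP; split); try done; try lia.

Section Macros.
Variable W : nat.

Definition fill x b e := For x (Put b (Reg 3) e).

Lemma run_fill x b e s N (f : nat -> nat) :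
  regs s x = N -> N < W -> x != 3 ->
  (forall j s', j < N -> frame [:: 3] [:: b] s s' -> regs s' 3 = j ->
     fits W s' e /\ eval s' e = f j) ->
  run W (fill x b e) s ((ecost e + 12) * N.+1)
    (fun s' => forall i, i < N -> arrs s' b i = f i).
Proof.
move=> xN NW nx he.
pose I j s' := forall i, i < j -> arrs s' b i = f i.
apply: run_weaken; first apply: (run_for (I := I) xN NW nx) => //=.
- move=> j s' jN fr ej Ij.
  have [fe ee] := he _ _ jN fr ej.
  split; rewrite ?ej //; first by rewrite andbT; lia.
  move=> i; rewrite ltnS leq_eqVlt /= /upd eqxx.
  by case: eqP => [->|_] //= ij; apply: Ij.
- by rewrite leq_mul2r /=; lia.
by [].
Qed.

Definition histogram x b idx g1 g2 :=
  For x (If g1 g2 (Put b idx (Plus (Get b idx) (Cst 1))) Skip).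

Lemma run_histogram x b idx g1 g2 s N (ix : nat -> nat) (gd : pred nat) :
  regs s x = N -> N < W -> x != 3 -> (forall i, arrs s b i = 0) ->
  (forall j s', j < N -> frame [:: 3] [:: b] s s' -> regs s' 3 = j ->
     [/\ fits W s' idx, fits W s' g1, fits W s' g2, eval s' idx = ix j &
         (eval s' g1 <= eval s' g2) = gd j]) ->
  run W (histogram x b idx g1 g2) s
    ((ecost g1 + ecost g2 + 2 * ecost idx + 20) * N.+1)
    (fun s' => forall i,
       arrs s' b i = count (fun j => gd j && (ix j == i)) (iota 0 N)).
Proof.
move=> xN NW nx b0 he.
pose I j s' := forall i,
  arrs s' b i = count (fun j => gd j && (ix j == i)) (iota 0 j).
apply: run_weaken; first apply: (run_for (I := I) xN NW nx) => //=; last first.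
- by [].
- by rewrite leq_mul2r /=; lia.
move=> j s' jN fr ej Ij; rewrite /I iotaSr.
have cl i : count (fun j => gd j && (ix j == i)) (iota 0 j) <= j.
  by rewrite -{2}(size_iota 0 j) count_size.
have [fi f1 f2 ei eg] := he _ _ jN fr ej.
split=> //; rewrite eg; case gj: (gd j) => /=.
  have := cl (ix j); rewrite -Ij => clj.
  rewrite ei; split=> //.
    by rewrite fi; apply/and4P; split; lia.
  move=> i; rewrite /= /upd eqxx -cats1 count_cat /= gj -Ij.
  by rewrite [ix j == i]eq_sym; case: eqP => [->|_]; rewrite /= ?addn0.
by move=> i; rewrite -cats1 count_cat /= gj -Ij !addn0.
Qed.

Definition truncate ka kb cl ct thr :=
  For 0 (If (Cst 1) (Get ka (Reg 3))
    (If (Plus (Get ct (Get cl (Reg 3))) (Cst 1)) thr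
       (Seq (Put kb (Reg 3) (Cst 1))
            (Put ct (Get cl (Reg 3)) (Plus (Get ct (Get cl (Reg 3))) (Cst 1))))
       Skip) Skip).

(** Each class keeps its first [th] candidates. A candidate is dropped only when the counter of its
    class has reached [th], and counters never decrease. *)
Lemma run_truncate ka kb cl ct thr s N th :
  regs s 0 = N -> N < W -> uniq [:: kb; ct; ka] -> uniq [:: kb; ct; cl] ->
  (forall i, arrs s kb i = 0) -> (forall i, arrs s ct i = 0) ->
  (forall i, i < N -> arrs s ka i <= W /\ arrs s cl i <= W) ->
  (forall s', frame [:: 3] [:: kb; ct] s s' -> fits W s' thr /\ eval s' thr = th) ->
  let kept f c := count (fun i => (0 < f i) && (arrs s cl i == c)) (iota 0 N) in
  run W (truncate ka kb cl ct thr) s ((ecost thr + 40) * N.+1)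
    (fun s' => [/\ forall i, arrs s' kb i <= (0 < arrs s ka i) && (i < N),
       forall c, kept (arrs s' kb) c <= th &
       forall i, i < N -> 0 < arrs s ka i -> arrs s' kb i = 0 ->
         th <= kept (arrs s' kb) (arrs s cl i)]).
Proof.
move=> xN NW; rewrite /= !inE !negb_or !andbT.
move=> /andP[/andP[kbct kbka] ctka] /andP[/andP[_ kbcl] ctcl] kb0 ct0 bnd hthr.
pose kept j f c := count (fun i => (0 < f i) && (arrs s cl i == c)) (iota 0 j).
pose I j s' := [/\ forall i, arrs s' kb i <= (0 < arrs s ka i) && (i < j),
   forall c, arrs s' ct c = kept j (arrs s' kb) c,
   forall c, arrs s' ct c <= th &
   forall i, i < j -> 0 < arrs s ka i -> arrs s' kb i = 0 ->
         th <= arrs s' ct (arrs s cl i)].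
apply: run_weaken; first apply: (run_for (I := I) xN NW) => //=.
- by split=> //= i; rewrite ?kb0 ?ct0.
- move=> j s' jN fr ej [I1 I2 I3 I4].
  have [_ fa] := fr.
  have eka : arrs s' ka = arrs s ka.
    by apply: fa; rewrite !inE eq_sym (negbTE kbka) eq_sym (negbTE ctka).
  have ecl : arrs s' cl = arrs s cl.
    by apply: fa; rewrite !inE eq_sym (negbTE kbcl) eq_sym (negbTE ctcl).
  have [bka bcl] := bnd j jN.
  have [fth eth] := hthr s' fr.
  rewrite !ej eka ecl eth.
  have keptS f c : kept j.+1 f c = kept j f c + ((0 < f j) && (arrs s cl j == c)).
    by rewrite /kept iotaSr -cats1 count_cat /= addn0.
  have kbj : arrs s' kb j = 0 by have := I1 j; rewrite ltnn andbF leqn0 => /eqP.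
  have ctle : arrs s' ct (arrs s cl j) <= j.
    by rewrite I2; apply: leq_trans (count_size _ _) _; rewrite size_iota.
  split; [lia | by fits_lia |].
  case: (leqP 1 (arrs s ka j)) => [ka1|ka0]; last first.
    split=> [i|c|c|i] /=; rewrite ?keptS ?kbj ?addn0 //.
      by apply: leq_trans (I1 i) _; case: (0 < _) => //=; lia.
    rewrite ltnS leq_eqVlt => /orP[/eqP->|]; [lia | exact: I4].
  split; [by fits_lia | by [] |].
  case: (leqP (_ + 1) th) => [lt|ge]; last first.
    split=> [i|c|c|i] /=; rewrite ?keptS ?kbj ?addn0 //.
      by apply: leq_trans (I1 i) _; case: (0 < _) => //=; lia.
    rewrite ltnS leq_eqVlt => /orP[/eqP->|]; [lia | exact: I4].
  split; [by fits_lia | lia |]; split.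
  - by rewrite /= upd_other 1?eq_sym // ?ej ?ecl; fits_lia.
  - rewrite /= !(@upd_other _ _ kb) 1?eq_sym // ?ej ?ecl.
    by fits_lia.
  rewrite /I /= !upd_same !(@upd_other _ _ kb) 1?eq_sym // ?ej ?ecl.
  rewrite !(@upd_other _ _ ct) // !upd_same /upd.
  have kb' i : i < j -> (if i == j then 1 else arrs s' kb i) = arrs s' kb i.
    by move=> ij; rewrite ltn_eqF.
  have keptE c : kept j.+1 (fun k => if k == j then 1 else arrs s' kb k) c =
      (if c == arrs s cl j then arrs s' ct (arrs s cl j) + 1 else arrs s' ct c).
    rewrite keptS eqxx /= [c == _]eq_sym !I2.
    have -> : kept j (fun k => if k == j then 1 else arrs s' kb k) c = kept j (arrs s' kb) c.
      apply: eq_in_count => i; rewrite mem_iota add0n => /= ij; by rewrite kb'.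
    by case: eqP => [->|_]; rewrite ?addn0.
  split=> [i|c|c|i].
  + case: eqP => [->|_]; first by rewrite ka1 ltnSn.
    by apply: leq_trans (I1 i) _; case: (0 < _) => //=; lia.
  + by rewrite keptE.
  + by case: eqP => // _; lia.
  + rewrite ltnS leq_eqVlt; case: eqP => //= _ ij kai ki.
    have := I4 i ij kai ki; case: eqP => [->|//]; lia.
- by rewrite leq_mul2r /=; lia.
move=> s' [I1 I2 I3 I4]; split=> //.
  by move=> c; have := I3 c; rewrite I2.
by move=> i iN kai ki; have := I4 i iN kai ki; rewrite I2.
Qed.

(** Applied to the identity array and then to its own result, this gives the least vertex within
    distance 1 and within distance 2. *)
Definition min_pass a b :=
  Seq (fill 0 b (Get a (Reg 3)))
      (For 2 (If (Get a dst) (Get b src) (Put b src (Get a dst)) Skip)).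

(** Register 7 holds the old label and register 6 the next fresh one. Stamps are pivots plus one, so
    the initial 0 means never split. *)
Definition core_refine a st nw :=
  Seq (Asg 7 (Get a dst))
  (Seq (If (absd (Get st (Reg 7)) (Plus src (Cst 1))) (Cst 0) Skip
          (Seq (Put st (Reg 7) (Plus src (Cst 1)))
          (Seq (Put nw (Reg 7) (Reg 6))
               (Asg 6 (Plus (Reg 6) (Cst 1))))))
       (Put a dst (Get nw (Reg 7)))).

Definition refine a st nw g1 g2 :=
  Seq (Asg 6 (Cst 1)) (For 2 (If g1 g2 (core_refine a st nw) Skip)).

Section PairLoops.
Variables (n : nat) (E : seq (nat * nat)).
Let M := size E.
Let e_ i := nth (0, 0) E i.
Hypotheses (E_lt : forall q, q \in E -> q.1 < n /\ q.2 < n)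
  (E_uniq : uniq E) (E_sorted : sorted (fun p q => p.1 <= q.1) E)
  (nW : n.+2 < W) (MW : M.+2 < W).

Definition pairs_at s := [/\ regs s 2 = M,
  forall i, i < M -> arrs s 2 i = (e_ i).1 &
  forall i, i < M -> arrs s 3 i = (e_ i).2].

Lemma pairs_lt i : i < M -> (e_ i).1 < n /\ (e_ i).2 < n.
Proof. by move=> iM; apply: E_lt; apply: mem_nth. Qed.

(** Sortedness ensures that a stamp of an earlier pivot can never become current again. *)
Lemma pairs_before j : j < M -> {in take j E, forall q, q.1 <= (e_ j).1}.
Proof.
move=> jM q /(nthP (0, 0))[i]; rewrite size_takel; last exact: ltnW.
move=> ij <-; rewrite nth_take //.
have tr : transitive (fun p q : nat * nat => p.1 <= q.1).
  by move=> a b c; apply: leq_trans.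
apply: (sorted_ltn_nth tr (0, 0) E_sorted) => //; rewrite inE //.
exact: ltn_trans jM.
Qed.

Lemma pairs_new j : j < M -> e_ j \notin take j E.
Proof.
move=> jM; have : uniq (take j E ++ drop j E) by rewrite cat_take_drop.
rewrite cat_uniq; case/and3P => _ /hasPn h _; suff /h : e_ j \in drop j E by [].
by rewrite (drop_nth (0, 0)) // mem_head.
Qed.

Lemma run_min_pass a b s :
  regs s 0 = n -> pairs_at s -> uniq [:: b; 2; 3; a] ->
  (forall i, i < n -> arrs s a i <= W) ->
  run W (min_pass a b) s (40 * (n + M + 2))
    (fun s' => forall v, v < n ->
       (forall u, ((u == v) || ((v, u) \in E)) -> arrs s' b v <= arrs s a u) /\
       (exists2 u, (u == v) || ((v, u) \in E) & arrs s' b v = arrs s a u)).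
Proof.
move=> s0 [s2 eS eD]; rewrite /= !inE !negb_or !andbT.
move=> /andP[/and3P[b2 b3 ba] /andP[a2 a3]] bnd.
apply: run_le; first apply: run_seq.
  apply: run_weaken; first apply: run_frame;
    first apply: (@run_fill 0 b _ s n (arrs s a)) => //; first by lia.
  - move=> j s' jn [_ fa] ej; rewrite /= ej fa ?inE 1?eq_sym //.
    by have := bnd j jn; split=> //; fits_lia.
  - exact: leqnn.
  move=> s1 [b1 [fr fa]].
  pose I j s' := forall v, v < n ->
       (forall u, ((u == v) || ((v, u) \in take j E)) -> arrs s' b v <= arrs s a u) /\
       (exists2 u, (u == v) || ((v, u) \in take j E) & arrs s' b v = arrs s a u).
  apply: run_weaken; first apply: (@run_for W 2 _ I s1 M) => //=.
  - by rewrite fr.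
  - by lia.
  - move=> v vn; rewrite b1 //; split=> [u|]; last by exists v; rewrite ?eqxx.
    by rewrite take0 in_nil orbF => /eqP->.
  - move=> j s' jM [fr' fa'] ej Ij.
    have ea : arrs s' a = arrs s a by rewrite fa' ?inE 1?eq_sym // fa ?inE 1?eq_sym.
    have e2 : arrs s' 2 j = (e_ j).1 by rewrite fa' ?inE 1?eq_sym // fa ?inE 1?eq_sym // eS.
    have e3 : arrs s' 3 j = (e_ j).2 by rewrite fa' ?inE 1?eq_sym // fa ?inE 1?eq_sym // eD.
    have [lt1 lt2] := pairs_lt jM.
    have bs := Ij _ lt1; rewrite !ej ea e2 e3.
    have [bmin [u0 u0P bu0]] := bs.
    have u0n : u0 < n.
      by case/orP: u0P => [/eqP->//|/mem_take/E_lt[]].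
    have := bnd _ lt2; have := bnd _ u0n => h1 h2.
    have IS u v : ((v, u) \in take j.+1 E) = ((v, u) == e_ j) || ((v, u) \in take j E).
      by rewrite (take_nth (0, 0)) // mem_rcons inE.
    split; [by fits_lia | by rewrite bu0; fits_lia |].
    case: leqP => le.
      split; [by fits_lia | by fits_lia |].
      move=> v vn; rewrite /= upd_same /upd; have [->|ne] := eqVneq v (e_ j).1.
        split=> [u|]; last first.
          by exists (e_ j).2; rewrite // IS -surjective_pairing eqxx orbT.
        rewrite IS orbCA => /orP[/eqP/(congr1 snd)/= -> //|uP].
        by apply: leq_trans le _; apply: bmin.
      have [h3 [u4 h4 h5]] := Ij v vn; split=> [u|].
        rewrite IS orbCA => /orP[/eqP/(congr1 fst)/= e|]; last exact: h3.
        by rewrite e eqxx in ne.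
      by exists u4 => //; rewrite IS orbCA h4 orbT.
    move=> v vn /=; have [h3 [u4 h4 h5]] := Ij v vn; split=> [u|].
      rewrite IS orbCA => /orP[/eqP e|]; last exact: h3.
      by rewrite -[v]/(v, u).1 -[u in arrs s a u]/(v, u).2 e; apply: ltnW.
    by exists u4 => //; rewrite IS orbCA h4 orbT.
  - exact: leqnn.
  by move=> s'; rewrite /I take_oversize.
by rewrite /=; lia.
Qed.

Lemma run_refine a st nw g1 g2 (gd : pred (nat * nat)) s :
  pairs_at s -> uniq [:: a; st; nw; 2; 3] ->
  (forall i, [/\ arrs s a i = 0, arrs s st i = 0 & arrs s nw i = 0]) ->
  (forall j s', j < M -> frame [:: 3; 7; 6] [:: st; nw; a] s s' -> regs s' 3 = j ->
     [/\ fits W s' g1, fits W s' g2 & (eval s' g1 <= eval s' g2) = gd (e_ j)]) ->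
  run W (refine a st nw g1 g2) s ((ecost g1 + ecost g2 + 80) * M.+1)
    (fun s' => (forall u x, u < n -> x < n ->
        (arrs s' a u = arrs s' a x <-> same [seq q <- E | gd q] u x)) /\
      forall u, arrs s' a u <= M).
Proof.
move=> [s2 eS eD]; rewrite /= !inE !negb_or !andbT.
move=> /and4P[/and4P[ast anw a2 a3] /and3P[stnw st2 st3] nw2 nw3] z hg.
pose I j s' := rinv n [seq q <- take j E | gd q]
  (arrs s' a) (arrs s' st) (arrs s' nw) (regs s' 6).
apply: run_le; first apply: run_seq.
  apply: run_weaken; first apply: wp_run => /=.
  - by split; [lia | exact: erefl].
  - exact: leqnn.
  move=> s1 <-; set s0 := set_reg _ _ _.
  apply: run_weaken; first apply: (@run_for W 2 _ I s0 M) => //=.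
  - by lia.
  - by rewrite /I take0 /=; apply: rinv0 => i; have [] := z i.
  - move=> j s' jM fr0 ej Ij.
    have fr : frame [:: 3; 7; 6] [:: st; nw; a] s s'.
      case: fr0 => fr fa; split=> // r rn; rewrite fr // /s0 /= upd_other //.
      by move: rn; rewrite !inE !negb_or => /and3P[].
    have [f1 f2 eg] := hg j s' jM fr ej; split=> //; rewrite eg.
    have eT : take j.+1 E = rcons (take j E) (e_ j) by rewrite (take_nth (0, 0)).
    rewrite /I eT filter_rcons.
    case gj: (gd (e_ j)) => //=.
    have e2 : arrs s' 2 j = (e_ j).1.
      by rewrite fr.2 ?eS // !inE !negb_or 1?eq_sym st2 1?eq_sym nw2 1?eq_sym.
    have e3 : arrs s' 3 j = (e_ j).2.
      by rewrite fr.2 ?eD // !inE !negb_or 1?eq_sym st3 1?eq_sym nw3 1?eq_sym.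
    have [lt1 lt2] := pairs_lt jM.
    have vuL : ((e_ j).1, (e_ j).2) \notin [seq q <- take j E | gd q].
      by rewrite mem_filter negb_and -surjective_pairing (pairs_new jM) orbT.
    have Lv : {in [seq q <- take j E | gd q], forall q, q.1 <= (e_ j).1}.
      by move=> q; rewrite mem_filter => /andP[_]; apply: pairs_before.
    have [labP stampP newP srcP ltP newltP freshP] := Ij.
    (* At most one label is created per pair, so labels fit in a machine word. *)
    have fM : regs s' 6 <= M.+1.
      apply: leq_trans freshP _; rewrite ltnS size_filter.
      apply: leq_trans (count_size _ _) _; rewrite size_take.
      by rewrite jM; apply: ltnW.
    have Sn c : arrs s' st c <= n.
      have [->//|/srcP[q]] := eqVneq (arrs s' st c) 0.
      by rewrite mem_filter => /andP[_ /mem_take/E_lt[qn _]] ->.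
    rewrite !(@upd_other _ _ 6 _ 7 isT) !(@upd_other _ _ 6 _ 3 isT).
    rewrite !(@upd_other _ _ 7 _ 6 isT) !(@upd_other _ _ 7 _ 3 isT) !upd_same.
    rewrite !ej e2 e3; set u := (e_ j).2; set v := (e_ j).1.
    have x2 : 2 != st by rewrite eq_sym.
    have x3 : 3 != st by rewrite eq_sym.
    have x3' : 3 != nw by rewrite eq_sym.
    have nwst : nw != st by rewrite eq_sym.
    have := ltP u => lu; have := Sn (arrs s' a u) => ls.
    rewrite [e_ j]surjective_pairing -/u -/v.
    split; first by fits_lia.
    split; first by rewrite /= ?ej ?e2; fits_lia.
      by fits_lia.
    have sta : st != a by rewrite eq_sym.
    have nwa : nw != a by rewrite eq_sym.
    rewrite /= ?ej ?e2 -/v.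
    do 3 rewrite ?upd_same ?(upd_other _ _ x3') ?(upd_other _ _ x3)
      ?(upd_other _ _ nwst) ?(upd_other _ _ stnw) ?(upd_other _ _ anw)
      ?(upd_other _ _ ast) ?(upd_other _ _ sta) ?(upd_other _ _ nwa).
    rewrite !(@upd_other _ _ 3 _ 6 isT) !(@upd_other _ _ 7 _ 6 isT) ?upd_same.
    rewrite ?ej e3 -/u !addn1.
    have [le|gt] := leqP (arrs s' st (arrs s' a u) - v.+1 + (v.+1 - arrs s' st (arrs s' a u))) 0.
      have es : arrs s' st (arrs s' a u) = v.+1 by lia.
      have := newltP (arrs s' a u); rewrite es => /(_ isT) ln.
      by split; [fits_lia | fits_lia | exact: rinv_old].
    have es : arrs s' st (arrs s' a u) <> v.+1 by lia.
    split; [by fits_lia | by fits_lia |].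
    split; [by fits_lia | by fits_lia |].
    split; first by fits_lia.
    by split; [fits_lia | fits_lia | exact: rinv_split].
  - exact: leqnn.
  move=> s'; rewrite /I take_oversize // => -[labP _ _ _ ltP _ freshP]; split=> // u.
  rewrite -ltnS; apply: leq_trans (ltP u) _; apply: leq_trans freshP _; rewrite ltnS size_filter; exact: count_size.
by rewrite /=; lia.
Qed.

End PairLoops.

End Macros.

(** * Writing the kernel *)

Section Emit.
Variables (W n : nat) (E : seq (nat * nat)).
Let M := size E.
Let e_ i := nth (0, 0) E i.
Hypotheses (E_lt : forall q, q \in E -> q.1 < n /\ q.2 < n)
  (nW : n.+2 < W) (MW : M.+2 < W).

(** The diagonal pair [(v, v)] heads the block of [v]: there the degree is written, elsewhere the
    new name of the neighbour. One pass over the pairs thus yields the adjacency lists; position 2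
    skips the header. *)
Definition emit :=
  Seq (Put 1 (Cst 0) (Reg 8)) (Seq (Put 1 (Cst 1) (Reg 1)) (Seq (Asg 12 (Cst 2))
  (For 2 (If (Cst 2) (Plus (Get 26 src) (Get 26 dst))
    (Seq (If (absd src dst) (Cst 0)
            (Put 1 (Reg 12) (Get 28 src)) (Put 1 (Reg 12) (Get 27 dst)))
         (Asg 12 (Plus (Reg 12) (Cst 1))))
    Skip)))).

Definition out_item (keep dg id : nat -> nat) (q : nat * nat) : seq nat :=
  if 1 < keep q.1 + keep q.2 then [:: if q.1 == q.2 then dg q.1 else id q.2]
  else [::].

Lemma run_emit s : pairs_at E s -> regs s 8 <= W -> regs s 1 <= W ->
  (forall i, i < n -> [/\ arrs s 26 i <= 1, arrs s 27 i <= W & arrs s 28 i <= W]) ->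
  run W emit s (70 * M.+1) (fun s' => output_is s' (regs s 8 :: regs s 1 ::
    flatten [seq out_item (arrs s 26) (arrs s 28) (arrs s 27) q | q <- E])).
Proof.
move=> [s2 eS eD] w8 w1 bnd; set it := out_item _ _ _.
pose out j := regs s 8 :: regs s 1 :: flatten [seq it q | q <- take j E].
have szo j : size (out j) <= (minn j M).+2.
  have szf t : size (flatten [seq it q | q <- t]) <= size t.
    elim: t => //= q t IH.
    by rewrite size_cat -add1n leq_add // /it /out_item; case: ifP.
  by apply: leq_trans (szf _) _; rewrite size_take_min.
pose I j s' := regs s' 12 = size (out j) /\
  forall i, i < size (out j) -> arrs s' 1 i = nth 0 (out j) i.
apply: run_le; first apply: run_seq.
  apply: run_weaken; first apply: wp_run => /=.
  - by split; [lia | by rewrite andbT | exact: erefl].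
  - exact: leqnn.
  move=> s1 <-; apply: run_seq; apply: run_weaken; first apply: wp_run => /=.
  - by split; [lia | by rewrite andbT | exact: erefl].
  - exact: leqnn.
  move=> s3 <-; apply: run_seq; apply: run_weaken; first apply: wp_run => /=.
  - by split; [lia | exact: erefl].
  - exact: leqnn.
  move=> s4 <-.
  apply: run_weaken; first apply: (@run_for W 2 _ I _ M) => //=.
  - by lia.
  - rewrite /I /out take0 /=; split=> // i i2; rewrite /= upd_same upd_same.
    by rewrite /upd; case: i i2 => [|[|]].
  - move=> j s' jM [fr fa] ej [I12 I1].
    have e2 : arrs s' 2 j = (e_ j).1 by rewrite fa //; apply: eS.
    have e3 : arrs s' 3 j = (e_ j).2 by rewrite fa //; apply: eD.
    have outS : out j.+1 = out j ++ it (e_ j).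
      by rewrite /out (take_nth (0, 0)) // map_rcons flatten_rcons.
    have := pairs_lt E_lt jM; move: e2 e3 outS; rewrite -/(e_ j).
    case: (e_ j) => v u /= e2 e3 outS [lt1 lt2].
    have [so eso] : exists so, so = size (out j) by exists (size (out j)).
    rewrite -eso in I12 I1.
    have e26 : arrs s' 26 = arrs s 26 by rewrite fa.
    have e27 : arrs s' 27 = arrs s 27 by rewrite fa.
    have e28 : arrs s' 28 = arrs s 28 by rewrite fa.
    rewrite !ej e2 e3 I12 e26 e27 e28.
    have [k1 i1 d1] := bnd _ lt1; have [k2 i2 d2] := bnd _ lt2.
    have := szo j; rewrite (minn_idPl (ltnW jM)) -eso => szj.
    split; [by lia | by fits_lia |].
    rewrite /I outS -[it _]/(if 1 < arrs s 26 v + arrs s 26 u then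
      [:: if v == u then arrs s 28 v else arrs s 27 u] else [::]); case: (1 < arrs s 26 v + arrs s 26 u); last by rewrite cats0 -eso; split.
    split; [by fits_lia | by lia |].
    rewrite (_ : (_ - _ + _ <= 0) = (v == u)); last by lia.
    have fin x : forall i, i < size (out j ++ [:: x]) ->
        upd (arrs s' 1) so x i = nth 0 (out j ++ [:: x]) i.
      move=> i; rewrite size_cat addn1 ltnS leq_eqVlt nth_cat /upd -eso.
      by case: eqP => [->|_ /= h]; [rewrite ltnn subnn | rewrite h I1].
    case: eqP => _; split; rewrite ?I12; [by fits_lia | by fits_lia | | by fits_lia | by fits_lia |];
      (split; first by fits_lia); (split; last exact: fin);
      by rewrite /= (@upd_other _ _ 3 _ 12 isT) upd_same eso /= size_cat !addn1.
  - exact: leqnn.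
  by move=> s' [_ h]; move: h; rewrite /out take_oversize.
by rewrite /=; lia.
Qed.

End Emit.

Lemma flatten_map_filter (S T : Type) (P : pred S) (F : S -> seq T) s :
  (forall x, ~~ P x -> F x = [::]) ->
  flatten [seq F x | x <- s] = flatten [seq F x | x <- s & P x].
Proof.
move=> h; elim: s => //= x s ->; case: (boolP (P x)) => //= /h -> //.
Qed.

Lemma drop_enum_ord n v (vn : v < n) :
  drop v (enum 'I_n) = Ordinal vn :: drop v.+1 (enum 'I_n).
Proof.
rewrite (drop_nth (Ordinal vn)) ?size_enum_ord //; congr cons.
exact: (nth_ord_enum (Ordinal vn) (Ordinal vn)).
Qed.

(** * Decoding the adjacency lists *)

Section Input.
Variables (n k : nat) (G : sgraph 'I_n) (nb : 'I_n -> seq 'I_n).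
Hypothesis nbP : forall v, uniq (nb v) /\ nb v =i G v.

Definition wblock (v : 'I_n) := size (nb v) :: map val (nb v).
Definition wbody := flatten [seq wblock v | v <- enum 'I_n].

(** The diagonal pair takes the place of the degree word, so pair [i] corresponds to input word
    [i + 2], and the list describes closed neighbourhoods. *)
Definition eblock (v : 'I_n) : seq (nat * nat) :=
  (val v, val v) :: [seq (val v, val u) | u <- nb v].
Definition pairs := flatten [seq eblock v | v <- enum 'I_n].

Lemma mem_nb v u : (u \in nb v) = G v u.
Proof. by have [_ ->] := nbP v. Qed.

Lemma size_pairs : size pairs = size wbody.
Proof.
rewrite !size_flatten /shape -!map_comp; congr sumn; apply: eq_map => v /=.
by rewrite !size_map.
Qed.

Lemma mem_pairs (v u : 'I_n) : ((val v, val u) \in pairs) = (u == v) || G v u.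
Proof.
apply/flatten_mapP/idP => [[x _]|h].
  rewrite inE => /orP[/eqP[/val_inj-> /val_inj->]|/mapP[y yx]]; first by rewrite eqxx.
  by case=> /val_inj-> /val_inj->; rewrite -mem_nb yx orbT.
exists v; rewrite ?mem_enum // inE; case/orP: h => [/eqP->|]; first by rewrite eqxx.
by rewrite -mem_nb => h; apply/orP; right; apply/mapP; exists u.
Qed.

Lemma pairs_ord q : q \in pairs -> exists v u : 'I_n, q = (val v, val u).
Proof.
case/flatten_mapP => v _; rewrite inE => /orP[/eqP->|/mapP[u _ ->]].
  by exists v, v.
by exists v, u.
Qed.

Lemma pairs_bound q : q \in pairs -> q.1 < n /\ q.2 < n.
Proof. by case/pairs_ord => v [u ->]; rewrite !ltn_ord. Qed.

Lemma filter_pairs (v : 'I_n) : [seq q <- pairs | q.1 == val v] = eblock v.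
Proof.
rewrite /pairs filter_flatten -map_comp.
have bl (x : 'I_n) : [seq q <- eblock x | q.1 == val v] = if x == v then eblock v else [::].
  case: eqVneq => [->|ne].
    apply/all_filterP/allP => q; rewrite inE => /orP[/eqP-> //|/mapP[u _ -> //]].
  apply/eqP; rewrite -(negbK (_ == _)) -has_filter; apply/hasPn => q.
  by rewrite inE => /orP[/eqP->|/mapP[u _ ->]] /=.
rewrite (eq_map bl) /= (@flatten_map_filter _ _ (pred1 v)); last first.
  by move=> x /= /negbTE->.
rewrite filter_pred1_uniq ?enum_uniq ?mem_enum //= eqxx cats0 //.
Qed.

Lemma pairs_uniq : uniq pairs.
Proof.
apply: count_mem_uniq => q; case: (boolP (q \in pairs)) => [qp|/count_memPn //].
have [v [u eq]] := pairs_ord qp.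
have -> : count_mem q pairs = count_mem q [seq p <- pairs | p.1 == val v].
  rewrite count_filter; apply: eq_count => p /=; case: eqP => [->|//].
  by rewrite eq /= eqxx.
rewrite filter_pairs; have uq : uniq (eblock v).
  rewrite /= map_inj_uniq; last by move=> a b [/val_inj].
  have [-> _] := nbP v; rewrite andbT; apply/mapP => -[a av [/val_inj e]].
  by move: av; rewrite -e mem_nb adj_irr.
rewrite count_uniq_mem // -filter_pairs mem_filter qp eq eqxx //.
Qed.

Lemma pairs_sorted : sorted (fun p q => p.1 <= q.1) pairs.
Proof.
rewrite sorted_pairwise; last by move=> a b c; apply: leq_trans.
have : sorted ltn (map val (enum 'I_n)) by rewrite val_enum_ord iota_ltn_sorted.
rewrite /pairs; elim: (enum 'I_n) => // x s IH.
rewrite -[flatten _]/(eblock x ++ flatten [seq eblock v | v <- s]).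
rewrite [sorted _ _]/= (path_sortedE ltn_trans).
case/andP => /allP xs /IH {}IH; rewrite pairwise_cat IH andbT; apply/andP; split.
  apply/allrelP => p q; rewrite inE => px /flatten_mapP[y ys qy].
  have -> : p.1 = val x by case/orP: px => [/eqP->|/mapP[a _ ->]].
  have -> : q.1 = val y by move: qy; rewrite inE => /orP[/eqP->|/mapP[a _ ->]].
  by apply/ltnW/xs/map_f.
rewrite /= all_map; apply/andP; split; first by apply/allP => u _ /=.
rewrite pairwise_map; apply/(pairwiseP x) => i j _ _ _ /=; exact: leqnn.
Qed.

Lemma size_pairs_le : size pairs <= n + 2 * #|edges G|.
Proof.
have -> : size pairs = n + \sum_(v < n) #|[set u | G v u]|.
  rewrite size_flatten /shape -map_comp sumnE big_map big_enum /=.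
  rewrite -[X in X + _]card_ord -sum1_card -big_split; apply: eq_bigr => v _ /=.
  rewrite size_map -add1n; congr (_ + _).
  by have [/card_uniqP <- _] := nbP v; apply: eq_card => u; rewrite inE mem_nb.
rewrite leq_add2l; apply: leq_trans (card_edges_pairs G).
rewrite -sum1_card (eq_bigl (fun q : 'I_n * 'I_n => G q.1 q.2)); last first.
  by move=> q; rewrite inE.
rewrite -(pair_big_dep xpredT (fun v u => G v u) (fun _ _ => 1)) /=.
apply: leq_sum => v _; rewrite -sum1_card; apply: eq_leq.
by apply: eq_bigl => u; rewrite inE.
Qed.

Variable W : nat.
Let M := size pairs.
Hypotheses (nW : n.+3 < W) (MW : M.+4 < W).
Let w := n :: k :: wbody.

(** The input does not state its length. Jumping from one degree word to the next finds its end in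
    [n] steps. *)
Definition scan_degrees :=
  Seq (Asg 4 (Cst 2))
  (Seq (For 0 (Asg 4 (Plus (Plus (Reg 4) (Get 0 (Reg 4))) (Cst 1))))
       (Asg 2 (Minus (Reg 4) (Cst 2)))).

Lemma wbody_split v (vn : v < n) :
  wbody = flatten [seq wblock x | x <- take v (enum 'I_n)] ++
    wblock (Ordinal vn) ++ flatten [seq wblock x | x <- drop v.+1 (enum 'I_n)].
Proof.
by rewrite /wbody -{1}(cat_take_drop v (enum 'I_n)) map_cat flatten_cat (drop_enum_ord vn).
Qed.

Lemma take_enum_ord v (vn : v < n) :
  take v.+1 (enum 'I_n) = rcons (take v (enum 'I_n)) (Ordinal vn).
Proof.
rewrite (take_nth (Ordinal vn)) ?size_enum_ord //; congr rcons.
exact: (nth_ord_enum (Ordinal vn) (Ordinal vn)).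
Qed.

Lemma run_scan_degrees s : regs s 0 = n -> (forall i, arrs s 0 i = nth 0 w i) ->
  run W scan_degrees s (30 * n.+1) (fun s' => regs s' 2 = M).
Proof.
move=> s0 sw.
apply: run_le; first apply: run_seq.
  apply: run_weaken; first apply: wp_run => /=.
  - by split; [lia | exact: erefl].
  - exact: leqnn.
  move=> s1 <-; apply: run_seq.
  pose I j s' := regs s' 4 = 2 + size (flatten [seq wblock x | x <- take j (enum 'I_n)]).
  apply: run_weaken; first apply: (@run_for W 0 _ I _ n) => //=.
  - by lia.
  - by rewrite /I take0.
  - move=> j s' jn [fr fa] ej Ij; rewrite /I /= upd_other // upd_same Ij fa // sw.
    have eM : M = size (flatten [seq wblock x | x <- take j (enum 'I_n)]) +
        ((size (nb (Ordinal jn))).+1 +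
         size (flatten [seq wblock x | x <- drop j.+1 (enum 'I_n)])).
      by rewrite /M size_pairs (wbody_split jn) !size_cat /= size_map.
    have -> : nth 0 w (2 + size (flatten [seq wblock x | x <- take j (enum 'I_n)])) =
        size (nb (Ordinal jn)).
      by rewrite /= (wbody_split jn) nth_cat ltnn subnn.
    rewrite (take_enum_ord jn) map_rcons flatten_rcons size_cat /= size_map.
    have := MW; rewrite eM; move: (size _) (size (nb _)) (size _) => p q r MW'.
    by split; [fits_lia | lia].
  - exact: leqnn.
  move=> s2; rewrite /I take_oversize ?size_enum_ord // => e.
  apply: run_weaken; first apply: wp_run => /=.
  - rewrite e -/wbody -size_pairs -/M addKn; split; last exact: erefl.
    by fits_lia.
  - exact: leqnn.
  by move=> s' <-; rewrite /= upd_same.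
by rewrite /=; lia.
Qed.

(** Register 5 counts the neighbours still to be read in the current block; at 0 the next word is a
    degree. Register 4 counts the opened blocks, so the current vertex is one less. *)
Definition scan_pairs :=
  Seq (Asg 4 (Cst 0)) (Seq (Asg 5 (Cst 0))
  (For 2 (If (Reg 5) (Cst 0)
    (Seq (Put 2 (Reg 3) (Reg 4)) (Seq (Put 3 (Reg 3) (Reg 4))
    (Seq (Asg 5 (Get 0 (Plus (Reg 3) (Cst 2)))) (Asg 4 (Plus (Reg 4) (Cst 1))))))
    (Seq (Put 2 (Reg 3) (Minus (Reg 4) (Cst 1)))
    (Seq (Put 3 (Reg 3) (Get 0 (Plus (Reg 3) (Cst 2))))
         (Asg 5 (Minus (Reg 5) (Cst 1)))))))).

Lemma run_scan_pairs s : regs s 2 = M -> (forall i, arrs s 0 i = nth 0 w i) ->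
  run W scan_pairs s (60 * M.+1)
    (fun s' => (forall i, i < M -> arrs s' 2 i = (nth (0, 0) pairs i).1) /\
               (forall i, i < M -> arrs s' 3 i = (nth (0, 0) pairs i).2)).
Proof.
move=> s2 sw.
(* The list [l] is the unread part of the current block; words and pairs are consumed in step. *)
pose I e s' := [/\ regs s' 4 <= n,
  forall i, i < e -> arrs s' 2 i = (nth (0, 0) pairs i).1,
  forall i, i < e -> arrs s' 3 i = (nth (0, 0) pairs i).2 &
  exists l, [/\ size l = regs s' 5,
    drop e wbody = l ++ flatten [seq wblock x | x <- drop (regs s' 4) (enum 'I_n)] &
    drop e pairs = [seq ((regs s' 4).-1, x) | x <- l] ++
       flatten [seq eblock x | x <- drop (regs s' 4) (enum 'I_n)]]].
apply: run_le; first apply: run_seq.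
  apply: run_weaken; first apply: wp_run => /=.
  - by split; [lia | exact: erefl].
  - exact: leqnn.
  move=> s1 <-; apply: run_seq.
  apply: run_weaken; first apply: wp_run => /=.
  - by split; [lia | exact: erefl].
  - exact: leqnn.
  move=> s3 <-.
  apply: run_weaken; first apply: (@run_for W 2 _ I _ M) => //=.
  - by lia.
  - split=> //; exists [::]; rewrite /= !drop0; split=> //.
  - move=> j s' jM [fr fa] ej [v4 I2 I3 [l [sl dw dp]]].
    have jw : j < size wbody by rewrite -size_pairs.
    have w0 : arrs s' 0 (j + 2) = nth 0 wbody j by rewrite fa // sw addn2.
    have ep : nth (0, 0) pairs j = head (0, 0) (drop j pairs).
      by rewrite -nth0 nth_drop addn0.
    have ew : nth 0 wbody j = head 0 (drop j wbody).
      by rewrite -nth0 nth_drop addn0.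
    have dS T (t : seq T) : drop j.+1 t = behead (drop j t).
      by rewrite -drop1 drop_drop add1n.
    have upI (f g : nat -> nat) x : (forall i, i < j -> f i = g i) -> x = g j ->
        forall i, i < j.+1 -> (if i == j then x else f i) = g i.
      by move=> h e i; rewrite ltnS leq_eqVlt; case: eqP => [->|_] //= /h.
    rewrite /I !dS /= /upd /= !ej w0.
    have lM : size l <= M.
      have := congr1 size dw; rewrite size_drop size_cat -size_pairs -/M.
      by move: (size _) (size (flatten _)) => p q; lia.
    split; [by rewrite -sl andbT; lia | by [] |].
    case: l sl dw dp lM => [|x l] /= sl dw dp lM; rewrite -sl /=.
      have vn : regs s' 4 < n.
        rewrite ltnNge; apply/negP => le.
        have e0 : drop (regs s' 4) (enum 'I_n) = [::].
          by rewrite drop_oversize // size_enum_ord.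
        move: dp; rewrite e0 => /(congr1 size).
        by rewrite size_drop /= => /eqP; rewrite subn_eq0 leqNgt jM.
      move: dw dp; rewrite (drop_enum_ord vn) /= => dw dp.
      have sz : size (nb (Ordinal vn)) <= n.
        have [/card_uniqP <- _] := nbP (Ordinal vn).
        by apply: leq_trans (max_card _) _; rewrite card_ord.
      rewrite ew dw dp /=.
      split; [by fits_lia | by fits_lia |].
      split; [by fits_lia | by fits_lia |].
      split; [by fits_lia |]; split; [by fits_lia |].
      rewrite addn1; split=> //; try by apply: upI; rewrite ?ep ?dp.
      exists (map val (nb (Ordinal vn))); rewrite size_map; split=> //=.
      by rewrite -map_comp.
    have lx : x < n.
      have : (((regs s' 4).-1, x) \in pairs).
        by rewrite -[pairs](cat_take_drop j) mem_cat dp mem_head orbT.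
      by case/pairs_bound.
    rewrite ew dw dp /= subn1.
    split; [by fits_lia | by fits_lia |].
    split; [by fits_lia | by fits_lia |].
    split; first by fits_lia.
    split=> //; try by apply: upI; rewrite ?ep ?dp.
    by exists l; rewrite subn1; split.
  - exact: leqnn.
  by move=> s' [].
by rewrite /=; lia.
Qed.

End Input.

(** * Correctness of the emitted encoding *)

Section Output.
Variables (n k : nat) (G : sgraph 'I_n) (nb : 'I_n -> seq 'I_n).
Hypothesis nbP : forall v, uniq (nb v) /\ nb v =i G v.
Variables (X : {set 'I_n}) (keep dg id : nat -> nat).
Hypotheses (keepP : forall v : 'I_n, keep v = (v \in X))
  (dgP : forall v : 'I_n, v \in X -> dg v = size [seq u <- nb v | u \in X])
  (idnP : forall v : 'I_n, id v = count (fun i => 0 < keep i) (iota 0 v)).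

Lemma filter_enum_set : [seq x <- enum 'I_n | x \in X] = enum X.
Proof. by rewrite {1}/enum_mem -filter_predI; apply: eq_filter => x; rewrite /= andbT. Qed.

Lemma map_enum_val : [seq enum_val i | i <- enum 'I_#|X|] = enum X.
Proof.
have sz : size [seq enum_val i | i <- enum 'I_#|X|] = size (enum X).
  by rewrite size_map size_enum_ord -cardE.
case e: (enum X) => [|x0 t].
  by apply: size0nil; rewrite sz e.
rewrite -e; apply: (eq_from_nth (x0 := x0)) => // i.
rewrite size_map size_enum_ord => iX.
by rewrite (nth_map (Ordinal iX)) ?size_enum_ord // (nth_ord_enum _ (Ordinal iX)) (enum_val_nth x0).
Qed.

(** [enum X] lists [X] in increasing order, so the number of kept vertices below a vertex is its
    index there. *)
Lemma id_enum_val (j : 'I_#|X|) : id (enum_val j) = j.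
Proof.
rewrite idnP; set x := enum_val j.
have eX : map val (enum X) = [seq i <- iota 0 n | 0 < keep i].
  rewrite -filter_enum_set -val_enum_ord filter_map; congr map.
  by apply: eq_filter => v /=; rewrite keepP lt0b.
have ex : nth 0 (map val (enum X)) j = val x.
  by rewrite (nth_map x) -?cardE // -enum_val_nth.
have e : iota 0 n = iota 0 x ++ val x :: iota x.+1 (n - x.+1).
  rewrite -[LHS](cat_take_drop x) take_iota drop_iota; congr (_ ++ _).
    by rewrite (minn_idPl (ltnW (ltn_ord x))).
  by rewrite add0n -[n - x]prednK ?subn_gt0 // subnS.
have uq : uniq (map val (enum X)) by rewrite map_inj_uniq ?enum_uniq //; apply: val_inj.
have xX : x \in X := enum_valP j.
apply/eqP; rewrite -(nth_uniq 0 _ _ uq).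
- by rewrite ex eX e filter_cat /= keepP xX /= nth_cat size_filter ltnn subnn.
- by rewrite eX e filter_cat size_cat size_filter /= keepP xX /=; lia.
by rewrite size_map -cardE.
Qed.

Definition rank_in (u : 'I_n) : option 'I_#|X| := [pick i | enum_val i == u].

Lemma rank_inK : ocancel rank_in enum_val.
Proof. by move=> u; rewrite /rank_in; case: pickP => //= i /eqP. Qed.

Lemma rank_in_val (i : 'I_#|X|) : rank_in (enum_val i) = Some i.
Proof.
rewrite /rank_in; case: pickP => [j /eqP/enum_val_inj-> //|/(_ i)].
by rewrite eqxx.
Qed.

Lemma map_rank (s : seq 'I_n) :
  map val (pmap rank_in s) = [seq id (val u) | u <- s & u \in X].
Proof.
elim: s => //= u s IH; have [uX|uX] := boolP (u \in X).
  have [i ->] := enum_val_surj uX.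
  by rewrite rank_in_val /= IH id_enum_val.
rewrite /rank_in; case: pickP => [i /eqP e|_] /=; last exact: IH.
by rewrite -e enum_valP in uX.
Qed.

Lemma flatten_map_flatten (S T : Type) (g : S -> seq T) ss :
  flatten (map g (flatten ss)) = flatten [seq flatten (map g s) | s <- ss].
Proof. by elim: ss => //= s ss IH; rewrite map_cat flatten_cat IH. Qed.

Lemma encodes_out : encodes (induced G X) k
  (#|X| :: k :: flatten [seq out_item keep dg id q | q <- pairs nb]).
Proof.
exists (fun i => pmap rank_in (nb (enum_val i))); split.
  move=> i; split.
    by apply: (pmap_uniq rank_inK); have [] := nbP (enum_val i).
  move=> j; rewrite mem_pmap; apply/mapP/idP => [[u un e]|h].
    rewrite -[_ \in _]/(G (enum_val i) (enum_val j)) -(mem_nb nbP).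
    by have := rank_inK u; rewrite -e /= => ->.
  exists (enum_val j); last by rewrite rank_in_val.
  by rewrite (mem_nb nbP).
congr (_ :: _ :: _).
pose F v := if v \in X then size [seq u <- nb v | u \in X] :: [seq id (val u) | u <- nb v & u \in X] else [::].
have FE v : flatten [seq out_item keep dg id q | q <- eblock nb v] = F v.
  rewrite /F /eblock /= /out_item /= keepP eqxx.
  have [vX|vX] := boolP (v \in X) => /=; last first.
    by elim: (nb v) => //= u s IH; rewrite !keepP (negbTE vX); case: (u \in X).
  rewrite dgP //; congr cons.
  have : v \notin nb v by rewrite (mem_nb nbP) adj_irr.
  elim: (nb v) => //= u s IH; rewrite inE negb_or => /andP[ne /IH ->].
  rewrite !keepP vX; case: (u \in X) => //=.
  by rewrite val_eqE (negbTE ne).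
rewrite /pairs flatten_map_flatten -map_comp (eq_map FE).
rewrite (@flatten_map_filter _ _ (mem X)); last by move=> v /= /negbTE; rewrite /F => ->.
rewrite filter_enum_set -map_enum_val -map_comp; congr flatten; apply: eq_map => i /=.
rewrite /F enum_valP map_rank; congr cons.
by rewrite -(size_map val (pmap _ _)) map_rank size_map.
Qed.

End Output.

Lemma count_nth (T : Type) (x0 : T) (P : pred T) s :
  count (fun j => P (nth x0 s j)) (iota 0 (size s)) = count P s.
Proof. by rewrite -[in RHS](mkseq_nth x0 s) /mkseq count_map. Qed.

(** * Products by repeated addition, and ranks by prefix sums *)

Section Arithmetic.
Variable W : nat.

Definition mul_loop x y e :=
  Seq (Asg y (Cst 0)) (For x (Asg y (Plus (Reg y) e))).

Lemma run_mul_loop x y e s N v :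
  regs s x = N -> N < W -> x != 3 -> x != y -> y != 3 ->
  (forall s', frame [:: 3; y] [::] s s' -> fits W s' e /\ eval s' e = v) ->
  N * v < W ->
  run W (mul_loop x y e) s ((ecost e + 20) * N.+1) (fun s' => regs s' y = N * v).
Proof.
move=> xN NW x3 xy y3 he vW.
apply: run_le; first apply: run_seq.
  apply: run_weaken; first apply: wp_run => /=.
  - by split; [lia | exact: erefl].
  - exact: leqnn.
  move=> s1 <-.
  apply: (@run_for W x _ (fun j s' => regs s' y = j * v) _ N) => //=.
  - by rewrite upd_other.
  - by rewrite inE.
  - by rewrite inE eq_sym.
  - by rewrite upd_other // upd_same.
  move=> j s' jN [fr fa] ej ey.
  have [fe ee] : fits W s' e /\ eval s' e = v.
    apply: he; split=> // r rn; rewrite fr //= upd_other //.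
    by move: rn; rewrite !inE negb_or => /andP[].
  rewrite ee ey fe upd_other // upd_same; split; last by rewrite mulSn addnC.
  by have : j.+1 * v <= N * v by [rewrite leq_mul2r jN orbT]; rewrite mulSn; fits_lia.
by rewrite /=; lia.
Qed.

Definition rank_loop :=
  Seq (Asg 8 (Cst 0)) (For 0 (Seq (Put 27 (Reg 3) (Reg 8))
    (Asg 8 (Plus (Reg 8) (Get 26 (Reg 3)))))).

Lemma run_rank_loop s n : regs s 0 = n -> n.+1 < W ->
  (forall i, i < n -> arrs s 26 i <= 1) ->
  run W rank_loop s (30 * n.+1) (fun s' =>
    regs s' 8 = count (fun i => 0 < arrs s 26 i) (iota 0 n) /\
    forall i, i < n -> arrs s' 27 i = count (fun i => 0 < arrs s 26 i) (iota 0 i)).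
Proof.
move=> s0 nW le1; pose c j := count (fun i => 0 < arrs s 26 i) (iota 0 j).
have cS j : j < n -> c j.+1 = c j + arrs s 26 j.
  move=> jn; rewrite /c iotaSr -cats1 count_cat /= addn0; congr (_ + _).
  by have := le1 j jn; case: (arrs s 26 j) => [|[|]].
have cle j : c j <= j by apply: leq_trans (count_size _ _) _; rewrite size_iota.
apply: run_le; first apply: run_seq.
  apply: run_weaken; first apply: wp_run => /=.
  - by split; [lia | exact: erefl].
  - exact: leqnn.
  move=> s1 <-.
  apply: (@run_for W 0 _ (fun j s' => regs s' 8 = c j /\
     forall i, i < j -> arrs s' 27 i = c i) _ n) => //=.
  - by lia.
  move=> j s' jn [fr fa] ej [e8 e27].
  have e26 : arrs s' 26 = arrs s 26 by rewrite fa.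
  rewrite (@upd_other _ _ 3 _ 8 isT) !upd_same ej e8 (@upd_other _ _ 27 _ 26 isT) e26.
  have := cle j; have := le1 j jn => h1 h2.
  split; [by fits_lia | by fits_lia |]; split; first by fits_lia.
  split; first by rewrite cS.
  move=> i; rewrite ltnS leq_eqVlt /upd.
  by case: eqP => [->|_] //= ij; apply: e27.
by rewrite /=; lia.
Qed.

End Arithmetic.

(** * Neighbourhoods and degrees read off the pair list *)

Section PairCounts.
Variables (n : nat) (G : sgraph 'I_n) (nb : 'I_n -> seq 'I_n).
Hypothesis nbP : forall v, uniq (nb v) /\ nb v =i G v.

Lemma count_pairs_at (v : 'I_n) (P : pred (nat * nat)) :
  count (fun q => P q && (q.1 == val v)) (pairs nb) = count P (eblock nb v).
Proof. by rewrite -filter_pairs count_filter. Qed.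

Lemma count_degree (v : 'I_n) (X : {set 'I_n}) (P : pred (nat * nat)) :
  (forall u : 'I_n, P (val v, val u) = (u != v) && (u \in X)) ->
  count (fun q => P q && (q.1 == val v)) (pairs nb) = size [seq u <- nb v | u \in X].
Proof.
move=> hP; rewrite count_pairs_at /= hP eqxx /= count_map size_filter.
apply: eq_in_count => u unb /=; rewrite hP; case: eqP => // e.
by move: unb; rewrite (mem_nb nbP) e adj_irr.
Qed.

Lemma size_nb (v : 'I_n) : size (nb v) = #|[set u | G v u]|.
Proof.
have [/card_uniqP <- _] := nbP v; apply: eq_card => u.
by rewrite inE (mem_nb nbP).
Qed.

(** Leaving out the diagonal pairs makes the refinement compare open neighbourhoods; with them, as
    in [same_closed], it compares closed ones. *)
Lemma same_open (gd : pred (nat * nat)) (u x : 'I_n) :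
  (forall q, gd q = (q.1 != q.2)) ->
  same [seq q <- pairs nb | gd q] u x <-> [forall y, G u y == G x y].
Proof.
move=> hg; have mem (v a : 'I_n) : ((val v, val a) \in [seq q <- pairs nb | gd q]) = G v a.
  rewrite mem_filter hg (mem_pairs nbP) /= val_eqE eq_sym.
  by case: eqP => [->|_] //=; rewrite adj_irr.
split=> [h|/forallP h v].
  by apply/forallP => y; have := h y; rewrite !mem adj_sym (adj_sym G y x) => ->.
have [vn|vn] := ltnP v n.
  have := h (Ordinal vn); rewrite adj_sym (adj_sym G x) -!mem => /eqP //.
apply/idP/idP; rewrite mem_filter => /andP[_ /pairs_bound[/=]]; lia.
Qed.

Lemma same_closed (gd : pred (nat * nat)) (u x : 'I_n) :
  (forall q, gd q) ->
  same [seq q <- pairs nb | gd q] u x <->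
    [forall y, ((y == u) || G u y) == ((y == x) || G x y)].
Proof.
move=> hg; have mem (v a : 'I_n) :
    ((val v, val a) \in [seq q <- pairs nb | gd q]) = (v == a) || G a v.
  by rewrite mem_filter hg (mem_pairs nbP) /= eq_sym adj_sym.
split=> [h|/forallP h v].
  by apply/forallP => y; have := h y; rewrite !mem => ->.
have [vn|vn] := ltnP v n.
  by have := h (Ordinal vn); rewrite -!mem => /eqP.
apply/idP/idP; rewrite mem_filter => /andP[_ /pairs_bound[/=]]; lia.
Qed.

End PairCounts.

(** * The program *)

(* Arrays: 2, 3 the pairs (v, u) with u in N[v]; 4 and 7 the classes of vertices
   with equal open and closed neighbourhoods (5, 6, 8, 9 auxiliary); 10 sizes of
   the classes of 4; 11 degrees; 13, 14 the vertices r1, r2; 15 and 19 number of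
   vertices and of classes for a given r2; 18 one vertex per class of 4; 20, 21
   violations for a given r2; 22, 24, 26 successively kept vertices (17, 23, 25
   counters); 27, 28 new names and new degrees. *)
Definition at_root a := Get a (Get 14 (Reg 3)).

(* As [nz e] evaluates to [0 < e], this is 1 iff the degree is positive and
   either a violation was counted or there are more than [l] classes and fewer
   classes than vertices; otherwise it is 0. *)
Definition keep_expr l :=
  Minus (Plus (nz (Get 11 (Reg 3)))
    (nz (Plus (Plus (at_root 20) (at_root 21))
      (Minus (Plus (nz (Minus (at_root 19) (Cst l)))
                   (nz (Minus (at_root 15) (at_root 19)))) (Cst 1))))) (Cst 1).

Definition classify l :=
  Seq (Asg 0 (Get 0 (Cst 0))) (
  Seq (Asg 1 (Get 0 (Cst 1))) (
  Seq scan_degrees (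
  Seq scan_pairs (
  Seq (refine 4 5 6 (Cst 1) (absd src dst)) (
  Seq (refine 7 8 9 (Cst 0) (Cst 0)) (
  Seq (histogram 0 10 (Get 4 (Reg 3)) (Cst 0) (Cst 0)) (
  Seq (histogram 2 11 src (Cst 1) (absd src dst)) (
  Seq (fill 0 12 (Reg 3)) (
  Seq (min_pass 12 13) (
  Seq (min_pass 13 14) (
  Seq (histogram 0 15 (Get 14 (Reg 3)) (Cst 0) (Cst 0)) (
  Seq (fill 0 16 (Cst 1)) (
  Seq (truncate 16 18 4 17 (Cst 1)) (
  Seq (histogram 0 19 (Get 14 (Reg 3)) (Cst 1) (Get 18 (Reg 3))) (
  Seq (histogram 2 20 (Get 14 src) (Cst 1) (absd (Get 14 src) (Get 14 dst))) (
  Seq (histogram 0 21 (Get 14 (Reg 3)) (Cst 1)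
         (absd (Plus (Get 11 (Reg 3)) (Get 10 (Get 4 (Reg 3)))) (at_root 15))) (
  Seq (fill 0 22 (keep_expr l)) (
  Seq (truncate 22 24 4 23 (Plus (Plus (Reg 1) (Reg 1)) (Cst 2)))
      (truncate 24 26 7 25 (Plus (Plus (Reg 1) (Reg 1)) (Cst l.+1)))
  )))))))))))))))))).

(** Moves known facts to the store after a phase; that the phase does not write the cell in question
    is decided by computation through [isT]. [pull] does the same in the goal. *)
Ltac transport fr s :=
  repeat match goal with
  | H : context [arrs s ?a] |- _ => rewrite -(proj2 fr a isT) in H
  | H : context [regs s ?r] |- _ => rewrite -(proj1 fr r isT) in H
  end.

Ltac pull fr s :=
  repeat match goal with
  | |- context [arrs s ?a] => rewrite (proj2 fr a isT)
  | |- context [regs s ?r] => rewrite (proj1 fr r isT)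
  end.

(** * Execution of the classification phases *)

Section Classify.
Variables (n k l : nat) (G : sgraph 'I_n) (nb : 'I_n -> seq 'I_n).
Hypothesis nbP : forall v, uniq (nb v) /\ nb v =i G v.
Let E := pairs nb.
Let M := size E.
Let e_ i := nth (0, 0) E i.

Definition trunc_post s ka kb cl th :=
  let kept c := count (fun i => (0 < arrs s kb i) && (arrs s cl i == c)) (iota 0 n) in
  [/\ forall i, arrs s kb i <= (0 < arrs s ka i) && (i < n),
      forall c, kept c <= th &
      forall i, i < n -> 0 < arrs s ka i -> arrs s kb i = 0 -> th <= kept (arrs s cl i)].

Definition min_post s a b := forall v, v < n ->
  (forall u, ((u == v) || ((v, u) \in E)) -> arrs s b v <= arrs s a u) /\
  (exists2 u, (u == v) || ((v, u) \in E) & arrs s b v = arrs s a u).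

Definition gt0 (x : nat) : nat := 1 - (1 - x).

Definition keep_val s i :=
  let r := arrs s 14 i in
  gt0 (arrs s 11 i) + gt0 (arrs s 20 r + arrs s 21 r +
    (gt0 (arrs s 19 r - l) + gt0 (arrs s 15 r - arrs s 19 r) - 1)) - 1.

Record classified s : Prop := Classified {
  cl_n : regs s 0 = n;
  cl_k : regs s 1 = k;
  cl_M : regs s 2 = M;
  cl_src : forall i, i < M -> arrs s 2 i = (e_ i).1;
  cl_dst : forall i, i < M -> arrs s 3 i = (e_ i).2;
  cl_cls : forall u x, u < n -> x < n ->
    (arrs s 4 u = arrs s 4 x <-> same [seq q <- E | q.1 != q.2] u x);
  cl_tcls : forall u x, u < n -> x < n ->
    (arrs s 7 u = arrs s 7 x <-> same [seq q <- E | true] u x);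
  cl_size : forall i, arrs s 10 i = count (fun j => true && (arrs s 4 j == i)) (iota 0 n);
  cl_deg : forall i, arrs s 11 i =
    count (fun j => ((e_ j).1 != (e_ j).2) && ((e_ j).1 == i)) (iota 0 M);
  cl_id : forall i, i < n -> arrs s 12 i = i;
  cl_r1 : min_post s 12 13;
  cl_r2 : min_post s 13 14;
  cl_cnt : forall i, arrs s 15 i = count (fun j => true && (arrs s 14 j == i)) (iota 0 n);
  cl_one : forall i, i < n -> arrs s 16 i = 1;
  cl_first : trunc_post s 16 18 4 1;
  cl_parts : forall i, arrs s 19 i =
    count (fun j => (0 < arrs s 18 j) && (arrs s 14 j == i)) (iota 0 n);
  cl_bade : forall i, arrs s 20 i = count (fun j =>
    (arrs s 14 (e_ j).1 != arrs s 14 (e_ j).2) && (arrs s 14 (e_ j).1 == i)) (iota 0 M);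
  cl_badv : forall i, arrs s 21 i = count (fun j =>
    (arrs s 11 j + arrs s 10 (arrs s 4 j) != arrs s 15 (arrs s 14 j)) &&
    (arrs s 14 j == i)) (iota 0 n);
  cl_keep0 : forall i, i < n -> arrs s 22 i = keep_val s i;
  cl_keep1 : trunc_post s 22 24 4 (2 * k + 2);
  cl_keep2 : trunc_post s 24 26 7 (2 * k + l.+1);
  cl_zero : forall a i, 27 <= a -> arrs s a i = 0 }.

Variable W : nat.
Hypothesis hW : 2 * n + 2 * M + 2 * k + l + 20 < W.
Let w := n :: k :: wbody nb.

Lemma e_lt i : i < M -> (e_ i).1 < n /\ (e_ i).2 < n.
Proof. by move=> iM; apply: (pairs_bound (nb := nb)); apply: mem_nth. Qed.

Lemma count_le (P : pred nat) N : count P (iota 0 N) <= N.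
Proof. by apply: leq_trans (count_size _ _) _; rewrite size_iota. Qed.

Lemma run_classify :
  run W (classify l) (input_state w) (2000 * (n + M + 1)) classified.
Proof.
have elt := pairs_bound (nb := nb).
have euq := pairs_uniq nbP.
have eso := pairs_sorted nb.
apply: run_le; first apply: run_seq.
apply: run_weaken; first apply: run_frame; first apply: (wp_run (Q := fun s => regs s 0 = n)) => /=.
- by split=> //; lia.
- exact: leqnn.
move=> s1 [e0 fr].
(* Counters and stamps must start at 0. This fact is carried through all phases, its lower index
   rising past the arrays already used. *)
have hz : forall a i, 2 <= a -> arrs s1 a i = 0.
  by move=> [|[|a]] i // _; rewrite (proj2 fr).
have hw : forall i, arrs s1 0 i = nth 0 w i by move=> i; rewrite (proj2 fr).
move: {fr}s1 e0 hz hw => s e0 hz hw.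
apply: run_seq; apply: run_weaken; first apply: run_frame;
  first apply: (wp_run (Q := fun s => regs s 1 = k)) => /=.
- by rewrite hw /= ; split=> //; lia.
- exact: leqnn.
move=> s1 [e1 fr]; transport fr s.
have {}hz : forall a i, 2 <= a -> arrs s1 a i = 0.
  by move=> a i h; rewrite (proj2 fr) // hz.
move: {s}s1 {fr} e0 e1 hz hw => s e0 e1 hz hw.
apply: run_seq; apply: run_weaken; first apply: run_frame;
  first apply: (@run_scan_degrees n k nb W _ _ s) => //.
- by lia.
- by rewrite -/E -/M; lia.
- exact: leqnn.
rewrite -/E -/M; move=> s1 [eM fr]; transport fr s.
have {}hz : forall a i, 2 <= a -> arrs s1 a i = 0.
  by move=> a i h; rewrite (proj2 fr) // hz.
move: {s}s1 {fr} e0 e1 eM hz hw => s e0 e1 eM hz hw.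
apply: run_seq; apply: run_weaken; first apply: run_frame;
  first apply: (@run_scan_pairs n k G nb nbP W _ _ s) => //.
- by lia.
- by rewrite -/E -/M; lia.
- exact: leqnn.
rewrite -/E -/M; move=> s1 [[hS hD] fr]; transport fr s.
have {}hz : forall a i, 4 <= a -> arrs s1 a i = 0.
  move=> a i h; rewrite (proj2 fr) ?hz //; first by lia.
  by rewrite /= !inE; lia.
move: {s}s1 {fr hw} e0 e1 eM hz hS hD => s e0 e1 eM hz hS hD.
apply: run_seq; apply: run_weaken; first apply: run_frame;
  first apply: (@run_refine W n E elt euq eso _ _ 4 5 6 _ _ (fun q => q.1 != q.2) s) => //.
- by lia.
- by rewrite -/M; lia.
- by move=> i; rewrite !hz.
- move=> j s' jM fr ej; rewrite /= ej; pull fr s'; rewrite hS // hD // -/(e_ j).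
  have [lt1 lt2] := e_lt jM; split; [by lia | | by lia].
  by move: (e_ j).1 (e_ j).2 lt1 lt2 => x y lt1 lt2; fits_lia.
- exact: leqnn.
move=> s1 [[h4 b4] fr]; transport fr s.
have {}hz : forall a i, 7 <= a -> arrs s1 a i = 0.
  move=> a i h; rewrite (proj2 fr) ?hz //; first by lia.
  by rewrite /= !inE; lia.
move: {s}s1 {fr} e0 e1 eM hz hS hD h4 b4 => s e0 e1 eM hz hS hD h4 b4.
apply: run_seq; apply: run_weaken; first apply: run_frame;
  first apply: (@run_refine W n E elt euq eso _ _ 7 8 9 _ _ (fun q => true) s) => //.
- by lia.
- by rewrite -/M; lia.
- by move=> i; rewrite !hz.
- exact: leqnn.
move=> s1 [[h7 b7] fr]; transport fr s.
have {}hz : forall a i, 10 <= a -> arrs s1 a i = 0.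
  move=> a i h; rewrite (proj2 fr) ?hz //; first by lia.
  by rewrite /= !inE; lia.
move: {s}s1 {fr} e0 e1 eM hz hS hD h4 b4 h7 b7 => s e0 e1 eM hz hS hD h4 b4 h7 b7.
rewrite -/M in b4 b7.
apply: run_seq; apply: run_weaken; first apply: run_frame;
  first apply: (@run_histogram W 0 10 _ _ _ s n (arrs s 4) (fun=> true)) => //.
- by lia.
- by move=> i; rewrite hz.
- move=> j s' jM fr ej; rewrite /= ej; pull fr s'; split=> //.
  by have := b4 j; fits_lia.
- exact: leqnn.
move=> s1 [h10 fr]; transport fr s.
have {}hz : forall a i, 11 <= a -> arrs s1 a i = 0.
  move=> a i h; rewrite (proj2 fr) ?hz //; first by lia.
  by rewrite /= !inE; lia.
move: {s}s1 {fr} e0 e1 eM hz hS hD h4 b4 h7 b7 h10 => s e0 e1 eM hz hS hD h4 b4 h7 b7 h10.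
apply: run_seq; apply: run_weaken; first apply: run_frame;
  first apply: (@run_histogram W 2 11 _ _ _ s M (fun j => (e_ j).1) (fun j => (e_ j).1 != (e_ j).2)) => //.
- by lia.
- by move=> i; rewrite hz.
- move=> j s' jM fr ej; rewrite /= ej; pull fr s'; rewrite hS // hD //.
  have [lt1 lt2] := e_lt jM; move: (e_ j).1 (e_ j).2 lt1 lt2 => x y lt1 lt2.
  by split; [by fits_lia | by lia | by fits_lia | by [] | by lia].
- exact: leqnn.
move=> s1 [h11 fr]; transport fr s.
have {}hz : forall a i, 12 <= a -> arrs s1 a i = 0.
  move=> a i h; rewrite (proj2 fr) ?hz //; first by lia.
  by rewrite /= !inE; lia.
move: {s}s1 {fr} e0 e1 eM hz hS hD h4 b4 h7 b7 h10 h11 => s e0 e1 eM hz hS hD h4 b4 h7 b7 h10 h11.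
apply: run_seq; apply: run_weaken; first apply: run_frame;
  first apply: (@run_fill W 0 12 _ s n (fun j => j)) => //.
- by lia.
- by move=> j s' jM fr ej; rewrite /= ej; split=> //; lia.
- exact: leqnn.
move=> s1 [h12 fr]; transport fr s.
have {}hz : forall a i, 13 <= a -> arrs s1 a i = 0.
  move=> a i h; rewrite (proj2 fr) ?hz //; first by lia.
  by rewrite /= !inE; lia.
move: {s}s1 {fr} e0 e1 eM hz hS hD h4 b4 h7 b7 h10 h11 h12
  => s e0 e1 eM hz hS hD h4 b4 h7 b7 h10 h11 h12.
apply: run_seq; apply: run_weaken; first apply: run_frame;
  first apply: (@run_min_pass W n E elt euq eso _ _ 12 13 s) => //.
- by lia.
- by rewrite -/M; lia.
- by move=> i lt; rewrite h12 //; lia.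
- exact: leqnn.
move=> s1 [h13 fr]; transport fr s.
have {}hz : forall a i, 14 <= a -> arrs s1 a i = 0.
  move=> a i h; rewrite (proj2 fr) ?hz //; first by lia.
  by rewrite /= !inE; lia.
have b13 : forall i, i < n -> arrs s1 13 i < n.
  move=> i lt; have [_ [u ui ->]] := h13 i lt.
  have un : u < n by case/orP: ui => [/eqP->|/elt[]].
  by rewrite h12.
move: {s}s1 {fr} e0 e1 eM hz hS hD h4 b4 h7 b7 h10 h11 h12 h13 b13
  => s e0 e1 eM hz hS hD h4 b4 h7 b7 h10 h11 h12 h13 b13.
apply: run_seq; apply: run_weaken; first apply: run_frame;
  first apply: (@run_min_pass W n E elt euq eso _ _ 13 14 s) => //.
- by lia.
- by rewrite -/M; lia.
- by move=> i lt; have := b13 i lt; lia.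
- exact: leqnn.
move=> s1 [h14 fr]; transport fr s.
have {}hz : forall a i, 15 <= a -> arrs s1 a i = 0.
  move=> a i h; rewrite (proj2 fr) ?hz //; first by lia.
  by rewrite /= !inE; lia.
have b14 : forall i, i < n -> arrs s1 14 i < n.
  move=> i lt; have [_ [u ui ->]] := h14 i lt.
  have un : u < n by case/orP: ui => [/eqP->|/elt[]].
  exact: b13.
move: {s}s1 {fr} e0 e1 eM hz hS hD h4 b4 h7 b7 h10 h11 h12 h13 b13 h14 b14
  => s e0 e1 eM hz hS hD h4 b4 h7 b7 h10 h11 h12 h13 b13 h14 b14.
apply: run_seq; apply: run_weaken; first apply: run_frame;
  first apply: (@run_histogram W 0 15 _ _ _ s n (arrs s 14) (fun=> true)) => //.
- by lia.
- by move=> i; rewrite hz.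
- move=> j s' jM fr ej; rewrite /= ej; pull fr s'; split=> //.
  by have := b14 j jM; fits_lia.
- exact: leqnn.
move=> s1 [h15 fr]; transport fr s.
have {}hz : forall a i, 16 <= a -> arrs s1 a i = 0.
  move=> a i h; rewrite (proj2 fr) ?hz //; first by lia.
  by rewrite /= !inE; lia.
move: {s}s1 {fr} e0 e1 eM hz hS hD h4 b4 h7 b7 h10 h11 h12 h13 b13 h14 b14 h15
  => s e0 e1 eM hz hS hD h4 b4 h7 b7 h10 h11 h12 h13 b13 h14 b14 h15.
apply: run_seq; apply: run_weaken; first apply: run_frame;
  first apply: (@run_fill W 0 16 _ s n (fun=> 1)) => //.
- by lia.
- by move=> j s' jM fr ej; split=> //=; lia.
- exact: leqnn.
move=> s1 [h16 fr]; transport fr s.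
have {}hz : forall a i, 17 <= a -> arrs s1 a i = 0.
  move=> a i h; rewrite (proj2 fr) ?hz //; first by lia.
  by rewrite /= !inE; lia.
move: {s}s1 {fr} e0 e1 eM hz hS hD h4 b4 h7 b7 h10 h11 h12 h13 b13 h14 b14 h15 h16
  => s e0 e1 eM hz hS hD h4 b4 h7 b7 h10 h11 h12 h13 b13 h14 b14 h15 h16.
apply: run_seq; apply: run_weaken; first apply: run_frame;
  first apply: (@run_truncate W 16 18 4 17 _ s n 1) => //.
- by lia.
- by move=> i; rewrite hz.
- by move=> i; rewrite hz.
- by move=> i lt; rewrite h16 //; have := b4 i; lia.
- by move=> s' _; split=> //=; lia.
- exact: leqnn.
move=> s1 [h18 fr]; transport fr s.
have {}hz : forall a i, 19 <= a -> arrs s1 a i = 0.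
  move=> a i h; rewrite (proj2 fr) ?hz //; first by lia.
  by rewrite /= !inE; lia.
move: {s}s1 {fr} e0 e1 eM hz hS hD h4 b4 h7 b7 h10 h11 h12 h13 b13 h14 b14 h15 h16 h18
  => s e0 e1 eM hz hS hD h4 b4 h7 b7 h10 h11 h12 h13 b13 h14 b14 h15 h16 h18.
apply: run_seq; apply: run_weaken; first apply: run_frame;
  first apply: (@run_histogram W 0 19 _ _ _ s n (arrs s 14) (fun j => 0 < arrs s 18 j)) => //.
- by lia.
- by move=> i; rewrite hz.
- move=> j s' jM fr ej; rewrite /= ej; pull fr s'; have := b14 j jM => b.
  have [/(_ j) b18 _ _] := h18; have {}b18 : arrs s 18 j <= 1.
    by apply: leq_trans b18 _; case: (_ && _).
  by split=> //; fits_lia.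
- exact: leqnn.
move=> s1 [h19 fr]; transport fr s.
have {}hz : forall a i, 20 <= a -> arrs s1 a i = 0.
  move=> a i h; rewrite (proj2 fr) ?hz //; first by lia.
  by rewrite /= !inE; lia.
move: {s}s1 {fr} e0 e1 eM hz hS hD h4 b4 h7 b7 h10 h11 h12 h13 b13 h14 b14 h15 h16 h18 h19
  => s e0 e1 eM hz hS hD h4 b4 h7 b7 h10 h11 h12 h13 b13 h14 b14 h15 h16 h18 h19.
apply: run_seq; apply: run_weaken; first apply: run_frame;
  first apply: (@run_histogram W 2 20 _ _ _ s M (fun j => arrs s 14 (e_ j).1)
    (fun j => arrs s 14 (e_ j).1 != arrs s 14 (e_ j).2)) => //.
- by lia.
- by move=> i; rewrite hz.
- move=> j s' jM fr ej; rewrite /= ej; pull fr s'; rewrite hS // hD //.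
  have [lt1 lt2] := e_lt jM; have := b14 _ lt1; have := b14 _ lt2.
  move: (e_ j).1 (e_ j).2 lt1 lt2 => x y lt1 lt2 lt3 lt4.
  by split; [by fits_lia | by lia | by fits_lia | by [] | by lia].
- exact: leqnn.
move=> s1 [h20 fr]; transport fr s.
have {}hz : forall a i, 21 <= a -> arrs s1 a i = 0.
  move=> a i h; rewrite (proj2 fr) ?hz //; first by lia.
  by rewrite /= !inE; lia.
move: {s}s1 {fr} e0 e1 eM hz hS hD h4 b4 h7 b7 h10 h11 h12 h13 b13 h14 b14 h15 h16 h18 h19 h20
  => s e0 e1 eM hz hS hD h4 b4 h7 b7 h10 h11 h12 h13 b13 h14 b14 h15 h16 h18 h19 h20.
apply: run_seq; apply: run_weaken; first apply: run_frame;
  first apply: (@run_histogram W 0 21 _ _ _ s n (arrs s 14) (fun j =>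
    arrs s 11 j + arrs s 10 (arrs s 4 j) != arrs s 15 (arrs s 14 j))) => //.
- by lia.
- by move=> i; rewrite hz.
- move=> j s' jM fr ej; rewrite /= ej; pull fr s'.
  have := b14 _ jM; have := b4 j; have := h11 j; have := h10 (arrs s 4 j).
  have := h15 (arrs s 14 j); move: (arrs s 15 _) (arrs s 10 _) (arrs s 11 _).
  move=> x y z hx hy hz' bz b.
  have {hx} : x <= n by rewrite hx count_le.
  have {hy} : y <= n by rewrite hy count_le.
  have {hz'} : z <= M by rewrite hz' count_le.
  move: (arrs s 4 j) (arrs s 14 j) bz b => a b bz bb lx ly lz.
  by split; [by fits_lia | by lia | by fits_lia | by [] | by lia].
- exact: leqnn.
move=> s1 [h21 fr]; transport fr s.
have {}hz : forall a i, 22 <= a -> arrs s1 a i = 0.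
  move=> a i h; rewrite (proj2 fr) ?hz //; first by lia.
  by rewrite /= !inE; lia.
move: {s}s1 {fr} e0 e1 eM hz hS hD h4 b4 h7 b7 h10 h11 h12 h13 b13 h14 b14 h15 h16 h18 h19 h20 h21
  => s e0 e1 eM hz hS hD h4 b4 h7 b7 h10 h11 h12 h13 b13 h14 b14 h15 h16 h18 h19 h20 h21.
apply: run_seq; apply: run_weaken; first apply: run_frame;
  first apply: (@run_fill W 0 22 _ s n (keep_val s)) => //.
- by lia.
- move=> j s' jM fr ej; rewrite /= ej; pull fr s'; rewrite /keep_val /gt0 /=; split=> //.
  have := b14 _ jM; have := h11 j; have := h15 (arrs s 14 j).
  have := h19 (arrs s 14 j); have := h20 (arrs s 14 j); have := h21 (arrs s 14 j).
  move: (arrs s 15 _) (arrs s 19 _) (arrs s 20 _) (arrs s 21 _) (arrs s 11 _).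
  move=> x1 x2 x3 x4 x5 y4 y3 y2 y1 y5 b.
  have {}y1 : x1 <= n by rewrite y1 count_le.
  have {}y2 : x2 <= n by rewrite y2 count_le.
  have {}y3 : x3 <= M by rewrite y3 count_le.
  have {}y4 : x4 <= n by rewrite y4 count_le.
  have {}y5 : x5 <= M by rewrite y5 count_le.
  by move: (arrs s 14 j) b => b bb; fits_lia.
- exact: leqnn.
move=> s1 [h22 fr]; transport fr s.
have {}hz : forall a i, 23 <= a -> arrs s1 a i = 0.
  move=> a i h; rewrite (proj2 fr) ?hz //; first by lia.
  by rewrite /= !inE; lia.
rewrite /keep_val in h22; transport fr s.
move: {s}s1 {fr} e0 e1 eM hz hS hD h4 b4 h7 b7 h10 h11 h12 h13 b13 h14 b14 h15 h16 h18 h19 h20 h21 h22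
  => s e0 e1 eM hz hS hD h4 b4 h7 b7 h10 h11 h12 h13 b13 h14 b14 h15 h16 h18 h19 h20 h21 h22.
apply: run_seq; apply: run_weaken; first apply: run_frame;
  first apply: (@run_truncate W 22 24 4 23 _ s n (2 * k + 2)) => //.
- by lia.
- by move=> i; rewrite hz.
- by move=> i; rewrite hz.
- by move=> i lt; rewrite h22 // /gt0; have := b4 i; lia.
- move=> s' fr; rewrite /= ; pull fr s'; rewrite e1; split; last by lia.
  by fits_lia.
- exact: leqnn.
move=> s1 [h24 fr]; transport fr s.
have {}hz : forall a i, 25 <= a -> arrs s1 a i = 0.
  move=> a i h; rewrite (proj2 fr) ?hz //; first by lia.
  by rewrite /= !inE; lia.
move: {s}s1 {fr} e0 e1 eM hz hS hD h4 b4 h7 b7 h10 h11 h12 h13 b13 h14 b14 h15 h16 h18 h19 h20 h21 h22 h24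
  => s e0 e1 eM hz hS hD h4 b4 h7 b7 h10 h11 h12 h13 b13 h14 b14 h15 h16 h18 h19 h20 h21 h22 h24.
apply: run_weaken; first apply: run_frame;
  first apply: (@run_truncate W 24 26 7 25 _ s n (2 * k + l.+1)) => //.
- by lia.
- by move=> i; rewrite hz.
- by move=> i; rewrite hz.
- move=> i lt; have [/(_ i) b24 _ _] := h24; have := b7 i; split; last by lia.
  by apply: leq_trans b24 _; case: (_ && _) => //=; lia.
- move=> s' fr; rewrite /= ; pull fr s'; rewrite e1; split; last by lia.
  by fits_lia.
- exact: leqnn.
move=> s1 [h26 fr]; transport fr s.
have {}hz : forall a i, 27 <= a -> arrs s1 a i = 0.
  move=> a i h; rewrite (proj2 fr) ?hz //; first by lia.
  by rewrite /= !inE; lia.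
by split.
by rewrite /= -/E -/M; move: (M) => M0; clear; lia.
Qed.

End Classify.

(** * From array contents to the graph-theoretic kernel *)

Section Kernel.
Variables (n k l : nat) (G : sgraph 'I_n) (nb : 'I_n -> seq 'I_n) (s : state).
Hypothesis nbP : forall v, uniq (nb v) /\ nb v =i G v.
Hypothesis cl : classified k l nb s.

Let r1 (v : 'I_n) := arrs s 13 v.
Let r2 (v : 'I_n) := arrs s 14 v.
Let cls (v : 'I_n) := arrs s 4 v.
Let tcls (v : 'I_n) := arrs s 7 v.
Let kept a := [set v : 'I_n | 0 < arrs s a v].

Lemma card_kept a c z :
  #|[set u in kept a | arrs s c u == z]| =
  count (fun i => (0 < arrs s a i) && (arrs s c i == z)) (iota 0 n).
Proof. by rewrite -card_ord_count; apply: eq_card => u; rewrite !inE. Qed.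

Lemma min_post_ord a b (v : 'I_n) : min_post nb s a b ->
  (forall u : 'I_n, (u == v) || G v u -> arrs s b v <= arrs s a u) /\
  exists2 u : 'I_n, (u == v) || G v u & arrs s b v = arrs s a u.
Proof.
case/(_ v (ltn_ord v)) => h1 [u h2 e].
split=> [x vx|]; first by apply: h1; rewrite (mem_pairs nbP) vx orbT.
have un : u < n by case/orP: h2 => [/eqP->|/pairs_bound[]].
exists (Ordinal un) => //; case/orP: h2 => [/eqP e'|].
  by apply/orP; left; apply/eqP/val_inj.
by rewrite -[u]/(val (Ordinal un)) (mem_pairs nbP).
Qed.

(** Array 18 comes from truncating the classes to one vertex, so two kept vertices with the same
    label would exceed the threshold 1. *)
Lemma arr_first_inj : {in kept 18 &, injective cls}.
Proof.
have [_ le1 _] := cl_first cl.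
move=> u v; rewrite !inE => u0 v0 e; apply/eqP/negPn/negP => ne.
have := le1 (cls v); rewrite -card_kept leqNgt => /negP; apply.
apply: (@leq_trans #|[set u; v]|); first by rewrite cards2 ne.
apply/subset_leq_card/subsetP => x; rewrite !inE => /orP[]/eqP->.
  by rewrite u0 -e eqxx.
by rewrite v0 eqxx.
Qed.

Lemma arr_first_ex v : exists2 u, u \in kept 18 & cls u = cls v.
Proof.
have [_ _ ge1] := cl_first cl.
have [v0|] := posnP (arrs s 18 v); last by exists v; rewrite ?inE.
have := ge1 v (ltn_ord v); rewrite (cl_one cl) // -card_kept => /(_ isT v0).
by case/card_gt0P => u; rewrite !inE => /andP[u0 /eqP e]; exists u; rewrite ?inE.
Qed.

Lemma arr_degree (v : 'I_n) : arrs s 11 v = #|[set u | G v u]|.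
Proof.
rewrite (cl_deg cl) (count_nth (0, 0) (fun q => (q.1 != q.2) && (q.1 == val v))).
rewrite (count_degree nbP (X := setT)); last first.
  by move=> u; rewrite /= val_eqE eq_sym inE andbT.
rewrite -(size_nb nbP); congr size; apply/all_filterP/allP => u _.
by rewrite inE.
Qed.

Lemma arr_size (v : 'I_n) : arrs s 10 (cls v) = #|[set u | cls u == cls v]|.
Proof. by rewrite (cl_size cl) -card_ord_count; apply: eq_card => u; rewrite !inE. Qed.

Lemma arr_cnt r : arrs s 15 r = #|cc r2 r|.
Proof. by rewrite (cl_cnt cl) -card_ord_count; apply: eq_card => u; rewrite !inE. Qed.

Lemma arr_parts r : arrs s 19 r = #|kept 18 :&: cc r2 r|.
Proof. by rewrite (cl_parts cl) -card_ord_count; apply: eq_card => u; rewrite !inE. Qed.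

Lemma arr_bad_edge r : (0 < arrs s 20 r) = bad_edge G r2 r.
Proof.
rewrite (cl_bade cl) (count_nth (0, 0) (fun q =>
  (arrs s 14 q.1 != arrs s 14 q.2) && (arrs s 14 q.1 == r))) -has_count.
apply/hasP/existsP => [[q qE /= /andP[ne e]]|[v /existsP[u /and3P[vu e ne]]]].
  have [v [u eq]] := pairs_ord qE; exists v; apply/existsP; exists u.
  move: qE ne e; rewrite eq (mem_pairs nbP) /= => /orP[/eqP->|->]; first by rewrite eqxx.
  by rewrite /r2 eq_sym => -> ->.
exists (val v, val u); first by rewrite (mem_pairs nbP) vu orbT.
by rewrite /= eq_sym ne.
Qed.

Lemma arr_bad_degree r : (0 < arrs s 21 r) = bad_degree G r2 cls r.
Proof.
rewrite (cl_badv cl) -card_ord_count; apply/card_gt0P/existsP => -[v h]; exists v.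
  by move: h; rewrite inE arr_degree -/(cls v) arr_size arr_cnt andbC.
by rewrite inE arr_degree -/(cls v) arr_size arr_cnt andbC.
Qed.

Lemma arr_keep0 (v : 'I_n) : (0 < arrs s 22 v) = ~~ good l G r2 cls (kept 18) v.
Proof.
rewrite (cl_keep0 cl) // /keep_val -/(r2 v) /good -arr_bad_edge -arr_bad_degree.
rewrite -arr_degree -arr_cnt -arr_parts /gt0; move: (arrs s 11 v) (arrs s 20 _).
by move=> a b; move: (arrs s 21 _) (arrs s 19 _) (arrs s 15 _) => c d e; lia.
Qed.

Hypothesis l_gt1 : 1 < l.

Lemma arr_kernel :
  (yes_instance l G k <-> yes_instance l (induced G (kept 26)) k) /\
  (yes_instance l G k -> #|kept 26| <= 10 * l * k ^ 2).
Proof.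
have r1P v := min_post_ord v (cl_r1 cl); have r2P v := min_post_ord v (cl_r2 cl).
have id12 (u : 'I_n) : arrs s 12 u = u by rewrite (cl_id cl).
have r1_min (v u : 'I_n) : (u == v) || G v u -> r1 v <= u.
  by move=> /(r1P v).1; rewrite id12.
have r1_ex v : exists2 u : 'I_n, (u == v) || G v u & r1 v = u.
  by have [_ [u h e]] := r1P v; exists u; rewrite // -(id12 u).
have r2_min v u : (u == v) || G v u -> r2 v <= r1 u by apply: (r2P v).1.
have r2_ex v : exists2 u, (u == v) || G v u & r2 v = r1 u by apply: (r2P v).2.
have clsP u v : (cls u == cls v) = [forall x, G u x == G v x].
  apply/eqP/idP => [/(cl_cls cl)|h]; last apply/(cl_cls cl) => //.
    by rewrite (same_open nbP) //; apply.
  by rewrite (same_open nbP).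
have tclsP u v : (tcls u == tcls v) =
    [forall x, ((x == u) || G u x) == ((x == v) || G v x)].
  apply/eqP/idP => [/(cl_tcls cl)|h]; last apply/(cl_tcls cl) => //.
    by rewrite (same_closed nbP) //; apply.
  by rewrite (same_closed nbP).
have [le1 X1_le X1_ge] := cl_keep1 cl; have [le2 X2_le X2_ge] := cl_keep2 cl.
have sX1 : kept 24 \subset [set v | ~~ good l G r2 cls (kept 18) v].
  apply/subsetP => v; rewrite !inE -arr_keep0 => v0.
  by have := leq_trans v0 (le1 v); rewrite lt0b => /andP[].
have sX2 : kept 26 \subset kept 24.
  apply/subsetP => v; rewrite !inE => v0.
  by have := leq_trans v0 (le2 v); rewrite lt0b => /andP[].
have c1 v : #|[set u in kept 24 | cls u == cls v]| <= 2 * k + 2.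
  by rewrite card_kept.
have c2 v : #|[set u in kept 26 | tcls u == tcls v]| <= 2 * k + l.+1.
  by rewrite card_kept.
have g1 v : v \in [set v | ~~ good l G r2 cls (kept 18) v] -> v \notin kept 24 ->
    2 * k + 2 <= #|[set u in kept 24 | cls u == cls v]|.
  rewrite !inE -arr_keep0 -eqn0Ngt => v0 /eqP v1.
  by rewrite card_kept; apply: X1_ge.
have g2 v : v \in kept 24 -> v \notin kept 26 ->
    2 * k + l.+1 <= #|[set u in kept 26 | tcls u == tcls v]|.
  rewrite !inE -eqn0Ngt => v0 /eqP v1.
  by rewrite card_kept; apply: X2_ge.
split.
  exact: (kernel_equiv r1_ex r2_ex clsP arr_first_inj arr_first_ex l_gt1 tclsP
    sX1 sX2 g1 g2).
exact: (kernel_size r1_min r1_ex r2_min r2_ex clsP arr_first_inj arr_first_ex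
  l_gt1 tclsP sX1 sX2 c1 c2).
Qed.

End Kernel.

(** * A fixed no-instance and the output phase *)

Definition path4_rel : rel 'I_4 := fun i j => (val i == j.+1) || (val j == i.+1).

Lemma path4_sym : symmetric path4_rel.
Proof. by move=> i j; rewrite /path4_rel orbC. Qed.

Lemma path4_irr : irreflexive path4_rel.
Proof. by move=> i; rewrite /path4_rel orbb ltn_eqF. Qed.

Definition path4 := SGraph path4_sym path4_irr.

(** The edges put all four vertices in one class. The non-edges 0-2 and 0-3 give vertices 2 and 3
    the same [p], against the edge 2-3; this works for every [l]. *)
Lemma path4_no l : ~ yes_instance l path4 0.
Proof.
rewrite yes_instanceE => -[L [c [p [_]]]]; rewrite muln0 leqn0 cards_eq0 => /eqP/setP d0.
have E (i j : 'I_4) : path4_rel i j = (c i == c j) && (p i != p j).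
  by have := d0 (i, j); rewrite !inE /= => /negbFE/eqP.
pose v i : 'I_4 := inord i.
have V i : i < 4 -> val (v i) = i by move=> ?; rewrite /= inordK.
have := E (v 0) (v 1); have := E (v 1) (v 2); have := E (v 2) (v 3).
have := E (v 0) (v 2); have := E (v 0) (v 3).
rewrite /path4_rel !V //= => e03 e02 /esym/andP[/eqP c23 p23].
move=> /esym/andP[/eqP c12 _] /esym/andP[/eqP c01 _].
move: e03 e02; rewrite c01 c12 -c23 eqxx /= => /esym/negbFE/eqP e03 /esym/negbFE/eqP e02.
by rewrite -e03 -e02 eqxx in p23.
Qed.

Definition path4_word := [:: 4; 0; 1; 1; 2; 0; 2; 2; 1; 3; 1; 2].

Lemma path4_encodes : encodes path4 0 path4_word.
Proof.
exists (fun v => [seq u <- enum 'I_4 | path4 v u]); split.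
  move=> v; split; first by rewrite filter_uniq ?enum_uniq.
  by move=> u; rewrite mem_filter mem_enum andbT.
pose F i := [seq j <- iota 0 4 | (i == j.+1) || (j == i.+1)].
have FE (v : 'I_4) : size [seq u <- enum 'I_4 | path4 v u] ::
    map val [seq u <- enum 'I_4 | path4 v u] = size (F (val v)) :: F (val v).
  have e : map val [seq u <- enum 'I_4 | path4 v u] = F (val v).
    by rewrite /F -val_enum_ord filter_map; congr map; apply: eq_filter.
  by rewrite e -e size_map.
rewrite (eq_map FE) (map_comp (fun i => size (F i) :: F i) val) val_enum_ord.
by [].
Qed.

Fixpoint put_word i (u : seq nat) : cmd :=
  if u is x :: u' then Seq (Put 1 (Cst i) (Cst x)) (put_word i.+1 u') else Skip.

(* Register 9 receives min (max k 1) n; cutting at n keeps the loops that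
   compute the size bound linear and is harmless, the kernel having at most
   n vertices. *)
Definition clamp :=
  Seq (Asg 9 (Reg 1)) (Seq (If (Cst 1) (Reg 9) Skip (Asg 9 (Cst 1)))
    (If (Reg 9) (Reg 0) Skip (Asg 9 (Reg 0)))).

(** The threshold [Cst 3] is a conjunction of three bits: both ends kept, and distinct. An oversized
    kernel is simply overwritten by the path, since only a prefix of the output array is read. *)
Definition output l :=
  Seq rank_loop (
  Seq (histogram 2 28 src (Cst 3)
         (Plus (Plus (Get 26 src) (Get 26 dst)) (nz (absd src dst)))) (
  Seq clamp (
  Seq (mul_loop 9 10 (Cst (10 * l))) (
  Seq (mul_loop 9 11 (Reg 10)) (
  Seq emit (If (Reg 8) (Reg 11) Skip (put_word 0 path4_word))))))).

Definition kernelize l := Seq (classify l) (output l).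

Section Main.
Variables (n k l : nat) (G : sgraph 'I_n) (nb : 'I_n -> seq 'I_n).
Hypothesis nbP : forall v, uniq (nb v) /\ nb v =i G v.
Let E := pairs nb.
Let M := size E.
Let e_ i := nth (0, 0) E i.
Variable W : nat.
Hypotheses (hW : 2 * n + 2 * M + 2 * k + l + 20 < W)
  (hB : 10 * l * n.+1 * n.+1 < W) (l_gt1 : 1 < l).

Definition kernel_output s : Prop :=
  exists (n' : nat) (G' : sgraph 'I_n') (k' : nat) (w' : seq nat),
    [/\ output_is s w' /\ encodes G' k' w', k' <= k,
        yes_instance l G k <-> yes_instance l G' k' &
        n' <= 10 * l * maxn k 1 ^ 2].

Lemma run_output s0 : classified k l nb s0 ->
  run W (output l) s0 (400 * (n + M + 1)) kernel_output.
Proof.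
move=> cl; have [equiv size_le] := arr_kernel nbP cl l_gt1.
have [keep ek] : exists f, arrs s0 26 = f by eexists.
rewrite ek in equiv size_le; set X := [set v : 'I_n | 0 < keep v] in equiv size_le.
have b26 i : keep i <= 1.
  by have [/(_ i) + _ _] := cl_keep2 cl; rewrite ek => h; apply: leq_trans h _; case: (_ && _).
have keepX (v : 'I_n) : keep v = (v \in X).
  by rewrite inE; have := b26 v; case: (keep v) => [|[|]].
have hz a i : 27 <= a -> arrs s0 a i = 0 by apply: cl_zero cl a i.
have [e0 e1 eM hS hD] : [/\ regs s0 0 = n, regs s0 1 = k, regs s0 2 = M,
    forall i, i < M -> arrs s0 2 i = (e_ i).1 & forall i, i < M -> arrs s0 3 i = (e_ i).2].
  by case: cl.
move: s0 {cl} ek e0 e1 eM hS hD hz => s ek e0 e1 eM hS hD hz.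
apply: run_le; first apply: run_seq.
apply: run_weaken; first apply: run_frame; first apply: (@run_rank_loop W s n) => //.
- by lia.
- by move=> i _; rewrite ek.
- exact: leqnn.
rewrite ek; move=> s1 [[e8 h27] fr]; transport fr s.
have {}hz : forall a i, 28 <= a -> arrs s1 a i = 0.
  move=> a i h; rewrite (proj2 fr) ?hz //; first by lia.
  by rewrite /= !inE; lia.
move: {s}s1 {fr} ek e0 e1 eM hS hD hz e8 h27 => s ek e0 e1 eM hS hD hz e8 h27.
apply: run_seq; apply: run_weaken; first apply: run_frame;
  first apply: (@run_histogram W 2 28 _ _ _ s M (fun j => (e_ j).1)
    (fun j => [&& 0 < keep (e_ j).1, 0 < keep (e_ j).2 & (e_ j).1 != (e_ j).2])) => //.
- by lia.
- by move=> i; rewrite hz.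
- move=> j s' jM fr ej; rewrite /= ej; pull fr s'; rewrite ek hS // hD //.
  have [lt1 lt2] := e_lt jM; move: (e_ j).1 (e_ j).2 lt1 lt2 => x y lt1 lt2.
  have := b26 x; have := b26 y => b1 b2.
  by split; [by fits_lia | by lia | by fits_lia | by [] | by lia].
- exact: leqnn.
move=> s1 [h28 fr]; transport fr s.
move: {s hz}s1 {fr} ek e0 e1 eM hS hD e8 h27 h28 => s ek e0 e1 eM hS hD e8 h27 h28.
pose K := minn (maxn k 1) n.
apply: run_seq; apply: run_weaken; first apply: run_frame;
  first apply: (@wp_run W clamp (fun s => regs s 9 = K)) => /=.
- rewrite /K !(@upd_other _ _ 9 _ 0 isT) !upd_same !e0 !e1.
  split; first by lia.
  split; [by lia | by lia |]; case: (leqP 1 k) => h /=.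
    by split; [lia | lia |]; case: (leqP k n) => h' /=; [| split]; lia.
  split; first by lia.
  by split; [lia | lia |]; case: (leqP 1 n) => h' /=; [| split]; lia.
- exact: leqnn.
move=> s1 [e9 fr]; transport fr s.
move: {s}s1 {fr} ek e0 e1 eM hS hD e8 h27 h28 e9 => s ek e0 e1 eM hS hD e8 h27 h28 e9.
have Kn : K <= n by rewrite /K geq_minr.
have sq a : 10 * l * a * a = a * (a * (10 * l)) by rewrite mulnC [10 * l * a]mulnC.
have sq2 a : 10 * l * a ^ 2 = a * (a * (10 * l)) by rewrite -mulnn mulnA sq.
have sq_le a b : a <= b -> a * (a * (10 * l)) <= b * (b * (10 * l)).
  by move=> ab; rewrite !leq_mul.
have KB : K * (K * (10 * l)) < W.
  by apply: leq_ltn_trans hB; rewrite sq; apply: sq_le; apply: leqW.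
have KB1 : K * (10 * l) < W.
  by apply: leq_ltn_trans KB; case: (K) => // K'; rewrite leq_pmull.
have lW : 10 * l < W.
  by apply: leq_ltn_trans hB; rewrite sq mulnA leq_pmull.
apply: run_seq; apply: run_weaken; first apply: run_frame;
  first apply: (@run_mul_loop W 9 10 _ s K (10 * l)) => //.
- by lia.
- by move=> s' _; split=> //=; rewrite andbT ltnW.
- exact: leqnn.
move=> s1 [e10 fr]; transport fr s.
move: {s}s1 {fr} ek e0 e1 eM hS hD e8 h27 h28 e9 e10
  => s ek e0 e1 eM hS hD e8 h27 h28 e9 e10.
apply: run_seq; apply: run_weaken; first apply: run_frame;
  first apply: (@run_mul_loop W 9 11 _ s K (K * (10 * l))) => //.
- by lia.
- by move=> s' fr; rewrite /=; pull fr s'; rewrite e10; split=> //; rewrite andbT ltnW.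
- exact: leqnn.
move=> s1 [e11 fr]; transport fr s.
move: {s}s1 {fr} ek e0 e1 eM hS hD e8 h27 h28 e9 e10 e11
  => s ek e0 e1 eM hS hD e8 h27 h28 _ _ e11.
have cX : regs s 8 = #|X|.
  by rewrite e8 -card_ord_count; apply: eq_card => v; rewrite !inE keepX lt0b.
have Xn : #|X| <= n by apply: leq_trans (max_card _) _; rewrite card_ord.
apply: run_seq; apply: run_weaken; first apply: run_frame;
  first apply: (@run_emit W n E (pairs_bound (nb := nb)) _ _ s) => //.
- by lia.
- by rewrite -/M; lia.
- by rewrite cX; lia.
- by rewrite e1; lia.
- move=> i lt; rewrite ek b26 h27 // h28; split=> //.
    by apply: leq_trans (count_le _ _) _; lia.
  by apply: leq_trans (count_le _ _) _; lia.
- exact: leqnn.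
rewrite ek cX e1; move=> s1 [out fr].
have {}e8 : regs s1 8 = #|X| by rewrite (proj1 fr).
have {}e11 : regs s1 11 = K * (K * (10 * l)) by rewrite (proj1 fr).
have enc : encodes (induced G X) k
    (#|X| :: k :: flatten [seq out_item keep (arrs s 28) (arrs s 27) q | q <- E]).
  apply: (encodes_out k nbP) => // v; last by rewrite h27.
  move=> vX; rewrite h28.
  rewrite (count_nth (0, 0) (fun q => [&& 0 < keep q.1, 0 < keep q.2 & q.1 != q.2] && (q.1 == val v))).
  rewrite (count_degree nbP (X := X) (P := fun q => [&& 0 < keep q.1, 0 < keep q.2 & q.1 != q.2])) //.
  by move=> u; rewrite /= !keepX vX /= lt0b val_eqE eq_sym andbC.
move=> {fr ek e0 eM hS hD e1 h27}.
apply: wp_run => /=; rewrite e8 e11.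
split; [by lia | by lia |].
have [le|le] := leqP #|X| (K * (K * (10 * l))).
  exists #|X|, (induced G X), k, (#|X| :: k :: flatten [seq out_item keep (arrs s 28) (arrs s 27) q | q <- E]).
  split=> //; apply: leq_trans le _.
  by rewrite sq2; apply: sq_le; rewrite /K geq_minl.
(* If [K] is [maxn k 1], the threshold is at least the bound for yes-instances. If the cut at [n]
   was effective, the kernel would have more than [n] vertices. *)
have no : ~ yes_instance l G k.
  move/size_le; rewrite sq2 => le'; move: le; rewrite ltnNge => /negP; apply.
  have [eK|eK] : K = maxn k 1 \/ K = n by rewrite /K /minn; case: ifP; auto.
    by apply: leq_trans le' _; apply: sq_le; rewrite eK leq_maxl.
  apply: leq_trans Xn _; rewrite eK; case: (n) => // n'.
  by rewrite leq_pmulr // !muln_gt0 /=; apply: ltnW.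
do 12 (split; [by lia | by lia |]).
exists 4, path4, 0, path4_word; split=> //.
- split; last exact: path4_encodes.
  by do 12 (case=> [//|]).
- by split=> [/no|/path4_no].
(* Here [maxn k 1] matters: for [k = 0] the bound [10 * l * k ^ 2] would leave no room for the four
   vertices of the path. *)
- rewrite sq2; apply: (@leq_trans (1 * (1 * (10 * l)))); first by lia.
  by apply: sq_le; rewrite leq_maxr.
rewrite /= -/E -/M; have := geq_minr (maxn k 1) n.
by move: (M) (minn _ _) => M0 K; clear; lia.
Qed.

End Main.

Theorem theorem8 :
  exists C c d : nat, forall l : nat, 2 <= l ->
  exists P : cmd,
  forall (n : nat) (G : sgraph 'I_n) (k : nat) (w : seq nat),
  encodes G k w ->
  exists (t : nat) (s : state),
    [/\ exec ((l + n + #|edges G| + k + 2) ^ d) P (input_state w) t s,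
        t <= c * (n + #|edges G| + 1) &
        exists (n' : nat) (G' : sgraph 'I_n') (k' : nat) (w' : seq nat),
          [/\ output_is s w' /\ encodes G' k' w',
              k' <= k,
              yes_instance l G k <-> yes_instance l G' k' &
              n' <= C * l * maxn k 1 ^ 2]].
Proof.
(* The two phases take [(2000 + 400) * (n + M + 1)] steps, and [M <= n + 2 * m] costs another factor
   2. *)
exists 10, 4800, 10 => l l2; exists (kernelize l) => n G k w [nb [nbP ->]].
have Mle := size_pairs_le nbP.
set m := #|edges G| in Mle *; pose S := l + n + m + k + 2.
have S4 : 4 <= S by rewrite /S; lia.
(* Three factors [S] dominate the cubic size bound [l * n.+1 * n.+1]; the other seven, each at least
   4, absorb the numerical constants. *)
have SW : 4 ^ 7 * (S * S * S) <= S ^ 10.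
  by rewrite -[10]/(7 + 3) expnD leq_mul ?leq_exp2r // !expnSr expn0 mul1n.
have S2 : S <= S * S * S by nia.
have hW : 2 * n + 2 * size (pairs nb) + 2 * k + l + 20 < S ^ 10.
  apply: leq_trans SW; rewrite -[4 ^ 7]/(16 * 1024) -mulnA.
  by move: (S * S * S) S2 => x; rewrite /S; lia.
have hB : 10 * l * n.+1 * n.+1 < S ^ 10.
  apply: leq_trans SW; apply: (@leq_ltn_trans (10 * (S * S * S))); last first.
    by rewrite ltn_mul2r; lia.
  by rewrite -!mulnA leq_mul2l /= !leq_mul // /S; lia.
have [|t [s [x le q]]] := @run_weaken _ _ _ _ (4800 * (n + m + 1)) _ _
  (run_seq (run_weaken (run_classify nbP hW) (leqnn _) (fun s cl => run_output nbP hW hB l2 cl)))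
  _ (fun s q => q).
  by rewrite -mulnDl; lia.
by exists t, s.
Qed.
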